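(* The following decision problem is coNP-complete. Given $n,m$, rational data $c_{11},c_{21}\in\mathbb{Q}^{n}$, $c_{22}\in\mathbb{Q}$, $A_{11}\in\mathbb{Q}^{m\times n}$, $A_{12},b_1\in\mathbb{Q}^{m}$, defining the bilevel linear program with a single upper-level variable $x_2\in\mathbb{R}$ $$\min_{x_1,x_2}\ c_{21}^{\top}x_1+c_{22}x_2\quad\text{s.t.}\quad x_1\in\operatorname{argmin}_{x_1'}\{c_{11}^{\top}x_1' : A_{11}x_1'+A_{12}x_2\ge b_1,\ \mathbf{0}\le x_1'\le\mathbf{1},\ 0\le x_2\le 1\},$$ and a rational point $(x_1,x_2)\in\mathbb{Q}^{n}\times\mathbb{Q}$: is $(x_1,x_2)$ an optimal solution?
   Context: The bilevel program is understood in the optimistic sense: a pair $(x_1,x_2)\in\mathbb{R}^n\times\mathbb{R}$ is feasible if and only if $x_1$ is an optimal solution of the lower-level linear program with parameter $x_2$ (which must be feasible, so $0\le x_2\le 1$), and it is an optimal solution if it is feasible and minimizes the upper-level objective over all feasible pairs. $\mathbf{0}$ and $\mathbf{1}$ are the all-zeros and all-ones vectors. All rational data are encoded in binary. *)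

(* Defs.v *)
From HB Require Import structures.
From mathcomp Require Import all_boot all_order all_algebra.
From mathcomp Require Import reals.

Set Implicit Arguments.
Unset Strict Implicit.
Unset Printing Implicit Defensive.

Import Order.TTheory GRing.Theory Num.Theory.

Local Open Scope ring_scope.

(* [None] is the blank; [S] holds the machine's symbols other than the blank
   and the two input bits. *)
Definition symbol (S : finType) : finType := option (bool + S)%type.

Definition bit (S : finType) (b : bool) : symbol S := Some (inl b).

(* A two-way infinite tape: the head scans the first symbol of [tright], and
   [tleft] lists the cells to its left, nearest first. All the cells beyond
   the two lists are blank. *)
Record tape (S : finType) : Type :=
  Tape { tleft : seq (symbol S); tright : seq (symbol S) }.

Definition scan (S : finType) (t : tape S) : symbol S := head None (tright t).

Inductive move : Set := MoveLeft | Stay | MoveRight.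

Definition move_head (S : finType) (d : move) (t : tape S) : tape S :=
  let: Tape l r := t in
  match d with
  | MoveLeft => Tape (behead l) (head None l :: r)
  | Stay => t
  | MoveRight => Tape (head None r :: l) (behead r)
  end.

Definition act (S : finType) (a : symbol S * move) (t : tape S) : tape S :=
  move_head a.2 (Tape (tleft t) (a.1 :: behead (tright t))).

Record machine : Type := Machine {
  extra : finType;
  state : finType;
  ntapes : nat;  (* the machine has [ntapes.+1] tapes *)
  start : state;
  halted : pred state;
  delta : state -> {ffun 'I_ntapes.+1 -> symbol extra} ->
          state * {ffun 'I_ntapes.+1 -> symbol extra * move}
}.

Record config (M : machine) : Type := Config {
  cstate : state M;
  ctapes : {ffun 'I_(ntapes M).+1 -> tape (extra M)}
}.

Definition step (M : machine) (c : config M) : config M :=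
  if halted (cstate c) then c else
  let: (q, a) := delta (cstate c) [ffun i => scan (ctapes c i)] in
  Config q [ffun i => act (a i) (ctapes c i)].

(* The i-th input string is written on the i-th tape, the head scanning its
   first bit; the other tapes are blank. *)
Definition init (M : machine) (args : seq (seq bool)) : config M :=
  Config (start M) [ffun i : 'I_(ntapes M).+1 =>
    Tape [::] [seq bit (extra M) b | b <- nth [::] args i]].

(* The output string starts at the head of the tape and ends just before the
   first blank cell. *)
Definition reads (S : finType) (t : tape S) (w : seq bool) : Prop :=
  exists r, tright t = [seq bit S b | b <- w] ++ r /\ head None r = None.

(* Halted configurations are fixed by [step], so this says "in at most t
   steps"; the output is on the tape 0. *)
Definition computes_within (M : machine) (args : seq (seq bool))
    (w : seq bool) (t : nat) : Prop :=
  let c := iter t (@step M) (init M args) in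
  halted (cstate c) /\ reads (ctapes c ord0) w.

Definition language := seq bool -> Prop.

Definition polytime (f : seq bool -> seq bool) : Prop :=
  exists (M : machine) (p : {poly nat}),
    forall x, computes_within M [:: x] (f x) p.[size x].

Definition NP (L : language) : Prop :=
  exists (V : seq bool -> seq bool -> bool) (M : machine) (p q : {poly nat}),
    (forall x y, computes_within M [:: x; y] [:: V x y] p.[(size x + size y)%N])
    /\ (forall x, L x <-> exists y, (size y <= q.[size x])%N /\ V x y).

Definition coNP (L : language) : Prop := NP (fun x => ~ L x).

Definition reducible (L1 L2 : language) : Prop :=
  exists f, polytime f /\ forall x, L1 x <-> L2 (f x).

Definition coNP_complete (L : language) : Prop :=
  coNP L /\ forall L', coNP L' -> reducible L' L.

(* The language of a decision problem with instances in [I], encoded by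
   [enc]; strings that encode no instance are outside the language. *)
Definition language_of (I : Type) (enc : I -> seq bool) (yes : I -> Prop) :
    language :=
  fun w => exists x, enc x = w /\ yes x.

(* Binary digits, least significant first; [up_log 2 n.+1] is the number of
   binary digits of [n], which is 0 for [n = 0]. *)
Definition binary (n : nat) : seq bool :=
  [seq odd (n %/ 2 ^ i)%N | i <- iota 0 (up_log 2 n.+1)].

(* Each digit is preceded by [true] and the number is terminated by [false],
   which makes the code prefix-free. *)
Definition encode_nat (n : nat) : seq bool :=
  flatten [seq [:: true; b] | b <- binary n] ++ [:: false].

Definition encode_int (z : int) : seq bool := (z < 0) :: encode_nat `|z|%N.

Definition encode_rat (q : rat) : seq bool :=
  encode_int (numq q) ++ encode_nat `|denq q|%N.

(* Row by row; the dimensions are encoded separately. *)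
Definition encode_mx (m n : nat) (A : 'M[rat]_(m, n)) : seq bool :=
  flatten [seq flatten [seq encode_rat (A i j) | j <- enum 'I_n]
          | i <- enum 'I_m].

Record bilevel (n m : nat) : Type := Bilevel {
  c11 : 'cV[rat]_n;
  c21 : 'cV[rat]_n;
  c22 : rat;
  A11 : 'M[rat]_(m, n);
  A12 : 'cV[rat]_m;
  b1 : 'cV[rat]_m
}.

Section Semantics.
Variables (R : realType) (n m : nat) (P : bilevel n m).

Local Notation real_mx := (map_mx (ratr : rat -> R)).

Definition dot (c : 'cV[rat]_n) (x : 'cV[R]_n) : R := ((real_mx c)^T *m x) 0 0.

Definition lower_feasible (x2 : R) (x1 : 'cV[R]_n) : Prop :=
  [/\ forall i, real_mx (b1 P) i 0
                  <= (real_mx (A11 P) *m x1 + x2 *: real_mx (A12 P)) i 0,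
      forall j, 0 <= x1 j 0 <= 1
    & 0 <= x2 <= 1].

Definition lower_optimal (x2 : R) (x1 : 'cV[R]_n) : Prop :=
  lower_feasible x2 x1 /\
  forall x1', lower_feasible x2 x1' -> dot (c11 P) x1 <= dot (c11 P) x1'.

Definition upper_objective (x1 : 'cV[R]_n) (x2 : R) : R :=
  dot (c21 P) x1 + ratr (c22 P) * x2.

Definition bilevel_feasible (x1 : 'cV[R]_n) (x2 : R) : Prop :=
  lower_optimal x2 x1.

Definition bilevel_optimal (x1 : 'cV[R]_n) (x2 : R) : Prop :=
  bilevel_feasible x1 x2 /\
  forall x1' x2', bilevel_feasible x1' x2' ->
    upper_objective x1 x2 <= upper_objective x1' x2'.

End Semantics.

Record query : Type := Query {
  qn : nat;
  qm : nat;
  program : bilevel qn qm;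
  point1 : 'cV[rat]_qn;
  point2 : rat
}.

Definition encode_query (Q : query) : seq bool :=
  let P := program Q in
  encode_nat (qn Q) ++ encode_nat (qm Q)
  ++ encode_mx (c11 P) ++ encode_mx (c21 P) ++ encode_rat (c22 P)
  ++ encode_mx (A11 P) ++ encode_mx (A12 P) ++ encode_mx (b1 P)
  ++ encode_mx (point1 Q) ++ encode_rat (point2 Q).

Definition query_optimal (R : realType) (Q : query) : Prop :=
  @bilevel_optimal R (qn Q) (qm Q) (program Q)
    (map_mx (ratr : rat -> R) (point1 Q)) (ratr (point2 Q)).

(* Main.v *)
(* Membership. A point is not optimal if it is infeasible for the lower level, or
   if some lower-level feasible point has a smaller lower-level cost, or if some
   bilevel feasible pair has a smaller upper-level objective. By linear
   programming duality, bilevel feasibility of (x1, x2) amounts to the existence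
   of multipliers satisfying dual feasibility and complementary slackness. Once
   the tight constraints are fixed, all these are systems of linear inequalities
   in which a solution with the largest set of tight rows is determined by a
   nonsingular subsystem; by Cramer's rule it has polynomially many bits, hence
   is a certificate of non-optimality.

   Hardness. A problem in coNP reduces to unsatisfiability of formulas through
   the tableau of a machine verifying its complement. The lower level imposes
   lower bounds on its variables that depend affinely on x2 and on the previous
   variables; with rapidly decreasing costs its unique optimum sets each
   variable to the positive part of its bound. Thus x1 is the state of a network
   of truncated affine gates with input x2. An iterated expanding map extracts
   from x2 an arbitrary sequence of truth values, and further gates compute a
   number that is positive for some x2 if and only if the formula is
   satisfiable. This number is 0 at x2 = 0, and the upper level maximizes it. *)

From mathcomp Require Import all_boot all_order all_algebra all_fingroup.
From mathcomp Require Import reals zify ring lra.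
Require Import Defs.

Set Implicit Arguments.
Unset Strict Implicit.
Unset Printing Implicit Defensive.

(** Membership and the reduction both end in concrete multitape machines, so polynomial time has to
    be made compositional: a small stack language is compiled with exact step counts, and functions
    on tree-coded data are composed inside it. Iteration is where closure can fail, since an
    accumulator may grow exponentially; every fold therefore carries a size bound. The improvement
    shown by a certificate is strict, while vertices belong to closed polyhedra; homogenising with
    one extra coordinate replaces the strict inequality by one with right-hand side 1. Encoded
    rationals are in lowest terms, and the verifier must accept a string that violates this: the
    certificate then names a common factor, so that checking it takes only multiplications. In the
    network the gates are scaled by u = min(1, 2 x2) instead of 1. At x2 = 0 all gates but the first
    vanish, so the candidate point can be written down without knowing anything about the formula;
    for x2 >= 1/2 the scale is 1 and 2 x2 - 1 still runs through [0, 1]. *)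

Local Notation "p .[ n ]" := (horner p n%N) : nat_scope.

(** * A structured language on four stacks of bits *)

Inductive reg : Set := R0 | R1 | R2 | R3.

Definition store : Type := seq bool * seq bool * seq bool * seq bool.

Definition get (r : reg) (s : store) : seq bool :=
  let: (a, b, c, d) := s in
  match r with R0 => a | R1 => b | R2 => c | R3 => d end.

Definition put (r : reg) (w : seq bool) (s : store) : store :=
  let: (a, b, c, d) := s in
  match r with
  | R0 => (w, b, c, d) | R1 => (a, w, c, d)
  | R2 => (a, b, w, d) | R3 => (a, b, c, w)
  end.

Inductive cmd : Type :=
  | Skip
  | Push of reg & bool
  | Pop of reg
  | Seq of cmd & cmd
  | Case of reg & cmd & cmd & cmd
  | While of reg & pred (option bool) & cmd.

Definition branch (o : option bool) (c0 cf ct : cmd) : cmd :=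
  match o with None => c0 | Some false => cf | Some true => ct end.

(* The last argument is the exact number of steps of the machine below. *)
Inductive exec : cmd -> store -> store -> nat -> Prop :=
  | ExecSkip s : exec Skip s s 0
  | ExecPush r b s : exec (Push r b) s (put r (b :: get r s) s) 2
  | ExecPop r s : exec (Pop r) s (put r (behead (get r s)) s) 1
  | ExecSeq c1 c2 s1 s2 s3 t1 t2 : exec c1 s1 s2 t1 -> exec c2 s2 s3 t2 ->
      exec (Seq c1 c2) s1 s3 (t1 + t2)
  | ExecCase r c0 cf ct s1 s2 t :
      exec (branch (ohead (get r s1)) c0 cf ct) s1 s2 t ->
      exec (Case r c0 cf ct) s1 s2 t.+1
  | ExecStop r (P : pred (option bool)) c s : ~~ P (ohead (get r s)) -> exec (While r P c) s s 1
  | ExecLoop r (P : pred (option bool)) c s1 s2 s3 t1 t2 : P (ohead (get r s1)) ->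
      exec c s1 s2 t1 -> exec (While r P c) s2 s3 t2 ->
      exec (While r P c) s1 s3 (t1 + t2).+1.

(** * Compilation to machines *)

Definition reg_of (i : 'I_4) : reg :=
  match val i with 0 => R0 | 1 => R1 | 2 => R2 | _ => R3 end.

Definition ord_of (r : reg) : 'I_4 :=
  match r with
  | R0 => @Ordinal 4 0 isT | R1 => @Ordinal 4 1 isT
  | R2 => @Ordinal 4 2 isT | R3 => @Ordinal 4 3 isT
  end.

Lemma reg_ofK i : ord_of (reg_of i) = i.
Proof. by case: i => [[|[|[|[|//]]]] ?]; apply/val_inj. Qed.

Lemma ord_ofK r : reg_of (ord_of r) = r.
Proof. by case: r. Qed.

Lemma get_put r r' w s : get r' (put r w s) = if ord_of r' == ord_of r then w else get r' s.
Proof. by case: s => [[[a b] c] d]; case: r r' => [] []. Qed.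

Local Notation sym := (symbol void).
Definition bits (w : seq bool) : seq sym := [seq bit void b | b <- w].

(** The top of the stack is under the head. Head moves leave explicit blanks behind them, so a stack
    is represented only up to blanks on both sides. *)
Definition holds (w : seq bool) (t : tape void) : Prop :=
  exists a b, t = Tape (nseq a None) (bits w ++ nseq b None).

(** The middle of a push: the head has moved onto the blank to the left of the word and is about to
    overwrite it. *)
Definition holds_gap (w : seq bool) (t : tape void) : Prop :=
  exists a b, t = Tape (nseq a None) (None :: bits w ++ nseq b None).

Definition scanned_bit (s : sym) : option bool :=
  match s with Some (inl b) => Some b | _ => None end.

Lemma scan_holds w t : holds w t -> scan t = oapp (bit void) None (ohead w).
Proof. by case=> a [b ->]; case: w => // ; case: b. Qed.

Lemma stay_holds w t : holds w t -> holds w (act (scan t, Stay) t).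
Proof.
case=> a [b ->]; case: w => [|x w]; last by exists a, b.
by case: b => [|b]; [exists a, 1 | exists a, b.+1].
Qed.

Lemma left_holds w t : holds w t -> holds_gap w (act (scan t, MoveLeft) t).
Proof.
case=> a [b ->]; case: w => [|x w]; last by exists a.-1, b; case: a.
by exists a.-1, b.-1.+1; case: a; case: b.
Qed.

Lemma write_gap w t x : holds_gap w t -> holds (x :: w) (act (bit void x, Stay) t).
Proof. by case=> a [b ->]; exists a, b. Qed.

Lemma erase_holds x w t : holds (x :: w) t -> holds w (act (None, MoveRight) t).
Proof. by case=> a [b ->]; exists a.+1, b. Qed.

Definition reading := {ffun 'I_4 -> sym}.
Definition action := {ffun 'I_4 -> sym * move}.

Definition act_on (r : reg) (a : sym * move) (s : reading) : action :=
  [ffun i => if i == ord_of r then a else (s i, Stay)].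

Definition idle (s : reading) : action := [ffun i => (s i, Stay)].

Fixpoint control (c : cmd) : finType :=
  match c with
  | Skip => void | Push _ _ => bool | Pop _ => unit
  | Seq c1 c2 => (control c1 + control c2)%type
  | Case _ c0 cf ct => option (control c0 + (control cf + control ct))
  | While _ _ c => option (control c)
  end.

(** [None] is for a command that takes no step at all; control then passes directly to whatever
    follows it. *)
Fixpoint entry (c : cmd) : option (control c) :=
  match c with
  | Skip => None
  | Push _ _ => Some false
  | Pop _ => Some tt
  | Seq c1 c2 => match entry c1 with
                 | Some q => Some (inl q) | None => omap inr (entry c2) end
  | Case _ _ _ _ => Some None
  | While _ _ _ => Some None
  end.

(* The state [None] of a [Case] or a [While] performs the test; in a
   transition, the result [None] leaves the command. *)
Fixpoint next (c : cmd) : control c -> reading -> option (control c) * action :=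
  match c with
  | Skip => fun q s => (None, idle s)
  | Push r b => fun q s =>
      if q then (None, act_on r (bit void b, Stay) s)
      else (Some true, act_on r (s (ord_of r), MoveLeft) s)
  | Pop r => fun q s =>
      (None, if s (ord_of r) is Some _ then act_on r (None, MoveRight) s else idle s)
  | Seq c1 c2 => fun q s =>
      match q with
      | inl q => let: (q', a) := next q s in
          (match q' with Some q' => Some (inl q') | None => omap inr (entry c2) end, a)
      | inr q => let: (q', a) := next q s in (omap inr q', a)
      end
  | Case r c0 cf ct => fun q s =>
      match q with
      | None =>
          (match scanned_bit (s (ord_of r)) with
           | None => omap (fun q => Some (inl q)) (entry c0)
           | Some false => omap (fun q => Some (inr (inl q))) (entry cf)
           | Some true => omap (fun q => Some (inr (inr q))) (entry ct)
           end, idle s)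
      | Some (inl q) =>
          let: (q', a) := next q s in (omap (fun q => Some (inl q)) q', a)
      | Some (inr (inl q)) =>
          let: (q', a) := next q s in (omap (fun q => Some (inr (inl q))) q', a)
      | Some (inr (inr q)) =>
          let: (q', a) := next q s in (omap (fun q => Some (inr (inr q))) q', a)
      end
  | While r P c => fun q s =>
      match q with
      | None => (if P (scanned_bit (s (ord_of r))) then
                   match entry c with Some q => Some (Some q) | None => Some None end
                 else None, idle s)
      | Some q => let: (q', a) := next q s in (Some q', a)
      end
  end.

Definition machine_of (c : cmd) : machine :=
  @Machine void (option (control c)) 3 (entry c) (fun q => ~~ isSome q)
    (fun q s => match q with None => (None, idle s) | Some q => next q s end).

Section Simulation.
Variables (M : cmd).
Local Notation mach := (machine_of M).

Definition represents (s : store) (k : config mach) (q : option (control M)) : Prop :=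
  cstate k = q /\ forall i, holds (get (reg_of i) s) (ctapes k i).

(* [e] embeds the control of the subcommand [c] into that of [M]; [k] is where
   [M] continues after [c]. *)
Definition embedded c (e : control c -> control M) (k : option (control M)) :=
  forall q s, next (e q) s = (oapp (fun q => Some (e q)) k (next q s).1, (next q s).2).

Definition steps_to (s : store) q (s' : store) q' (t : nat) : Prop :=
  forall k, represents s k q ->
    represents s' (iter t (@step mach) k) q'.

Lemma steps_trans s1 q1 s2 q2 s3 q3 t1 t2 :
  steps_to s1 q1 s2 q2 t1 -> steps_to s2 q2 s3 q3 t2 ->
  steps_to s1 q1 s3 q3 (t1 + t2).
Proof. by move=> H1 H2 k /H1 /H2; rewrite addnC iterD. Qed.

Lemma step_some (k : config mach) q : cstate k = Some q ->
  step k = Config (M := mach) (next q [ffun i => scan (ctapes k i)]).1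
     [ffun i => act ((next q [ffun i => scan (ctapes k i)]).2 i) (ctapes k i)].
Proof.
rewrite /step => Hq; have -> : halted (cstate k) = false by rewrite Hq.
have -> : delta (cstate k) [ffun i => scan (ctapes k i)]
  = next q [ffun i => scan (ctapes k i)] by rewrite /= Hq.
by case: (next q _).
Qed.

Lemma idle_step s (q : control M) q' :
  (forall v : reading, (forall i, scanned_bit (v i) = ohead (get (reg_of i) s)) ->
     next q v = (q', idle v)) ->
  steps_to s (Some q) s q' 1.
Proof.
move=> H k [Hq Ht] /=; rewrite (step_some Hq) H; last first.
  by move=> i; rewrite ffunE (scan_holds (Ht i)); case: (ohead _).
by split=> //= i; rewrite !ffunE; apply: stay_holds.
Qed.

(** The embedding and the continuation are arbitrary so that the induction on the execution reaches
    subcommands; the body of a loop, for instance, continues in the test state of the loop. *)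
Lemma sim c s s' t : exec c s s' t ->
  forall e k, embedded e k ->
  steps_to s (oapp (fun q => Some (e q)) k (entry c)) s' k t.
Proof.
elim=> {c s s' t}.
- by move=> s e k _ k0.
- move=> r b s e k He k0 [Hq Ht] /=.
  have H1 := step_some (k := k0) Hq.
  rewrite He /= in H1; set k1 := step k0 in H1 *.
  have Hq1 : cstate k1 = Some (e true) by rewrite H1.
  rewrite (step_some Hq1) He /=; split=> //= i.
  rewrite !ffunE get_put reg_ofK.
  have [Ei|Ni] := eqVneq i (ord_of r).
    rewrite Ei; apply: write_gap; rewrite H1 /= !ffunE eqxx.
    by rewrite -{1}(ord_ofK r); apply: left_holds.
  apply: stay_holds; rewrite H1 /= !ffunE (negPf Ni).
  exact: stay_holds.
- move=> r s e k He k0 [Hq Ht] /=.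
  rewrite (step_some Hq) He /=; split=> //= i.
  rewrite get_put reg_ofK !ffunE (scan_holds (Ht _)) ord_ofK.
  case E: (get r s) => [|x w] /=; rewrite !ffunE.
    by case: eqP => [->|_]; [rewrite -E -{1}(ord_ofK r)|]; apply: stay_holds.
  case: eqP => [->|_]; last exact: stay_holds.
  by apply: (@erase_holds x); rewrite -E -{1}(ord_ofK r).
- move=> c1 c2 s1 s2 s3 t1 t2 _ IH1 _ IH2 e k He.
  set k1 := oapp (fun q => Some (e (inr q))) k (entry c2).
  have H1 : embedded (fun q => e (inl q)) k1.
    move=> q s; rewrite He /=; case: (next q s) => [[q'|] a] //=.
    by rewrite /k1; case: (entry c2).
  have H2 : embedded (fun q => e (inr q)) k.
    by move=> q s; rewrite He /=; case: (next q s) => [[q'|] a].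
  have -> : oapp (fun q => Some (e q)) k (entry (Seq c1 c2))
          = oapp (fun q => Some (e (inl q))) k1 (entry c1).
    by rewrite /= /k1; case: (entry c1) => //; case: (entry c2).
  exact: steps_trans (IH1 _ _ H1) (IH2 _ _ H2).
- move=> r c0 cf ct s1 s2 t _ IH e k He /=; rewrite -add1n.
  have H0 : embedded (fun q => e (Some (inl q))) k.
    by move=> q s; rewrite He /=; case: (next q s) => [[q'|] a].
  have Hf : embedded (fun q => e (Some (inr (inl q)))) k.
    by move=> q s; rewrite He /=; case: (next q s) => [[q'|] a].
  have Ht : embedded (fun q => e (Some (inr (inr q)))) k.
    by move=> q s; rewrite He /=; case: (next q s) => [[q'|] a].
  have Hi (v : reading) : (forall i, scanned_bit (v i) = ohead (get (reg_of i) s1)) ->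
    scanned_bit (v (ord_of r)) = ohead (get r s1) by move=> ->; rewrite ord_ofK.
  case: (ohead (get r s1)) IH Hi => [[]|] IH Hi.
  + apply: steps_trans (IH _ _ Ht); apply: idle_step => v /Hi Hv.
    by rewrite He /= Hv; case: (entry ct).
  + apply: steps_trans (IH _ _ Hf); apply: idle_step => v /Hi Hv.
    by rewrite He /= Hv; case: (entry cf).
  + apply: steps_trans (IH _ _ H0); apply: idle_step => v /Hi Hv.
    by rewrite He /= Hv; case: (entry c0).
- move=> r P c s HP e k He /=.
  apply: idle_step => v Hv.
  by rewrite He /= Hv ord_ofK (negPf HP).
- move=> r P c s1 s2 s3 t1 t2 HP _ IH1 _ IH2 e k He /=.
  rewrite -add1n addnA.
  have Hc : embedded (fun q => e (Some q)) (Some (e None)).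
    by move=> q s; rewrite He /=; case: (next q s) => [[q'|] a].
  apply: steps_trans (IH2 _ _ He); apply: steps_trans (IH1 _ _ Hc).
  apply: idle_step => v Hv.
  by rewrite He /= Hv ord_ofK HP; case: (entry c).
Qed.

End Simulation.

Definition args_store (args : seq (seq bool)) : store :=
  (nth [::] args 0, nth [::] args 1, nth [::] args 2, nth [::] args 3).

Lemma step_halted M (k : config M) n : halted (cstate k) -> iter n (@step M) k = k.
Proof. by move=> Hk; elim: n => //= n ->; rewrite /step Hk. Qed.

Lemma machine_ofP c args s t t' : exec c (args_store args) s t -> t <= t' ->
  computes_within (machine_of c) args (get R0 s) t'.
Proof.
move=> H le; rewrite /computes_within -(subnK le) iterD.
have He : embedded (M := c) (c := c) id None.
  by move=> q v /=; case: (next q v) => [[q'|] a].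
have Hi : represents (args_store args) (init (machine_of c) args) (entry c).
  split=> // i; rewrite ffunE; exists 0, 0; rewrite cats0; congr (Tape _ (bits _)).
  by case: i => [[|[|[|[|//]]]] ?].
have := sim H He; case: (entry c) Hi => [q|] Hi /(_ _ Hi) [Hq Ht];
 rewrite step_halted Hq //; split=> //; have [a [b ->]] := Ht ord0;
 by exists (nseq b None); split=> //; case: b.
Qed.

(** * Trees as self-delimiting words, and the accounting of time *)

Inductive tree : Set := Lf | Nd of tree & tree.

(** Preorder makes the code prefix-free, so the items of a stack are written one after the other
    without separators. *)
Fixpoint enc (t : tree) : seq bool :=
  if t is Nd a b then true :: enc a ++ enc b else [:: false].

Definition sz (t : tree) : nat := size (enc t).

Definition encs (l : seq tree) : seq bool := flatten [seq enc t | t <- l].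

Lemma sz_Nd a b : sz (Nd a b) = (sz a + sz b).+1.
Proof. by rewrite /sz /= size_cat. Qed.

Lemma sz_gt0 t : 0 < sz t.
Proof. by case: t. Qed.

Lemma encs_cons t l : encs (t :: l) = enc t ++ encs l.
Proof. by []. Qed.

Lemma encs_cat l l' : encs (l ++ l') = encs l ++ encs l'.
Proof. by rewrite /encs map_cat flatten_cat. Qed.

Definition szs (l : seq tree) : nat := size (encs l).

Lemma szs_cons t l : szs (t :: l) = sz t + szs l.
Proof. by rewrite /szs encs_cons size_cat. Qed.

Lemma szs_cat l l' : szs (l ++ l') = szs l + szs l'.
Proof. by rewrite /szs encs_cat size_cat. Qed.

Lemma szs_nil : szs [::] = 0. Proof. by []. Qed.

Definition run c s s' T : Prop := exists2 t, t <= T & exec c s s' t.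

Lemma run_le c s s' T T' : run c s s' T -> T <= T' -> run c s s' T'.
Proof. by case=> t le H le'; exists t => //; apply: leq_trans le'. Qed.

Lemma run_seq c1 c2 s1 s2 s3 T1 T2 :
  run c1 s1 s2 T1 -> run c2 s2 s3 T2 -> run (Seq c1 c2) s1 s3 (T1 + T2).
Proof.
case=> t1 le1 H1 [t2 le2 H2]; exists (t1 + t2); first exact: leq_add.
exact: ExecSeq H1 H2.
Qed.

Lemma run_loop r (P : pred (option bool)) c s1 s2 s3 T1 T2 :
  P (ohead (get r s1)) -> run c s1 s2 T1 -> run (While r P c) s2 s3 T2 ->
  run (While r P c) s1 s3 (T1 + T2).+1.
Proof.
move=> HP [t1 le1 H1] [t2 le2 H2]; exists (t1 + t2).+1; last exact: ExecLoop H1 H2.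
by rewrite ltnS leq_add.
Qed.

Lemma run_case r c0 cf ct s1 s2 T :
  run (branch (ohead (get r s1)) c0 cf ct) s1 s2 T ->
  run (Case r c0 cf ct) s1 s2 T.+1.
Proof. by case=> t le H; exists t.+1 => //; apply: ExecCase. Qed.

Lemma run_exec c s s' t : exec c s s' t -> run c s s' t.
Proof. by exists t. Qed.

Definition total (s : store) : nat :=
  let: (a, b, c, d) := s in size a + size b + size c + size d.

(** A step adds at most one bit. Time bounds therefore bound the outputs as well, which is what
    composition needs. *)
Lemma exec_size c s s' t : exec c s s' t -> total s' <= total s + t.
Proof.
elim=> {c s s' t}; try by lia.
- by move=> [] b [[[x y] z] u] /=; lia.
- by move=> [] [[[x y] z] u] /=; rewrite size_behead; lia.
Qed.

(** * Moving, copying and deleting the items of a stack *)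

Definition pour (i j : reg) : cmd :=
  While i isSome (Case i Skip (Seq (Pop i) (Push j false)) (Seq (Pop i) (Push j true))).

Definition pour2 (i j k : reg) : cmd :=
  While i isSome (Case i Skip (Seq (Pop i) (Seq (Push j false) (Push k false)))
                              (Seq (Pop i) (Seq (Push j true) (Push k true)))).

Definition clear (i : reg) : cmd := While i isSome (Pop i).

Lemma run_pour i j s : ord_of i != ord_of j ->
  run (pour i j) s (put j (rev (get i s) ++ get j s) (put i [::] s)) (5 * size (get i s) + 1).
Proof.
move=> nij; move E: (get i s) => w; elim: w s E => [|x w IH] s E.
  apply: run_exec; have -> : put j (rev [::] ++ get j s) (put i [::] s) = s.
    by clear -E; move: E; case: s => [[[a b] c] d]; case: i; case: j => /= ->.
  by apply: ExecStop; rewrite E.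
set s1 := put j (x :: get j s) (put i w s).
have Ei : get i s1 = w by rewrite !get_put (negPf nij) eqxx.
have := IH _ Ei; set s2 := put j _ _ => H2.
have -> : put j (rev (x :: w) ++ get j s) (put i [::] s) = s2.
  rewrite /s2 get_put eqxx rev_cons cat_rcons /s1.
  by clear -nij; case: s => [[[a b] c] d]; case: i nij; case: j.
apply: (@run_le _ _ _ (4 + (5 * size w + 1)).+1); last by rewrite /=; lia.
apply: run_loop H2; first by rewrite E.
rewrite -[4]/3.+1; apply: run_case; rewrite E /=.
have Epop : exec (Pop i) s (put i w s) 1.
  by have := ExecPop i s; rewrite E.
have Epush : exec (Push j x) (put i w s) s1 2.
  have := ExecPush j x (put i w s).
  by rewrite get_put eq_sym (negPf nij).
clearbody s1; apply: run_exec.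
by case: x E Epush => _ Epush; apply: ExecSeq Epop Epush.
Qed.

Lemma run_pour2 a b d : run (pour2 R2 R0 R3) (a, b, d, [::])
  (rev d ++ a, b, [::], rev d) (7 * size d + 1).
Proof.
suff H e : run (pour2 R2 R0 R3) (a, b, d, e) (rev d ++ a, b, [::], rev d ++ e) (7 * size d + 1).
  by have := H [::]; rewrite cats0.
elim: d a e => [|x d IH] a e; first by apply: run_exec; apply: ExecStop.
apply: (@run_le _ _ _ (6 + (7 * size d + 1)).+1); last by rewrite /=; lia.
apply: run_loop => //; last by rewrite rev_cons !cat_rcons; apply: IH.
rewrite -[6]/(1 + (2 + 2)).+1; apply: run_case => /=.
by case: x => /=; apply: run_exec; apply: ExecSeq;
  [exact: (ExecPop R2)| |exact: (ExecPop R2)|];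
  (apply: ExecSeq; [exact: (ExecPush R0)|exact: (ExecPush R3)]).
Qed.

Lemma run_clear a b d : run (clear R2) (a, b, d, [::]) (a, b, [::], [::]) (2 * size d + 1).
Proof.
elim: d => [|x d IH]; first by apply: run_exec; apply: ExecStop.
apply: (@run_le _ _ _ (1 + (2 * size d + 1)).+1); last by rewrite /=; lia.
by apply: run_loop IH => //; apply: run_exec; exact: (ExecPop R2).
Qed.

(* The stack 3 counts in unary the subtrees still to be moved. *)
Definition mv_body (r : reg) : cmd :=
  Case R0 Skip (Seq (Pop R0) (Seq (Push r false) (Pop R3)))
               (Seq (Pop R0) (Seq (Push r true) (Push R3 true))).

Definition mv_loop (r : reg) : cmd := While R3 isSome (mv_body r).

Definition mv (r : reg) : cmd := Seq (Push R3 true) (mv_loop r).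

Definition pile (r : reg) (w : seq bool) (b c : seq bool) : seq bool * seq bool :=
  match r with R1 => (w ++ b, c) | _ => (b, w ++ c) end.

Lemma run_mv_loop r t rest b c n s T : (r = R1 \/ r = R2) ->
  run (mv_loop r) (rest, (pile r (rev (enc t)) b c).1, (pile r (rev (enc t)) b c).2, nseq n true) s T ->
  run (mv_loop r) (enc t ++ rest, b, c, nseq n.+1 true) s (7 * sz t + T).
Proof.
move=> Hr; elim: t rest b c n T => [|t1 IH1 t2 IH2] rest b c n T H.
  apply: (@run_le _ _ _ (5 + T).+1); last by rewrite /sz /=; lia.
  apply: run_loop H => //; rewrite -[5]/(1 + (2 + 1)).+1; apply: run_case => /=.
  apply: run_exec; apply: ExecSeq; first exact: (ExecPop R0).
  by case: Hr => ->; apply: ExecSeq; [exact: (ExecPush R1)|exact: (ExecPop R3)|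
     exact: (ExecPush R2)|exact: (ExecPop R3)].
apply: (@run_le _ _ _ (6 + (7 * sz t1 + (7 * sz t2 + T))).+1); last by rewrite sz_Nd; lia.
set b' := (pile r [:: true] b c).1; set c' := (pile r [:: true] b c).2.
apply: (@run_loop _ _ _ _ (enc t1 ++ (enc t2 ++ rest), b', c', nseq n.+2 true)) => //.
  rewrite -[6]/(1 + (2 + 2)).+1; apply: run_case => /=.
  apply: run_exec; apply: ExecSeq; first exact: (ExecPop R0).
  rewrite /b' /c' catA.
  by case: Hr => ->; apply: ExecSeq; [exact: (ExecPush R1)|exact: (ExecPush R3)|
     exact: (ExecPush R2)|exact: (ExecPush R3)].
apply: IH1; apply: IH2; move: H; rewrite /b' /c'.
by case: Hr => -> /=; rewrite rev_cons rev_cat cat_rcons -?catA.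
Qed.

Lemma run_mv r t rest b c : (r = R1 \/ r = R2) ->
  run (mv r) (enc t ++ rest, b, c, [::])
    (rest, (pile r (rev (enc t)) b c).1, (pile r (rev (enc t)) b c).2, [::]) (10 * sz t).
Proof.
move=> Hr; apply: (@run_le _ _ _ (2 + (7 * sz t + 1))); last by have := sz_gt0 t; lia.
apply: run_seq; first by apply: run_exec; exact: (ExecPush R3).
by apply: (@run_mv_loop _ _ _ _ _ 0) => //; apply: run_exec; apply: ExecStop.
Qed.

Fixpoint mvs (k : nat) : cmd := if k is k'.+1 then Seq (mv R1) (mvs k') else Skip.

Lemma run_mvs l rest b : run (mvs (size l)) (encs l ++ rest, b, [::], [::])
  (rest, rev (encs l) ++ b, [::], [::]) (10 * szs l).
Proof.
elim: l b => [|t l IH] b; first by apply: run_exec; apply: ExecSkip.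
rewrite szs_cons mulnDr encs_cons -catA rev_cat -catA /=.
by apply: run_seq (IH _); apply: run_mv; left.
Qed.

(** Between commands, [R0] is a stack of trees and the other three stacks are empty scratch
    space. *)
Definition runs c (l l' : seq tree) T : Prop :=
  forall rest, run c (encs l ++ rest, [::], [::], [::]) (encs l' ++ rest, [::], [::], [::]) T.

(** Each transfer reverses a word. The item goes reversed to [R2] and comes back upright on both
    [R0] and [R3]; the second copy needs two more reversals, through [R2], to land upright on
    top. *)
Definition copy_item (k : nat) : cmd :=
  Seq (mvs k) (Seq (mv R2) (Seq (pour2 R2 R0 R3) (Seq (pour R1 R0)
    (Seq (pour R3 R2) (pour R2 R0))))).

Definition delete_item (k : nat) : cmd :=
  Seq (mvs k) (Seq (mv R2) (Seq (clear R2) (pour R1 R0))).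

Lemma runs_frame c l l' T r : runs c l l' T -> runs c (l ++ r) (l' ++ r) T.
Proof. by move=> H rest; rewrite !encs_cat -!catA. Qed.

Lemma runs_le c l l' T T' : runs c l l' T -> T <= T' -> runs c l l' T'.
Proof. by move=> H le rest; apply: run_le le. Qed.

Lemma runs_seq c1 c2 l1 l2 l3 T1 T2 :
  runs c1 l1 l2 T1 -> runs c2 l2 l3 T2 -> runs (Seq c1 c2) l1 l3 (T1 + T2).
Proof. by move=> H1 H2 rest; apply: run_seq. Qed.

Lemma runs_copy l t r : runs (copy_item (size l)) (l ++ t :: r) (t :: l ++ t :: r) (40 * szs (l ++ [:: t])).
Proof.
move=> rest; rewrite szs_cat szs_cons szs_nil addn0.
rewrite encs_cons !encs_cat encs_cons -!catA; set e := encs r ++ rest.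
apply: (@run_le _ _ _ (10 * szs l + (10 * sz t + ((7 * sz t + 1) + ((5 * szs l + 1) + ((5 * sz t + 1) + (5 * sz t + 1)))))));
  last by have := sz_gt0 t; lia.
apply: run_seq; first exact: run_mvs.
apply: run_seq; first by apply: run_mv; right.
rewrite /= !cats0.
apply: run_seq; first by rewrite /sz -(size_rev (enc t)); apply: run_pour2.
rewrite revK; apply: run_seq.
  have := @run_pour R1 R0 (enc t ++ e, rev (encs l), [::], enc t) isT.
  by rewrite /= size_rev revK; exact.
apply: run_seq.
  have := @run_pour R3 R2 (encs l ++ enc t ++ e, [::], [::], enc t) isT.
  by rewrite /= cats0; exact.
have := @run_pour R2 R0 (encs l ++ enc t ++ e, [::], rev (enc t), [::]) isT.
by rewrite /= size_rev revK; exact.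
Qed.

Lemma runs_delete l t r : runs (delete_item (size l)) (l ++ t :: r) (l ++ r) (20 * szs (l ++ [:: t])).
Proof.
move=> rest; rewrite szs_cat szs_cons szs_nil addn0.
rewrite !encs_cat encs_cons -!catA; set e := encs r ++ rest.
apply: (@run_le _ _ _ (10 * szs l + (10 * sz t + ((2 * sz t + 1) + (5 * szs l + 1)))));
  last by have := sz_gt0 t; lia.
apply: run_seq; first exact: run_mvs.
apply: run_seq; first by apply: run_mv; right.
rewrite /= !cats0.
apply: run_seq; first by rewrite /sz -(size_rev (enc t)); apply: run_clear.
have := @run_pour R1 R0 (e, rev (encs l), [::], [::]) isT.
by rewrite /= size_rev revK; exact.
Qed.

(** In preorder, pairing two adjacent items is a single push, and unpairing a single pop. *)
Lemma runs_node a b r : runs (Push R0 true) (a :: b :: r) (Nd a b :: r) 2.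
Proof.
move=> rest; apply: run_exec; rewrite !encs_cons /= -!catA.
exact: (ExecPush R0 true (_, _, _, _)).
Qed.

Lemma runs_unnode a b r : runs (Pop R0) (Nd a b :: r) (a :: b :: r) 1.
Proof.
move=> rest; apply: run_exec; rewrite !encs_cons /= -!catA.
exact: (ExecPop R0 (_, _, _, _)).
Qed.

Fixpoint push_word (w : seq bool) : cmd :=
  if w is b :: w' then Seq (push_word w') (Push R0 b) else Skip.

Lemma runs_const t r : runs (push_word (enc t)) r (t :: r) (2 * sz t).
Proof.
move=> rest; rewrite encs_cons -catA /sz; move: (encs r ++ rest) => e.
elim: (enc t) => [|b w IH]; first by apply: run_exec; apply: ExecSkip.
rewrite /= mulnS addnC; apply: run_seq IH _; apply: run_exec.
exact: (ExecPush R0 b (_, _, _, _)).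
Qed.

Lemma runs_size c l l' T : runs c l l' T -> szs l' <= szs l + T.
Proof.
move/(_ [::]) => [t le /exec_size]; rewrite /= !cats0 -!/(szs _); lia.
Qed.

Lemma runs_case c0 cf ct a r l' T :
  runs (if a is Nd _ _ then ct else cf) (a :: r) l' T ->
  runs (Case R0 c0 cf ct) (a :: r) l' T.+1.
Proof. by move=> H rest; apply: run_case; case: a H => [|a b] /(_ rest). Qed.

(** * Polynomial bounds *)

Lemma leq_horner (p : {poly nat}) (m n : nat) : m <= n -> p.[m] <= p.[n].
Proof.
move=> le; rewrite !horner_coef; apply: (big_ind2 (fun a b => a <= b)) => //.
  by move=> a b c d; apply: leq_add.
by move=> i _; rewrite leq_mul2l; apply/orP; right; rewrite !natrXE; case: (val i) => [|j] //; rewrite leq_exp2r.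
Qed.

Definition poly_bounded (f : nat -> nat) : Prop :=
  exists p : {poly nat}, forall n, f n <= p.[n].

Lemma poly_bounded_le f g : (forall n, f n <= g n) -> poly_bounded g -> poly_bounded f.
Proof. by move=> H [p Hp]; exists p => n; apply: leq_trans (H n) (Hp n). Qed.

Lemma poly_bounded_cst c : poly_bounded (fun=> c).
Proof. by exists c%:P%R => n; rewrite hornerC. Qed.

Lemma poly_bounded_id : poly_bounded id.
Proof. by exists 'X%R => n; rewrite hornerX. Qed.

Lemma poly_boundedD f g : poly_bounded f -> poly_bounded g ->
  poly_bounded (fun n => f n + g n).
Proof.
move=> [p Hp] [q Hq]; exists (p + q)%R => n.
by rewrite hornerD; apply: leq_add.
Qed.

Lemma poly_boundedM f g : poly_bounded f -> poly_bounded g ->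
  poly_bounded (fun n => f n * g n).
Proof.
move=> [p Hp] [q Hq]; exists (p * q)%R => n.
by rewrite hornerM; apply: leq_mul.
Qed.

Lemma poly_bounded_horner (p : {poly nat}) f : poly_bounded f ->
  poly_bounded (fun n => p.[f n]).
Proof.
move=> [q Hq]; exists (p \Po q)%R => n.
by rewrite horner_comp; apply: leq_horner.
Qed.

Lemma poly_bounded_exp k f : poly_bounded f -> poly_bounded (fun n => f n ^ k).
Proof.
move=> Hf; elim: k => [|k IH]; first exact: poly_bounded_cst.
by apply: poly_bounded_le (poly_boundedM Hf IH) => n; rewrite expnS.
Qed.

Ltac pbd := repeat match goal with
  | |- poly_bounded (fun=> ?c) => exact: poly_bounded_cst
  | |- poly_bounded (fun n => n) => exact: poly_bounded_id
  | |- poly_bounded (fun n => @?f n + @?g n) => apply: (@poly_boundedD f g)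
  | |- poly_bounded (fun n => @?f n * @?g n) => apply: (@poly_boundedM f g)
  | |- poly_bounded (fun n => @?f n ^ ?k) => apply: (@poly_bounded_exp k f)
  | |- poly_bounded (fun n => horner ?p (@?f n)) => apply: (@poly_bounded_horner p f)
  | |- poly_bounded (fun n => (@?f n).+1) => apply: (@poly_boundedD (fun=> 1) f)
  end.

(** * Polynomial-time functions on coded types *)

Class coded (A : Type) := code : A -> tree.

Instance coded_unit : coded unit := fun=> Lf.
(** This is the code of a list of at most one unit, so a conditional is a special case of list
    matching. *)
Instance coded_bool : coded bool := fun b => if b then Nd Lf Lf else Lf.
Instance coded_prod A B (_ : coded A) (_ : coded B) : coded (A * B) :=
  fun x => Nd (code x.1) (code x.2).
Instance coded_seq A (_ : coded A) : coded (seq A) :=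
  fix c l := if l is x :: l' then Nd (code x) (c l') else Lf.
(* Natural numbers are unary by default. *)
Instance coded_nat : coded nat := fun n => iter n (Nd Lf) Lf.

Definition csz A {_ : coded A} (a : A) : nat := sz (code a).

Definition PT A B {cA : coded A} {cB : coded B} (f : A -> B) : Prop :=
  exists (c : cmd) (p : {poly nat}),
    forall a, runs c [:: code a] [:: code (f a)] p.[csz a].

Lemma csz_cons A {_ : coded A} (a : A) l : csz (a :: l) = (csz a + csz l).+1.
Proof. by rewrite /csz /= sz_Nd. Qed.
Lemma csz_pair A B {_ : coded A} {_ : coded B} (x : A * B) :
  csz x = (csz x.1 + csz x.2).+1.
Proof. by rewrite /csz /= sz_Nd. Qed.
Lemma csz_gt0 A {_ : coded A} (a : A) : 0 < csz a.
Proof. exact: sz_gt0. Qed.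
Lemma csz_cat A {_ : coded A} (l l' : seq A) : csz (l ++ l') = (csz l + csz l').-1.
Proof.
elim: l => [|a l IH]; first by rewrite cat0s.
rewrite cat_cons !csz_cons IH.
pose proof (csz_gt0 l); pose proof (csz_gt0 l'); lia.
Qed.
Lemma csz_nil A {_ : coded A} : csz (Nil A) = 1. Proof. by []. Qed.
Lemma csz_bool (b : bool) : csz b = if b then 3 else 1. Proof. by case: b. Qed.
Lemma csz_nat (n : nat) : csz n = (2 * n).+1.
Proof.
elim: n => [|n IH] //; have -> : csz n.+1 = (csz n).+2 by [].
by rewrite IH; lia.
Qed.
Lemma size_csz A {_ : coded A} (l : seq A) : 2 * size l < csz l.
Proof.
by elim: l => [|a l IH] //; rewrite csz_cons /=; pose proof (csz_gt0 a); lia.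
Qed.
Lemma csz_take A {_ : coded A} (l : seq A) k : csz (take k l) <= csz l.
Proof.
rewrite -{2}(cat_take_drop k l) csz_cat; pose proof (csz_gt0 (drop k l)); lia.
Qed.

Lemma poly_bounded_PT A B {cA : coded A} {cB : coded B} (f : A -> B) c T :
  poly_bounded T -> (forall a, runs c [:: code a] [:: code (f a)] (T (csz a))) -> PT f.
Proof. by case=> p Hp H; exists c, p => a; apply: runs_le (H a) (Hp _). Qed.

Lemma PT_size A B {cA : coded A} {cB : coded B} (f : A -> B) : PT f ->
  exists p : {poly nat}, forall a, csz (f a) <= p.[csz a].
Proof.
case=> c [p H]; exists ('X + p)%R => a; rewrite hornerD hornerX.
by have := runs_size (H a); rewrite !szs_cons !szs_nil !addn0.
Qed.

(** Only the codes of values matter, so a result may be retyped at no cost whenever the codes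
    agree. *)
Lemma PT_recode A B B' {cA : coded A} {cB : coded B} {cB' : coded B'}
  (f : A -> B) (g : A -> B') : (forall a, code (f a) = code (g a)) -> PT f -> PT g.
Proof. by move=> E [c [p H]]; exists c, p => a; rewrite -E. Qed.

Lemma PT_ext A B {cA : coded A} {cB : coded B} (f g : A -> B) :
  f =1 g -> PT f -> PT g.
Proof. by move=> E; apply: PT_recode => a; rewrite E. Qed.

Lemma PT_id A {cA : coded A} : PT (fun x : A => x).
Proof.
exists Skip, 0%R => a; rewrite horner0 => rest.
by apply: run_exec; apply: ExecSkip.
Qed.

Lemma PT_comp A B C {cA : coded A} {cB : coded B} {cC : coded C}
  (g : B -> C) (f : A -> B) : PT g -> PT f -> PT (fun x => g (f x)).
Proof.
move=> [c [p Hg]] Hf; have [r Hr] := PT_size Hf; move: Hf => [d [q Hf]].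
apply: (@poly_bounded_PT _ _ _ _ _ (Seq d c) (fun n => q.[n] + p.[r.[n]])).
  by pbd.
move=> a; apply: runs_seq (Hf a) _; apply: runs_le (Hg _) _; exact: leq_horner.
Qed.

Lemma PT_cst A B {cA : coded A} {cB : coded B} (b : B) : PT (fun _ : A => b).
Proof.
apply: (@poly_bounded_PT _ _ _ _ _ (Seq (delete_item 0) (push_word (enc (code b))))
  (fun n => 20 * n + 2 * csz b)); first by pbd.
move=> a; apply: runs_seq (runs_const _ _).
by apply: runs_le (runs_delete [::] (code a) [::]) _; rewrite /= szs_cons szs_nil addn0.
Qed.

Ltac unfold_csz := rewrite /= ?szs_cons ?szs_nil; rewrite -/(csz _).

Lemma PT_pair A B C {cA : coded A} {cB : coded B} {cC : coded C}
  (f : A -> B) (g : A -> C) : PT f -> PT g -> PT (fun x => (f x, g x)).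
Proof.
move=> Hf Hg; have [f' Hf'] := PT_size Hf; have [g' Hg'] := PT_size Hg.
move: Hf Hg => [c [p Hf]] [d [q Hg]].
apply: (@poly_bounded_PT _ _ _ _ _
  (Seq (copy_item 0) (Seq d (Seq (copy_item 1) (Seq (delete_item 2) (Seq c (Push R0 true))))))
  (fun n => 40 * n + (q.[n] + (40 * (g'.[n] + n) + (20 * (2 * n + g'.[n]) + (p.[n] + 2)))))).
  by pbd.
move=> a; have lg := Hg' a.
apply: runs_seq.
  by apply: runs_le (runs_copy [::] (code a) [::]) _; unfold_csz; rewrite addn0.
apply: runs_seq; first exact: runs_frame (Hg a).
apply: runs_seq.
  apply: runs_le (runs_copy [:: code (g a)] (code a) [::]) _; unfold_csz.
  by rewrite -/(csz _); lia.
apply: runs_seq.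
  apply: runs_le (runs_delete [:: code a; code (g a)] (code a) [::]) _; unfold_csz.
  by rewrite -/(csz _); lia.
apply: runs_seq; first exact: runs_frame (Hf a).
exact: runs_node.
Qed.

Lemma PT_cons A B {cA : coded A} {cB : coded B} (f : A -> B) (g : A -> seq B) :
  PT f -> PT g -> PT (fun x => f x :: g x).
Proof. by move=> Hf Hg; apply: PT_recode (PT_pair Hf Hg). Qed.

Lemma PT_fst A B C {cA : coded A} {cB : coded B} {cC : coded C} (f : A -> B * C) :
  PT f -> PT (fun x => (f x).1).
Proof.
apply: PT_comp.
apply: (@poly_bounded_PT _ _ _ _ _ (Seq (Pop R0) (delete_item 1)) (fun n => 1 + 20 * n)).
  by pbd.
move=> [a b]; apply: runs_seq; first exact: runs_unnode.
apply: runs_le (runs_delete [:: code a] (code b) [::]) _; unfold_csz.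
by rewrite csz_pair /= /csz; lia.
Qed.

Lemma PT_snd A B C {cA : coded A} {cB : coded B} {cC : coded C} (f : A -> B * C) :
  PT f -> PT (fun x => (f x).2).
Proof.
apply: PT_comp.
apply: (@poly_bounded_PT _ _ _ _ _ (Seq (Pop R0) (delete_item 0)) (fun n => 1 + 20 * n)).
  by pbd.
move=> [a b]; apply: runs_seq; first exact: runs_unnode.
apply: runs_le (runs_delete [::] (code a) [:: code b]) _; unfold_csz.
by rewrite csz_pair /= /csz; lia.
Qed.

Lemma PT_case A B C {cA : coded A} {cB : coded B} {cC : coded C}
  (f : A -> seq B) (n : A -> C) (c : A * (B * seq B) -> C) :
  PT f -> PT n -> PT c ->
  PT (fun a => if f a is x :: l then c (a, (x, l)) else n a).
Proof.
move=> Hf; have [r Hr] := PT_size Hf.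
move: Hf => [cf [p Hf]] [cn [q Hn]] [cc [s Hc]].
apply: (@poly_bounded_PT _ _ _ _ _
  (Seq (copy_item 0) (Seq cf (Case R0 Skip (Seq (delete_item 0) cn)
     (Seq (copy_item 1) (Seq (delete_item 2) (Seq (Push R0 true) cc))))))
  (fun n => 40 * n + (p.[n] + ((20 * (r.[n] + n) + q.[n]) +
      (40 * (r.[n] + n) + (20 * (r.[n] + 2 * n) + (2 + s.[1 + (n + r.[n])]))) + 1)))).
  by pbd.
move=> a; have lr := Hr a.
apply: runs_seq.
  by apply: runs_le (runs_copy [::] (code a) [::]) _; unfold_csz; rewrite addn0.
apply: runs_seq; first exact: runs_frame (Hf a).
rewrite addn1; apply: runs_case; case E: (f a) => [|x l] /=.
  rewrite E in lr.
  apply: runs_le (leq_addr _ _); apply: runs_seq (Hn a).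
  apply: runs_le (runs_delete [::] Lf [:: code a]) _; unfold_csz.
  by rewrite csz_nil in lr; rewrite /sz /=; lia.
apply: runs_le (leq_addl _ _).
(* The code of [x :: l] is also that of the pair [(x, l)], so the scrutinee itself becomes the
   second component of the argument. *)
set y := code (x :: l); have Ey : sz y = csz (f a) by rewrite E.
apply: runs_seq.
  apply: runs_le (runs_copy [:: y] (code a) [::]) _; unfold_csz.
  by rewrite Ey -/(csz _); lia.
apply: runs_seq.
  apply: runs_le (runs_delete [:: code a; y] (code a) [::]) _; unfold_csz.
  by rewrite Ey -/(csz _); lia.
apply: runs_seq; first exact: runs_node.
apply: runs_le (Hc (a, (x, l))) _; apply: leq_horner.
have Ey' : csz (x, l) = csz (f a) by rewrite E.
by rewrite csz_pair /= Ey'; lia.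
Qed.

Lemma PT_if A C {cA : coded A} {cC : coded C} (b : A -> bool) (f g : A -> C) :
  PT b -> PT f -> PT g -> PT (fun a => if b a then f a else g a).
Proof.
move=> Hb Hf Hg.
have Hb' : PT (fun a => nseq (b a) tt).
  by apply: PT_recode Hb => a; case: (b a).
have := PT_case Hb' Hg (PT_comp Hf (PT_fst PT_id)).
by apply: PT_ext => a; case: (b a).
Qed.

(** * Bounded recursion on lists *)

Section Fold.
Variables (X A B : Type) (cX : coded X) (cA : coded A) (cB : coded B).
Variables (l : X -> seq A) (i : X -> B) (s : X -> A -> B -> B).

(** A polynomial-time step may still square the accumulator each time, hence the bound on all
    intermediate accumulators and not only on the last one. *)
Lemma PT_foldl (bd : nat -> nat) : poly_bounded bd ->
  PT l -> PT i -> PT (fun z : X * (A * B) => s z.1 z.2.1 z.2.2) ->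
  (forall x k, csz (foldl (fun b a => s x a b) (i x) (take k (l x))) <= bd (csz x)) ->
  PT (fun x => foldl (fun b a => s x a b) (i x) (l x)).
Proof.
move=> [bp Hbp] Hl Hi [cs [ps Hs]] Hbd.
have [l' Hl'] := PT_size Hl; move: Hl Hi => [cl [pl Hl]] [ci [pi Hi]].
(* The stack holds the remaining list, the accumulator and [x]. One round assembles [(x, (a, b))] on
   top, applies [s], deletes the old accumulator and [a], and puts the rest of the list back on
   top. *)
set body := Seq (Pop R0) (Seq (copy_item 2) (Seq (copy_item 1) (Seq (Push R0 true) (Seq (copy_item 4)
  (Seq (Push R0 true) (Seq cs (Seq (delete_item 3) (Seq (delete_item 1) (Seq (copy_item 1) (delete_item 2)))))))))).
set test : pred (option bool) := (fun o => o == Some true).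
(* [S n] bounds the sizes of [x], the list and the accumulator together; [IT n] bounds the cost of a
   round, its copies and deletions included. *)
pose S n := (n + l'.[n] + bp.[n]).
pose IT n := (800 * S n + ps.[2 + S n] + 10).
have [pit Hpit] : poly_bounded IT by rewrite /IT /S; pbd.
apply: (@poly_bounded_PT _ _ _ _ _
  (Seq (copy_item 0) (Seq ci (Seq (copy_item 1) (Seq cl (Seq (While R0 test body) (Seq (delete_item 0) (delete_item 1)))))))
  (fun n => 40 * n + (pi.[n] + (40 * (bp.[n] + n) + (pl.[n] + ((l'.[n] * pit.[n] + 1) + (20 * (n + bp.[n]) + 20 * (n + bp.[n])))))))).
  by pbd.
move=> x; set n := csz x.
have Hb0 : csz (i x) <= bp.[n].
  by apply: leq_trans (Hbp n); have := Hbd x 0; rewrite take0.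
apply: runs_seq.
  by apply: runs_le (runs_copy [::] (code x) [::]) _; unfold_csz; rewrite addn0.
apply: runs_seq; first exact: runs_frame (Hi x).
apply: runs_seq.
  by apply: runs_le (runs_copy [:: code (i x)] (code x) [::]) _; unfold_csz; rewrite -/(csz _) -/n; lia.
apply: runs_seq; first exact: runs_frame (Hl x).
set b := foldl _ _ _.
have Hb : csz b <= bp.[n].
  by apply: leq_trans (Hbp n); have := Hbd x (size (l x)); rewrite take_size.
apply: (@runs_seq _ _ _ [:: Lf; code b; code x]); last first.
  have n0 : 0 < n by exact: csz_gt0.
  apply: runs_seq.
    apply: runs_le (runs_delete [::] Lf [:: code b; code x]) _; unfold_csz.
    by rewrite /sz /=; lia.
  apply: runs_le (runs_delete [:: code b] (code x) [::]) _; unfold_csz.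
  by rewrite -/(csz _) -/n; lia.
have Hit : (800 * (n + l'.[n] + bp.[n]) + ps.[2 + (n + l'.[n] + bp.[n])] + 10 <= pit.[n]) by exact: Hpit.
have Hsl : size (l x) <= l'.[n] by apply: leq_trans (Hl' x); pose proof (size_csz (l x)); lia.
enough (H : runs (While R0 test body) [:: code (l x); code (i x); code x]
            [:: Lf; code b; code x] (size (l x) * pit.[n] + 1)).
  by apply: runs_le H _; rewrite leq_add2r leq_mul2r Hsl orbT.
have {Hb0 Hb Hsl}Hbk k : csz (foldl (fun b a => s x a b) (i x) (take k (l x))) <= bp.[n].
  exact: leq_trans (Hbd x k) (Hbp n).
move: {Hl' Hl Hi} (Hl' x) Hbk => Hl'x; rewrite {}/b -/n in Hl'x *.
move: (i x) => b0; elim: (l x) Hl'x b0 => [|a r IH] Hr b0 Hbk /=.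
  by move=> rest; apply: run_exec; apply: ExecStop.
have Hr' : csz r <= l'.[n] by move: Hr; rewrite csz_cons; lia.
set b1 := s x a b0.
have Hb1 : csz b1 <= bp.[n] by have := Hbk 1; rewrite /= take0.
have Hb0 : csz b0 <= bp.[n] by have := Hbk 0.
have {}IH := IH Hr' b1 (fun k => Hbk k.+1).
enough (H : runs body [:: Nd (code a) (code r); code b0; code x]
    [:: code r; code b1; code x] (pit.[n] - 1)).
  move=> rest; apply: (@run_le _ _ _ ((pit.[n] - 1) + (size r * pit.[n] + 1)).+1).
    by apply: run_loop (H rest) (IH rest); rewrite encs_cons.
  by rewrite mulSn; lia.
have Ha : csz a + csz r < l'.[n] by rewrite -csz_cons.
have En : sz (code x) = n by [].
have Ea : sz (code a) = csz a by [].
have Er : sz (code r) = csz r by [].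
have Eb0 : sz (code b0) = csz b0 by [].
have Eb1 : sz (code b1) = csz b1 by [].
apply: (@runs_le _ _ _ (1 + (40 * (csz a + csz r + csz b0) + (40 * (csz b0 + csz a) + (2 +
   (40 * (1 + csz a + csz b0 + csz a + csz r + csz b0 + n) + (2 + (ps.[2 + (n + csz a + csz b0)] +
   (20 * (csz b1 + csz a + csz r + n + csz b0) + (20 * (csz b1 + csz a) + (40 * (csz b1 + csz r) + 20 * (csz b1 + csz r + csz r)))))))))))); last first.
  have : ps.[2 + (n + csz a + csz b0)] <= ps.[2 + (n + l'.[n] + bp.[n])] by apply: leq_horner; lia.
  move: Hit; lia.
apply: runs_seq; first exact: runs_unnode.
apply: runs_seq.
  by apply: runs_le (runs_copy [:: code a; code r] (code b0) [:: code x]) _; unfold_csz; lia.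
apply: runs_seq.
  by apply: runs_le (runs_copy [:: code b0] (code a) [:: code r; code b0; code x]) _; unfold_csz; lia.
apply: runs_seq; first exact: runs_node.
apply: runs_seq.
  apply: runs_le (runs_copy [:: Nd (code a) (code b0); code a; code r; code b0] (code x) [::]) _; unfold_csz.
  by rewrite sz_Nd; lia.
apply: runs_seq; first exact: runs_node.
apply: runs_seq.
  apply: runs_le (@runs_frame _ _ _ _ [:: code a; code r; code b0; code x] (Hs (x, (a, b0)))) _; apply: leq_horner.
  by rewrite !csz_pair /= -/n; lia.
apply: runs_seq.
  by apply: runs_le (runs_delete [:: code b1; code a; code r] (code b0) [:: code x]) _; unfold_csz; lia.
apply: runs_seq.
  by apply: runs_le (runs_delete [:: code b1] (code a) [:: code r; code x]) _; unfold_csz; lia.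
apply: runs_seq.
  by apply: runs_le (runs_copy [:: code b1] (code r) [:: code x]) _; unfold_csz; lia.
by apply: runs_le (runs_delete [:: code r; code b1] (code r) [:: code x]) _; unfold_csz; lia.
Qed.

End Fold.

Lemma PT_app1 X {cX : coded X} A B {cA : coded A} {cB : coded B} (g : A -> B) :
  PT g -> forall f : X -> A, PT f -> PT (fun x => g (f x)).
Proof. by move=> Hg f; apply: PT_comp. Qed.

Lemma PT_app2 X {cX : coded X} A B C {cA : coded A} {cB : coded B} {cC : coded C} (g : A -> B -> C) :
  PT (fun z : A * B => g z.1 z.2) ->
  forall (f1 : X -> A) (f2 : X -> B), PT f1 -> PT f2 -> PT (fun x => g (f1 x) (f2 x)).
Proof. move=> Hg f1 f2 H1 H2; exact: (PT_comp Hg (PT_pair H1 H2)). Qed.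

Lemma PT_app3 X {cX : coded X} A B C D {cA : coded A} {cB : coded B} {cC : coded C} {cD : coded D}
  (g : A -> B -> C -> D) : PT (fun z : A * (B * C) => g z.1 z.2.1 z.2.2) ->
  forall (f1 : X -> A) (f2 : X -> B) (f3 : X -> C), PT f1 -> PT f2 -> PT f3 ->
    PT (fun x => g (f1 x) (f2 x) (f3 x)).
Proof. move=> Hg f1 f2 f3 H1 H2 H3; exact: (PT_comp Hg (PT_pair H1 (PT_pair H2 H3))). Qed.

Lemma PT_app4 X {cX : coded X} A B C D E {cA : coded A} {cB : coded B} {cC : coded C}
  {cD : coded D} {cE : coded E} (g : A -> B -> C -> D -> E) :
  PT (fun z : A * (B * (C * D)) => g z.1 z.2.1 z.2.2.1 z.2.2.2) ->
  forall (f1 : X -> A) (f2 : X -> B) (f3 : X -> C) (f4 : X -> D),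
    PT f1 -> PT f2 -> PT f3 -> PT f4 -> PT (fun x => g (f1 x) (f2 x) (f3 x) (f4 x)).
Proof.
move=> Hg f1 f2 f3 f4 H1 H2 H3 H4.
exact: (PT_comp Hg (PT_pair H1 (PT_pair H2 (PT_pair H3 H4)))).
Qed.

Lemma PT_and X {cX : coded X} (f g : X -> bool) : PT f -> PT g -> PT (fun x => f x && g x).
Proof. by move=> Hf Hg; apply: (PT_if Hf Hg (PT_cst false)). Qed.

Lemma PT_or X {cX : coded X} (f g : X -> bool) : PT f -> PT g -> PT (fun x => f x || g x).
Proof. by move=> Hf Hg; apply: (PT_if Hf (PT_cst true) Hg). Qed.

Lemma PT_not X {cX : coded X} (f : X -> bool) : PT f -> PT (fun x => ~~ f x).
Proof. by move=> Hf; apply: (PT_if Hf (PT_cst false) (PT_cst true)). Qed.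

Lemma PT_behead X {cX : coded X} A {cA : coded A} (f : X -> seq A) : PT f -> PT (fun x => behead (f x)).
Proof.
move=> Hf; by apply: (PT_ext _ (PT_case Hf (PT_cst (Nil A)) (PT_snd (PT_snd PT_id)))) => x /=; case: (f x).
Qed.

Lemma PT_head X {cX : coded X} A {cA : coded A} (d : A) (f : X -> seq A) : PT f -> PT (fun x => head d (f x)).
Proof.
move=> Hf; by apply: (PT_ext _ (PT_case Hf (PT_cst d) (PT_fst (PT_snd PT_id)))) => x /=; case: (f x).
Qed.

Lemma PT_nilp X {cX : coded X} A {cA : coded A} (f : X -> seq A) : PT f -> PT (fun x => nilp (f x)).
Proof.
move=> Hf; by apply: (PT_ext _ (PT_case Hf (PT_cst true) (PT_cst false))) => x /=; case: (f x).
Qed.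

Lemma PT_units X {cX : coded X} (f : X -> nat) : PT f -> PT (fun x => nseq (f x) tt).
Proof. by apply: PT_recode => x; elim: (f x) => // n IH; rewrite -[LHS]/(Nd Lf (code n)) IH. Qed.

Lemma PT_of_units X {cX : coded X} (f : X -> seq unit) : PT f -> PT (fun x => size (f x)).
Proof. by apply: PT_recode => x; elim: (f x) => // [[] l IH]; rewrite -[RHS]/(Nd Lf (code (size l))) -IH. Qed.

(** If a step enlarges the accumulator by an amount independent of the accumulator, the increments
    add up to a polynomial. *)
Lemma PT_foldl_incr X {cX : coded X} A B {cA : coded A} {cB : coded B}
  (l : X -> seq A) (i : X -> B) (s : X -> A -> B -> B) (q : nat -> nat) : poly_bounded q ->
  PT l -> PT i -> PT (fun z : X * (A * B) => s z.1 z.2.1 z.2.2) ->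
  (forall x a b, csz (s x a b) <= csz b + q (csz x + csz a)) ->
  PT (fun x => foldl (fun b a => s x a b) (i x) (l x)).
Proof.
move=> [p Hp] Hl Hi Hs Hq; have [l' Hl'] := PT_size Hl; have [i' Hi'] := PT_size Hi.
apply: (PT_foldl (bd := fun n => i'.[n] + l'.[n] * p.[n + l'.[n]])) => //; first by pbd.
move=> x k; set n := csz x.
have Hlx : csz (take k (l x)) <= l'.[n] by apply: leq_trans (Hl' x); apply: csz_take.
have Hs' a b : csz a <= l'.[n] -> csz (s x a b) <= csz b + p.[n + l'.[n]].
  move=> Ha; apply: leq_trans (Hq x a b) _; rewrite leq_add2l.
  by apply: leq_trans (Hp _) _; apply: leq_horner; rewrite -/n leq_add2l.
apply: (@leq_trans (csz (i x) + size (take k (l x)) * p.[n + l'.[n]])); last first.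
  apply: leq_add; [exact: Hi'|]; rewrite leq_mul2r; apply/orP; right.
  by pose proof (size_csz (take k (l x))); lia.
elim: (take k _) (i x) Hlx => [|a r IH] b; first by rewrite addn0.
rewrite csz_cons => Ha /=; apply: leq_trans (IH _ _) _; first by lia.
by have := Hs' a b; rewrite mulSn; lia.
Qed.

Lemma PT_iter X {cX : coded X} B {cB : coded B} (n : X -> nat) (i : X -> B) (s : X -> B -> B) (q : nat -> nat) :
  poly_bounded q -> PT n -> PT i -> PT (fun z : X * B => s z.1 z.2) ->
  (forall x b, csz (s x b) <= csz b + q (csz x)) ->
  PT (fun x => iter (n x) (s x) (i x)).
Proof.
move=> [p Hp] Hn Hi Hs Hq.
have E : (fun x => foldl (fun b _ => s x b) (i x) (nseq (n x) tt)) =1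
         (fun x => iter (n x) (s x) (i x)).
  by move=> x; elim: (n x) (i x) => //= m IH b; rewrite IH -iterSr.
apply: (PT_ext E); apply: (PT_foldl_incr (q := fun n => p.[n])) (PT_units Hn) Hi _ _; first by pbd.
  exact: (PT_comp Hs (PT_pair (PT_fst PT_id) (PT_snd (PT_snd PT_id)))).
move=> x [] b; apply: leq_trans (Hq x b) _; rewrite leq_add2l.
by apply: leq_trans (Hp _) _; apply: leq_horner; rewrite leq_addr.
Qed.

Lemma PT_catrev X {cX : coded X} A {cA : coded A} (f g : X -> seq A) : PT f -> PT g ->
  PT (fun x => catrev (f x) (g x)).
Proof.
move=> Hf Hg.
have E : (fun x => foldl (fun b a => a :: b) (g x) (f x)) =1 (fun x => catrev (f x) (g x)).
  by move=> x; elim: (f x) (g x) => //= a r IH b; rewrite IH.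
apply: (PT_ext E); apply: (PT_foldl_incr (s := fun _ => cons) (q := fun n => n + 1)) => //.
- by pbd.
- exact: PT_cons (PT_fst (PT_snd PT_id)) (PT_snd (PT_snd PT_id)).
- by move=> x a b; rewrite csz_cons; lia.
Qed.

Lemma PT_rev X {cX : coded X} A {cA : coded A} (f : X -> seq A) : PT f -> PT (fun x => rev (f x)).
Proof. by move=> Hf; apply: PT_catrev (PT_cst [::]). Qed.

Lemma PT_cat X {cX : coded X} A {cA : coded A} (f g : X -> seq A) : PT f -> PT g -> PT (fun x => f x ++ g x).
Proof.
move=> Hf Hg; apply: PT_ext (PT_catrev (PT_rev Hf) Hg) => x.
by rewrite catrevE revK.
Qed.

Lemma PT_map X {cX : coded X} A B {cA : coded A} {cB : coded B} (l : X -> seq A) (f : X -> A -> B) :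
  PT l -> PT (fun z : X * A => f z.1 z.2) -> PT (fun x => [seq f x a | a <- l x]).
Proof.
move=> Hl Hf; have [q Hq] := PT_size Hf.
have E : (fun x => rev (foldl (fun b a => f x a :: b) [::] (l x))) =1
         (fun x => [seq f x a | a <- l x]).
  move=> x; rewrite -[RHS]revK; congr rev.
  rewrite -[RHS]cats0; elim: (l x) [::] => //= a r IH b.
  by rewrite IH rev_cons cat_rcons.
apply: (PT_ext E); apply: PT_rev.
apply: (PT_foldl_incr (s := fun x a b => f x a :: b) (q := fun n => q.[n + 1] + 1)) => //.
- by pbd.
- exact: (PT_cst [::]).
- apply: PT_cons (PT_snd (PT_snd PT_id)).
  exact: (PT_comp Hf (PT_pair (PT_fst PT_id) (PT_fst (PT_snd PT_id)))).
- move=> x a b; rewrite csz_cons; have := Hq (x, a); rewrite csz_pair /= -addn1 => H.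
  by lia.
Qed.

Lemma PT_size_seq X {cX : coded X} A {cA : coded A} (f : X -> seq A) : PT f -> PT (fun x => size (f x)).
Proof.
move=> Hf; by apply: (PT_ext _ (PT_of_units (PT_map (f := fun _ _ => tt) Hf (PT_cst tt)))) => x; rewrite size_map.
Qed.

Lemma PT_flatten X {cX : coded X} A {cA : coded A} (f : X -> seq (seq A)) : PT f -> PT (fun x => flatten (f x)).
Proof.
move=> Hf.
have E : (fun x => foldl (fun b a => a ++ b) [::] (rev (f x))) =1 (fun x => flatten (f x)).
  by move=> x; rewrite foldl_rev.
apply: (PT_ext E); apply: (PT_foldl_incr (s := fun _ => cat) (q := id)).
- by pbd.
- exact: PT_rev.
- exact: (PT_cst [::]).
- exact: PT_cat (PT_fst (PT_snd PT_id)) (PT_snd (PT_snd PT_id)).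
- by move=> x a b; rewrite csz_cat; lia.
Qed.

Lemma PT_all X {cX : coded X} A {cA : coded A} (l : X -> seq A) (f : X -> A -> bool) :
  PT l -> PT (fun z : X * A => f z.1 z.2) -> PT (fun x => all (f x) (l x)).
Proof.
move=> Hl Hf.
have E : (fun x => foldl (fun b a => f x a && b) true (l x)) =1 (fun x => all (f x) (l x)).
  move=> x; rewrite -[RHS]andbT; elim: (l x) true => //= a r IH b.
  by rewrite IH; case: (f x a); case: (all _ _); case: b.
apply: (PT_ext E).
apply: (PT_foldl_incr (s := fun x a b => f x a && b) (q := fun=> 3)) => //.
- by pbd.
- exact: (PT_cst true).
- apply: PT_and (PT_snd (PT_snd PT_id)).
  exact: (PT_comp Hf (PT_pair (PT_fst PT_id) (PT_fst (PT_snd PT_id)))).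
- by move=> x a b; rewrite !csz_bool; case: (_ && _); lia.
Qed.

Lemma PT_has X {cX : coded X} A {cA : coded A} (l : X -> seq A) (f : X -> A -> bool) :
  PT l -> PT (fun z : X * A => f z.1 z.2) -> PT (fun x => has (f x) (l x)).
Proof.
move=> Hl Hf; apply: (PT_ext _ (PT_not (PT_all (f := fun x a => ~~ f x a) Hl (PT_not Hf)))) => x.
by rewrite -has_predC; apply: eq_has => a /=; rewrite negbK.
Qed.

Lemma PT_drop X {cX : coded X} A {cA : coded A} (n : X -> nat) (f : X -> seq A) : PT n -> PT f ->
  PT (fun x => drop (n x) (f x)).
Proof.
move=> Hn Hf.
have E : (fun x => iter (n x) behead (f x)) =1 (fun x => drop (n x) (f x)).
  move=> x; elim: (n x) (f x) => [|m IH] b; first by rewrite drop0.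
  by rewrite iterSr IH; case: b.
apply: (PT_ext E); apply: (PT_iter (s := fun _ => behead) (q := fun=> 0)) => //.
- by pbd.
- exact: PT_behead (PT_snd PT_id).
- by move=> x [|a b] /=; rewrite ?csz_cons; lia.
Qed.

Lemma PT_nth X {cX : coded X} A {cA : coded A} (d : A) (f : X -> seq A) (n : X -> nat) : PT f -> PT n ->
  PT (fun x => nth d (f x) (n x)).
Proof.
by move=> Hf Hn; apply: PT_ext (PT_head d (PT_drop Hn Hf)) => x; rewrite -nth0 nth_drop addn0.
Qed.

Lemma PT_S X {cX : coded X} (f : X -> nat) : PT f -> PT (fun x => (f x).+1).
Proof.
move=> Hf; by apply: (PT_ext _ (PT_of_units (PT_cons (PT_cst tt) (PT_units Hf)))) => x; rewrite /= size_nseq.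
Qed.

Lemma PT_addn X {cX : coded X} (f g : X -> nat) : PT f -> PT g -> PT (fun x => f x + g x).
Proof.
move=> Hf Hg; by apply: (PT_ext _ (PT_of_units (PT_cat (PT_units Hf) (PT_units Hg)))) => x; rewrite size_cat !size_nseq.
Qed.

Lemma PT_subn X {cX : coded X} (f g : X -> nat) : PT f -> PT g -> PT (fun x => f x - g x).
Proof.
move=> Hf Hg; by apply: (PT_ext _ (PT_of_units (PT_drop Hg (PT_units Hf)))) => x; rewrite size_drop size_nseq.
Qed.

Lemma PT_leq X {cX : coded X} (f g : X -> nat) : PT f -> PT g -> PT (fun x => f x <= g x).
Proof.
move=> Hf Hg; by apply: (PT_ext _ (PT_nilp (PT_units (PT_subn Hf Hg)))) => x; rewrite /leq /nilp size_nseq.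
Qed.

Lemma PT_eqn X {cX : coded X} (f g : X -> nat) : PT f -> PT g -> PT (fun x => f x == g x).
Proof.
move=> Hf Hg; by apply: (PT_ext _ (PT_and (PT_leq Hf Hg) (PT_leq Hg Hf))) => x; rewrite -eqn_leq.
Qed.

Lemma PT_muln X {cX : coded X} (f g : X -> nat) : PT f -> PT g -> PT (fun x => f x * g x).
Proof.
move=> Hf Hg; have [q Hq] := PT_size Hg.
have E : (fun x => iter (f x) (addn (g x)) 0) =1 (fun x => f x * g x).
  by move=> x; rewrite iter_addn_0 mulnC.
apply: (PT_ext E); apply: (PT_iter (s := fun x => addn (g x)) (q := fun n => q.[n])) => //.
- by pbd.
- exact: (PT_cst 0).
- exact: PT_addn (PT_comp Hg (PT_fst PT_id)) (PT_snd PT_id).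
- by move=> x b; have := Hq x; rewrite !csz_nat; lia.
Qed.

Lemma PT_horner X {cX : coded X} (p : {poly nat}) (f : X -> nat) : PT f -> PT (fun x => p.[f x]).
Proof.
move=> Hf; rewrite /horner; elim: (polyseq p) => [|a s IH] /=; first exact: (PT_cst 0).
exact: PT_addn (PT_muln IH Hf) (PT_cst a).
Qed.

Lemma PT_iota X {cX : coded X} (n : X -> nat) : PT n -> PT (fun x => iota 0 (n x)).
Proof.
move=> Hn; have [q Hq] := PT_size Hn.
(* The length of the accumulator doubles as the counter. *)
have F k : foldl (fun (b : seq nat) _ => size b :: b) [::] (nseq k tt) = rev (iota 0 k).
  suff F' m : foldl (fun (b : seq nat) _ => size b :: b) (rev (iota 0 m)) (nseq k tt)
              = rev (iota 0 (m + k)) by exact: (F' 0).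
  elim: k m => [|k IH] m; first by rewrite addn0.
  have E : rev (iota 0 m.+1) = m :: rev (iota 0 m) by rewrite -addn1 iotaD rev_cat.
  by rewrite addnS -addSn -IH E /= size_rev size_iota.
have E : (fun x => rev (foldl (fun b _ => size b :: b) [::] (nseq (n x) tt))) =1
   (fun x => iota 0 (n x)).
  by move=> x; rewrite F revK.
have G m k : k <= m -> csz (rev (iota 0 k)) <= 2 * m * (m + 1) + 1.
  move=> le; apply: (@leq_trans (k * (2 * m + 2) + 1)); last by nia.
  elim: k le => [|k IH] le //; rewrite -addn1 iotaD rev_cat csz_cat.
  have -> : csz (rev (iota (0 + k) 1)) = (2 * k).+3 by rewrite -[rev _]/[:: _] csz_cons csz_nat csz_nil addn1.
  by have := IH (ltnW le); lia.
apply: (PT_ext E); apply: PT_rev.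
apply: (PT_foldl (bd := fun n => 2 * q.[n] * (q.[n] + 1) + 1) (s := fun _ _ b => size b :: b)).
- by pbd.
- exact: PT_units.
- exact: (PT_cst [::]).
- exact: PT_cons (PT_size_seq (PT_snd (PT_snd PT_id))) (PT_snd (PT_snd PT_id)).
- move=> x k; set m := minn k (n x).
  have -> : take k (nseq (n x) tt) = nseq m tt.
    by rewrite /m; elim: (k) (n x) => [|k0 IH] [|j] //=; rewrite IH minnSS.
  rewrite F; apply: G; apply: leq_trans (geq_minr _ _) _.
  by have := Hq x; rewrite csz_nat; lia.
Qed.

Ltac pt_user := fail.

Ltac pt1 := lazymatch goal with
  | |- PT (fun x => x) => exact: PT_id
  | |- PT (@fst _ _) => exact: (PT_fst PT_id)
  | |- PT (@snd _ _) => exact: (PT_snd PT_id)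
  | |- PT (fun=> ?c) => exact: (PT_cst c)
  | |- PT (fun x => (_, _)) => apply: PT_pair
  | |- PT (fun x => @fst _ _ _) => apply: PT_fst
  | |- PT (fun x => @snd _ _ _) => apply: PT_snd
  | |- PT (fun x => if _ then _ else _) => apply: PT_if
  | |- PT (fun x => @nil _) => exact: (PT_cst [::])
  | |- PT (fun x => _ :: _) => apply: PT_cons
  | |- PT (fun x => _ && _) => apply: PT_and
  | |- PT (fun x => _ || _) => apply: PT_or
  | |- PT (fun x => ~~ _) => apply: PT_not
  | |- PT (fun x => behead _) => apply: PT_behead
  | |- PT (fun x => head _ _) => apply: PT_head
  | |- PT (fun x => nilp _) => apply: PT_nilp
  | |- PT (fun x => nseq _ tt) => apply: PT_units
  | |- PT (fun x => catrev _ _) => apply: PT_catrev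
  | |- PT (fun x => rev _) => apply: PT_rev
  | |- PT (fun x => _ ++ _) => apply: PT_cat
  | |- PT (fun x => map _ _) => apply: PT_map
  | |- PT (fun x => size _) => apply: PT_size_seq
  | |- PT (fun x => flatten _) => apply: PT_flatten
  | |- PT (fun x => all _ _) => apply: PT_all
  | |- PT (fun x => has _ _) => apply: PT_has
  | |- PT (fun x => drop _ _) => apply: PT_drop
  | |- PT (fun x => nth _ _ _) => apply: PT_nth
  | |- PT (fun x => _.+1) => apply: PT_S
  | |- PT (fun x => _ + _) => apply: PT_addn
  | |- PT (fun x => _ - _) => apply: PT_subn
  | |- PT (fun x => _ * _) => apply: PT_muln
  | |- PT (fun x => _ <= _) => apply: PT_leq
  | |- PT (fun x => _ == _) => apply: PT_eqn
  | |- PT (fun x => horner _ _) => apply: PT_horner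
  | |- PT (fun x => iota 0 _) => apply: PT_iota
  | |- _ => pt_user
  end.
Ltac pt := repeat (cbv beta; pt1).

(** * Binary arithmetic *)

Fixpoint dval (d : seq bool) : nat := if d is b :: d' then b + 2 * dval d' else 0.

Lemma dval_cat d d' : dval (d ++ d') = dval d + 2 ^ size d * dval d'.
Proof. by elim: d => [|b d IH] /=; rewrite ?mul1n // IH expnS; lia. Qed.

Lemma binary0 : binary 0 = [::].
Proof. by rewrite /binary up_log1. Qed.

Lemma size_binary n : size (binary n) = up_log 2 n.+1.
Proof. by rewrite size_map size_iota. Qed.

Lemma binaryS n : 0 < n -> binary n = odd n :: binary n./2.
Proof.
move=> n0; rewrite /binary (up_log2S n0) /= expn0 divn1; congr (_ :: _).
rewrite -[in iota 1 _](addn0 1) iotaDl -map_comp; apply: eq_map => i /=.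
by rewrite add1n expnS divnMA divn2.
Qed.

Lemma dval_binary n : dval (binary n) = n.
Proof.
elim/ltn_ind: n => n IH; case: (posnP n) => [->|n0]; first by rewrite binary0.
by rewrite binaryS //= IH; lia.
Qed.

Lemma size_binary_leq n e : (size (binary n) <= e) = (n < 2 ^ e).
Proof.
rewrite size_binary; apply/idP/idP => [le|lt].
  by apply: leq_trans (up_logP n.+1 (isT : 1 < 2)) _; rewrite leq_pexp2l.
exact: up_log_min.
Qed.

(** Zeros at the most significant end are all that can separate a digit list from the canonical
    [binary] one. *)
Definition trim (d : seq bool) : seq bool :=
  foldr (fun b t => if b || ~~ nilp t then b :: t else t) [::] d.

Lemma trimE d : trim d = binary (dval d).
Proof.
elim: d => [|b d IH] /=; first by rewrite binary0.
rewrite -/(trim d) {}IH; case: (posnP (dval d)) => [-> | d0].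
  by rewrite binary0; case: b => //=; rewrite ?muln0 ?binary0 // binaryS //= binary0.
rewrite [in RHS]binaryS; last by lia.
have -> : (b + 2 * dval d)./2 = dval d by lia.
have -> : odd (b + 2 * dval d) = b by case: b; lia.
by rewrite binaryS //= orbT.
Qed.

(* The coding of a [bnat] is binary. *)
Record bnat := Bn { bv : nat }.
Instance coded_bnat : coded bnat := fun n => code (binary (bv n)).

Lemma csz_bits (d : seq bool) : csz d <= 4 * size d + 1.
Proof. by elim: d => [|b d IH] //; rewrite csz_cons csz_bool /=; case: b; lia. Qed.

Lemma csz_bnat n e : bv n < 2 ^ e -> csz n <= 4 * e + 1.
Proof.
rewrite -size_binary_leq => H; have -> : csz n = csz (binary (bv n)) by [].
by have := csz_bits (binary (bv n)); lia.
Qed.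

Lemma bnat_lt n : bv n < 2 ^ csz n.
Proof.
rewrite -size_binary_leq; have -> : csz n = csz (binary (bv n)) by [].
by pose proof (size_csz (binary (bv n))); lia.
Qed.

Lemma PT_digits X {cX : coded X} (f : X -> bnat) : PT f -> PT (fun x => binary (bv (f x))).
Proof. exact: PT_recode. Qed.

Lemma PT_Bn_dval X {cX : coded X} (f : X -> seq bool) : PT f -> PT (fun x => Bn (dval (f x))).
Proof.
move=> Hf; apply: (@PT_recode _ _ _ _ _ _ (fun x => trim (f x))).
  by move=> x; rewrite trimE.
have E : (fun x => foldl (fun t b => if b || ~~ nilp t then b :: t else t) [::] (rev (f x)))
   =1 (fun x => trim (f x)) by move=> x; rewrite foldl_rev.
apply: (PT_ext E).
apply: (PT_foldl_incr (s := fun _ b t => if b || ~~ nilp t then b :: t else t) (q := fun=> 4)); [by pbd| | |by pt|].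
- exact: PT_rev.
- by pt.
- by move=> x a b; case: ifP => _; rewrite ?csz_cons ?csz_bool; case: a; lia.
Qed.

(** The carry, the digits still to be read and the output so far, most significant digit first.
    Running for [size a + size b] rounds overshoots; the extra zeros are removed by [trim]. *)
Definition adder : Type := bool * (seq bool * (seq bool * seq bool)).

Definition add_step (s : adder) : adder :=
  let c := s.1 in let a := s.2.1 in let b := s.2.2.1 in
  let x := head false a in let y := head false b in
  ((if x then y || c else y && c),
   (behead a, (behead b,
    (if x then (if y then c else ~~ c) else (if y then ~~ c else c)) :: s.2.2.2))).

Definition add_digits (a b : seq bool) : seq bool :=
  let s := iter (size a + size b) add_step (false, (a, (b, [::]))) in
  rev (s.1 :: s.2.2.2).

Lemma dval_head a : dval a = head false a + 2 * dval (behead a).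
Proof. by case: a. Qed.

Lemma dval_add a b : dval (add_digits a b) = dval a + dval b.
Proof.
suff H k c o : size a <= k -> size b <= k ->
    let s := iter k add_step (c, (a, (b, o))) in
    dval (rev (s.1 :: s.2.2.2)) = dval (rev o) + 2 ^ size o * (c + dval a + dval b).
  by rewrite H ?leq_addr ?leq_addl //= mul1n.
elim: k a b c o => [|k IH] a b c o la lb.
  case: a la => // _; case: b lb => // _.
  by rewrite /= rev_cons -cats1 dval_cat size_rev /=; case: c; lia.
rewrite iterSr /= /add_step /=; rewrite IH ?size_behead; [|lia|lia].
rewrite rev_cons -cats1 dval_cat size_rev /= expnS (dval_head a) (dval_head b).
by case: (head false a); case: (head false b); case: c; rewrite /=; lia.
Qed.

Definition badd (m n : bnat) : bnat := Bn (bv m + bv n).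

Lemma csz_behead A {cA : coded A} (l : seq A) : csz (behead l) <= csz l.
Proof. by case: l => [|a l] //=; rewrite csz_cons; lia. Qed.

Lemma PT_badd X {cX : coded X} (f g : X -> bnat) : PT f -> PT g -> PT (fun x => badd (f x) (g x)).
Proof.
apply: PT_app2; apply: (PT_ext (f := fun z => Bn (dval (add_digits (binary (bv z.1)) (binary (bv z.2)))))).
  by move=> [m n] /=; rewrite dval_add !dval_binary.
apply: PT_Bn_dval.
have Hm : PT (fun z : bnat * bnat => binary (bv z.1)) by exact: PT_digits (PT_fst PT_id).
have Hn : PT (fun z : bnat * bnat => binary (bv z.2)) by exact: PT_digits (PT_snd PT_id).
rewrite /add_digits; apply: PT_rev.
pose F (z : bnat * bnat) := iter (size (binary (bv z.1)) + size (binary (bv z.2)))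
  add_step (false, (binary (bv z.1), (binary (bv z.2), [::]))).
have HF : PT F.
  apply: (PT_iter (s := fun _ => add_step) (q := fun=> 12)); [by pbd| | |by rewrite /add_step; pt|].
  - by apply: PT_addn; apply: PT_size_seq.
  - exact: (PT_pair (PT_cst false) (PT_pair Hm (PT_pair Hn (PT_cst [::])))).
  - move=> z [c [a [b o]]]; rewrite !csz_pair /= csz_cons !csz_bool.
    pose proof (csz_behead a); pose proof (csz_behead b).
    by do 2! case: ifP => _; lia.
exact: (PT_cons (PT_fst HF) (PT_snd (PT_snd (PT_snd HF)))).
Qed.

(** Digits come least significant first, so each differing pair overrides the verdict reached so
    far. *)
Definition le_step (s : bool * (seq bool * seq bool)) : bool * (seq bool * seq bool) :=
  let a := s.2.1 in let b := s.2.2 in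
  ((if head false a then (if head false b then s.1 else false)
    else (if head false b then true else s.1)), (behead a, behead b)).

Definition le_digits (a b : seq bool) : bool :=
  (iter (size a + size b) le_step (true, (a, b))).1.

Lemma le_digitsE a b : le_digits a b = (dval a <= dval b).
Proof.
suff H k r : size a <= k -> size b <= k ->
    (iter k le_step (r, (a, b))).1 = if dval a == dval b then r else dval a < dval b.
  by rewrite /le_digits H ?leq_addr ?leq_addl //; case: eqP; lia.
elim: k a b r => [|k IH] a b r la lb.
  by move: la lb; rewrite !leqn0 !size_eq0 => /eqP -> /eqP ->.
rewrite iterSr /le_step /= IH ?size_behead; [|lia|lia].
rewrite (dval_head a) (dval_head b).
by case: (head false a); case: (head false b); rewrite /=; do 2! case: eqP; lia.
Qed.

Definition bleq (m n : bnat) : bool := bv m <= bv n.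

Lemma PT_bleq X {cX : coded X} (f g : X -> bnat) : PT f -> PT g -> PT (fun x => bleq (f x) (g x)).
Proof.
apply: PT_app2; apply: (PT_ext (f := fun z => le_digits (binary (bv z.1)) (binary (bv z.2)))).
  by move=> [m n] /=; rewrite le_digitsE !dval_binary.
have Hm : PT (fun z : bnat * bnat => binary (bv z.1)) by exact: PT_digits (PT_fst PT_id).
have Hn : PT (fun z : bnat * bnat => binary (bv z.2)) by exact: PT_digits (PT_snd PT_id).
apply: PT_fst; apply: (PT_iter (s := fun _ => le_step) (q := fun=> 12)); [by pbd| | |by rewrite /le_step; pt|].
- by apply: PT_addn; apply: PT_size_seq.
- exact: (PT_pair (PT_cst true) (PT_pair Hm Hn)).
- move=> z [c [a b]]; rewrite !csz_pair /= !csz_bool.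
  pose proof (csz_behead a); pose proof (csz_behead b).
  by do 2! case: ifP => _; lia.
Qed.

Definition bmul (m n : bnat) : bnat := Bn (bv m * bv n).

Lemma PT_bmul X {cX : coded X} (f g : X -> bnat) : PT f -> PT g -> PT (fun x => bmul (f x) (g x)).
Proof.
apply: PT_app2.
have F m d : foldl (fun v (b : bool) => badd (badd v v) (if b then m else Bn 0)) (Bn 0) (rev d)
    = Bn (bv m * dval d).
  by rewrite foldl_rev; elim: d => [|b d IH] /=; [rewrite muln0|rewrite IH /badd /=; congr Bn; case: b => /=; lia].
apply: (PT_ext (f := fun z => foldl (fun v (b : bool) => badd (badd v v) (if b then z.1 else Bn 0)) (Bn 0)
   (rev (binary (bv z.2))))).
  by move=> [m n] /=; rewrite F dval_binary.
have Hn : PT (fun z : bnat * bnat => binary (bv z.2)) by exact: PT_digits (PT_snd PT_id).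
apply: (PT_foldl (bd := fun n => 4 * (2 * n) + 1) (s := fun z b v => badd (badd v v) (if b then z.1 else Bn 0))).
- by pbd.
- exact: PT_rev.
- by pt.
- do 2! (apply: PT_badd; try by pt).
(* After [k] rounds of Horner's rule the accumulator is [m] times the number formed by the [k]
   leading digits of [n], hence is no longer than the product. *)
- move=> [m n] k /=; set d := binary (bv n).
  rewrite take_rev F.
  apply: csz_bnat; rewrite csz_pair /=.
  have dk : dval (drop (size d - k) d) <= bv n.
    have := dval_cat (take (size d - k) d) (drop (size d - k) d).
    rewrite cat_take_drop dval_binary => ->.
    by apply: leq_trans (leq_addl _ _); rewrite leq_pmull // expn_gt0.
  apply: leq_ltn_trans (leq_mul (leqnn _) dk) _.
  have := bnat_lt m; have := bnat_lt n => Hb Ha.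
  apply: leq_trans (ltn_mul Ha Hb) _; rewrite -expnD leq_pexp2l //; lia.
Qed.

Ltac pt_user ::= lazymatch goal with
  | |- PT (fun x => badd _ _) => apply: PT_badd
  | |- PT (fun x => bmul _ _) => apply: PT_bmul
  | |- PT (fun x => bleq _ _) => apply: PT_bleq
  | |- PT (fun x => binary (bv _)) => apply: PT_digits
  end.

Lemma PT_Bn X {cX : coded X} (f : X -> nat) : PT f -> PT (fun x => Bn (f x)).
Proof.
have E k : iter k (badd (Bn 1)) (Bn 0) = Bn k by elim: k => //= k ->.
move=> Hf; apply: (PT_ext (f := fun x => iter (f x) (badd (Bn 1)) (Bn 0))) => [x|]; first exact: E.
have Hu := PT_units Hf; have [q Hq] := PT_size Hf.
apply: (PT_ext (f := fun x => foldl (fun b _ => badd (Bn 1) b) (Bn 0) (nseq (f x) tt))).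
  by move=> x; elim: (f x) (Bn 0) => //= m IH b; rewrite IH -iterSr.
apply: (PT_foldl (bd := fun n => 4 * q.[n] + 1) (s := fun _ _ b => badd (Bn 1) b)).
- by pbd.
- exact: Hu.
- by pt.
- by pt.
- move=> x k; have -> : take k (nseq (f x) tt) = nseq (minn k (f x)) tt.
    by elim: (k) (f x) => [|k0 IH] [|j] //=; rewrite IH minnSS.
  have -> : foldl (fun b _ => badd (Bn 1) b) (Bn 0) (nseq (minn k (f x)) tt) = Bn (minn k (f x)).
    by rewrite -(E (minn k (f x))); elim: (minn k _) (Bn 0) => //= m IH b; rewrite IH -iterSr.
  apply: csz_bnat => /=; apply: leq_ltn_trans (geq_minr _ _) _.
  apply: leq_trans (ltn_expl _ (isT : 1 < 2)) _; rewrite leq_pexp2l //.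
  by have := Hq x; rewrite csz_nat; lia.
Qed.

Lemma PT_bexp2 X {cX : coded X} (f : X -> nat) : PT f -> PT (fun x => Bn (2 ^ f x)).
Proof.
move=> Hf; apply: (PT_ext (f := fun x => Bn (dval ([seq false | _ <- nseq (f x) tt] ++ [:: true])))).
  move=> x; congr Bn; rewrite dval_cat size_map size_nseq /= muln1.
  by elim: (f x) => [|n IH] //=; rewrite add0n expnS; lia.
by apply: PT_Bn_dval; apply: PT_cat; [apply: PT_map => //; [exact: PT_units|exact: PT_cst]|exact: PT_cst].
Qed.

(** * Fractions *)

(* [(p, (q, d))] stands for (p - q) / d. *)
Definition bfrac : Type := bnat * (bnat * bnat).

(** Fractions are never reduced, which spares a gcd; the growth of denominators is controlled only
    where it accumulates, in [fdot]. Splitting numerators as p - q avoids signs. *)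
Definition fadd (x y : bfrac) : bfrac :=
  (badd (bmul x.1 y.2.2) (bmul y.1 x.2.2),
   (badd (bmul x.2.1 y.2.2) (bmul y.2.1 x.2.2), bmul x.2.2 y.2.2)).

Definition fmul (x y : bfrac) : bfrac :=
  (badd (bmul x.1 y.1) (bmul x.2.1 y.2.1),
   (badd (bmul x.1 y.2.1) (bmul x.2.1 y.1), bmul x.2.2 y.2.2)).

Definition fle (x y : bfrac) : bool :=
  bleq (badd (bmul x.1 y.2.2) (bmul y.2.1 x.2.2))
       (badd (bmul y.1 x.2.2) (bmul x.2.1 y.2.2)).

Definition frac0 : bfrac := (Bn 0, (Bn 0, Bn 1)).
Definition frac1 : bfrac := (Bn 1, (Bn 0, Bn 1)).

Lemma PT_fadd X {cX : coded X} (f g : X -> bfrac) : PT f -> PT g -> PT (fun x => fadd (f x) (g x)).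
Proof. by apply: PT_app2; rewrite /fadd; pt. Qed.

Lemma PT_fmul X {cX : coded X} (f g : X -> bfrac) : PT f -> PT g -> PT (fun x => fmul (f x) (g x)).
Proof. by apply: PT_app2; rewrite /fmul; pt. Qed.

Lemma PT_fle X {cX : coded X} (f g : X -> bfrac) : PT f -> PT g -> PT (fun x => fle (f x) (g x)).
Proof. by apply: PT_app2; rewrite /fle; pt. Qed.

Ltac pt_user ::= lazymatch goal with
  | |- PT (fun x => badd _ _) => apply: PT_badd
  | |- PT (fun x => bmul _ _) => apply: PT_bmul
  | |- PT (fun x => bleq _ _) => apply: PT_bleq
  | |- PT (fun x => binary (bv _)) => apply: PT_digits
  | |- PT (fun x => Bn (2 ^ _)) => apply: PT_bexp2
  | |- PT (fun x => Bn _) => apply: PT_Bn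
  | |- PT (fun x => fadd _ _) => apply: PT_fadd
  | |- PT (fun x => fmul _ _) => apply: PT_fmul
  | |- PT (fun x => fle _ _) => apply: PT_fle
  end.

Definition fdot (n : nat) (u v : seq bfrac) : bfrac :=
  foldl (fun a i => fadd a (fmul (nth frac0 u i) (nth frac0 v i))) frac0 (iota 0 n).

Definition frac_lt (x : bfrac) (e : nat) : bool :=
  [&& bv x.1 < 2 ^ e, bv x.2.1 < 2 ^ e & bv x.2.2 < 2 ^ e].

Lemma frac_lt_csz x : frac_lt x (csz x).
Proof.
have Hle n k : n <= csz x -> bv k < 2 ^ n -> bv k < 2 ^ csz x.
  by move=> le lt; apply: leq_trans lt _; rewrite leq_pexp2l.
apply/and3P; case: x Hle => p [q d] Hle.
by split; (apply: Hle; last exact: bnat_lt); rewrite !csz_pair /=; lia.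
Qed.

Lemma csz_frac x e : frac_lt x e -> csz x <= 12 * e + 5.
Proof.
case: x => p [q d] /and3P /= [/csz_bnat a /csz_bnat b /csz_bnat c].
by rewrite !csz_pair /=; lia.
Qed.

Lemma csz_nth A {cA : coded A} (d : A) (l : seq A) i : csz (nth d l i) <= csz d + csz l.
Proof.
elim: l i => [|a l IH] [|i] /=; rewrite ?csz_cons; try by lia.
by apply: leq_trans (IH i) _; lia.
Qed.

Lemma ltn_exp2D a b e f : a < 2 ^ e -> b < 2 ^ f -> a * b < 2 ^ (e + f).
Proof. by move=> la lb; rewrite expnD; apply: ltn_mul. Qed.

Lemma csz_Bn0 : csz (Bn 0) = 1.
Proof. by have -> : csz (Bn 0) = csz (binary 0) by []; rewrite binary0. Qed.

Lemma csz_Bn1 : csz (Bn 1) = 5.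
Proof. by have -> : csz (Bn 1) = csz (binary 1) by []; rewrite binaryS ?binary0. Qed.

Lemma csz_frac0 : csz frac0 = 9.
Proof. by rewrite !csz_pair /= csz_Bn0 csz_Bn1. Qed.

(** The denominators of the terms get multiplied together, yet each new term lengthens the three
    components by a fixed number of bits, so the growth is linear in the number of terms. *)
Lemma PT_fdot X {cX : coded X} (n : X -> nat) (u v : X -> seq bfrac) : PT n -> PT u -> PT v ->
  PT (fun x => fdot (n x) (u x) (v x)).
Proof.
apply: PT_app3; rewrite /fdot.
(* A bit bound for any item read from the vectors, the default [frac0] of an index out of range
   included. *)
pose E s := 2 * (s + 20).
apply: (PT_foldl (bd := fun s => 12 * (s * (2 * E s + 2) + 1) + 5)
  (s := fun z i a => fadd a (fmul (nth frac0 z.2.1 i) (nth frac0 z.2.2 i)))).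
- by rewrite /E; pbd.
- by pt.
- by pt.
- by pt.
move=> z k; apply: csz_frac; set s := csz z.
have He i : frac_lt (nth frac0 z.2.1 i) (E s) /\ frac_lt (nth frac0 z.2.2 i) (E s).
  have H (l : seq bfrac) : csz l <= s -> frac_lt (nth frac0 l i) (E s).
    move=> ls; have lc : csz (nth frac0 l i) <= csz frac0 + csz l by exact: csz_nth.
    rewrite csz_frac0 in lc; have /and3P [a b c] := frac_lt_csz (nth frac0 l i).
    have le : 2 ^ csz (nth frac0 l i) <= 2 ^ E s by rewrite leq_pexp2l // /E; lia.
    by apply/and3P; split; [apply: leq_trans a le|apply: leq_trans b le|apply: leq_trans c le].
  by split; apply: H; rewrite /s; case: (z) => a [b c]; rewrite !csz_pair /=; lia.
have Hk : size (take k (iota 0 z.1)) <= s.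
  rewrite size_take_min; apply: leq_trans (geq_minr _ _) _.
  by rewrite size_iota /s; case: (z) => a b; rewrite csz_pair csz_nat /=; lia.
have key l e a : frac_lt a e ->
   frac_lt (foldl (fun a i => fadd a (fmul (nth frac0 z.2.1 i) (nth frac0 z.2.2 i))) a l)
     (size l * (2 * E s + 2) + e).
  elim: l e a => [|i l IH] e a Ha //=.
  have -> : (size l).+1 * (2 * E s + 2) + e = size l * (2 * E s + 2) + (e + (2 * E s + 2)).
    by rewrite mulSn; lia.
  suff /IH H : frac_lt (fadd a (fmul (nth frac0 z.2.1 i) (nth frac0 z.2.2 i))) (e + (2 * E s + 2)).
    exact: H.
  have [/and3P [b1 b2 b3] /and3P [c1 c2 c3]] := He i.
  case/and3P: Ha => a1 a2 a3.
  move: (E s) b1 b2 b3 c1 c2 c3 => F b1 b2 b3 c1 c2 c3.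
  rewrite /frac_lt /=.
  have D : 2 ^ (e + (2 * F + 2)) = 4 * 2 ^ (e + (F + F)) by have -> : e + (2 * F + 2) = 2 + (e + (F + F)) by [lia]; rewrite expnD.
  have D1 : 2 ^ (e + (F + F)) = 2 ^ ((F + F) + e) by congr (_ ^ _); lia.
  have h1 := ltn_exp2D a1 (ltn_exp2D b3 c3).
  have h2 := ltn_exp2D (ltn_exp2D b1 c1) a3.
  have h3 := ltn_exp2D (ltn_exp2D b2 c2) a3.
  have h4 := ltn_exp2D a2 (ltn_exp2D b3 c3).
  have h5 := ltn_exp2D (ltn_exp2D b1 c2) a3.
  have h6 := ltn_exp2D (ltn_exp2D b2 c1) a3.
  have h7 := ltn_exp2D a3 (ltn_exp2D b3 c3).
  by apply/and3P; rewrite D !mulnDl; split; lia.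
have := key (take k (iota 0 z.1)) 1 frac0 isT.
set r := foldl _ _ _ => /and3P [r1 r2 r3].
have le : 2 ^ (size (take k (iota 0 z.1)) * (2 * E s + 2) + 1) <= 2 ^ (s * (2 * E s + 2) + 1).
  by rewrite leq_pexp2l // leq_add2r leq_mul2r Hk orbT.
by apply/and3P; split; [apply: leq_trans r1 le|apply: leq_trans r2 le|apply: leq_trans r3 le].
Qed.

Definition slice (l : seq bfrac) (o k : nat) : seq bfrac := [seq nth frac0 l (o + i) | i <- iota 0 k].

Lemma PT_slice X {cX : coded X} (l : X -> seq bfrac) (o k : X -> nat) : PT l -> PT o -> PT k ->
  PT (fun x => slice (l x) (o x) (k x)).
Proof. by apply: PT_app3; rewrite /slice; pt. Qed.

(** * Raw queries *)

(** A rational as it appears in a string: sign, numerator, denominator. It may fail to be in lowest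
    terms, or even to denote a rational. *)
Definition rtoken : Type := bool * (bnat * bnat).

Lemma PT_encode_nat X {cX : coded X} (f : X -> bnat) : PT f -> PT (fun x => encode_nat (bv (f x))).
Proof. by apply: (PT_app1 (g := fun n => encode_nat (bv n))); rewrite /encode_nat; pt. Qed.

Definition encode_rtoken (r : rtoken) : seq bool :=
  r.1 :: encode_nat (bv r.2.1) ++ encode_nat (bv r.2.2).

Definition encode_raw (n m : bnat) (L : seq rtoken) : seq bool :=
  encode_nat (bv n) ++ encode_nat (bv m) ++ flatten [seq encode_rtoken r | r <- L].

Ltac pt_user0 := lazymatch goal with
  | |- PT (fun x => badd _ _) => apply: PT_badd
  | |- PT (fun x => bmul _ _) => apply: PT_bmul
  | |- PT (fun x => bleq _ _) => apply: PT_bleq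
  | |- PT (fun x => binary (bv _)) => apply: PT_digits
  | |- PT (fun x => Bn (2 ^ _)) => apply: PT_bexp2
  | |- PT (fun x => Bn (dval _)) => apply: PT_Bn_dval
  | |- PT (fun x => Bn _) => apply: PT_Bn
  | |- PT (fun x => fadd _ _) => apply: PT_fadd
  | |- PT (fun x => fmul _ _) => apply: PT_fmul
  | |- PT (fun x => fle _ _) => apply: PT_fle
  | |- PT (fun x => fdot _ _ _) => apply: PT_fdot
  | |- PT (fun x => slice _ _ _) => apply: PT_slice
  | |- PT (fun x => encode_nat (bv _)) => apply: PT_encode_nat
  end.
Ltac pt_user ::= pt_user0.

Lemma PT_encode_raw X {cX : coded X} (n m : X -> bnat) (L : X -> seq rtoken) : PT n -> PT m -> PT L ->
  PT (fun x => encode_raw (n x) (m x) (L x)).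
Proof. by apply: PT_app3; rewrite /encode_raw /encode_rtoken; pt. Qed.

(* Phases: 0 and 1 for the dimensions, 2 for a sign, 3 for a numerator, 4 for
   a denominator. The flag is set between the two bits of a digit. *)
Definition tok_state : Type := nat * (bool * (seq bool * seq bnat)).

Definition next_phase (p : nat) : nat := nth 2 [:: 1; 2; 2; 4; 2] p.

Definition tok_step (s : tok_state) (b : bool) : tok_state :=
  let: p := s.1 in let: cur := s.2.2.1 in let: out := s.2.2.2 in
  if p == 2 then (3, (false, ([::], (if b then Bn 1 else Bn 0) :: out)))
  else if s.2.1 then (p, (false, (b :: cur, out)))
  else if b then (p, (true, (cur, out)))
  else (next_phase p, (false, ([::], Bn (dval (rev cur)) :: out))).

Definition tok_init : tok_state := (0, (false, ([::], [::]))).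

Definition tokens (x : seq bool) : seq bnat := rev (foldl tok_step tok_init x).2.2.2.

Lemma csz_trim d : csz (trim d) <= csz d.
Proof.
elim: d => [|b d IH] //=; rewrite -/(trim d) csz_cons.
by case: ifP => _; rewrite ?csz_cons; lia.
Qed.

Lemma csz_Bn_dval d : csz (Bn (dval d)) <= csz d.
Proof. by have -> : csz (Bn (dval d)) = csz (trim d) by [rewrite trimE]; exact: csz_trim. Qed.

Lemma csz_rev A {cA : coded A} (l : seq A) : csz (rev l) = csz l.
Proof.
elim: l => [|a l IH] //; rewrite rev_cons -cats1 csz_cat IH !csz_cons csz_nil; lia.
Qed.

Lemma PT_tokens X {cX : coded X} (f : X -> seq bool) : PT f -> PT (fun x => tokens (f x)).
Proof.
apply: PT_app1; rewrite /tokens; apply: PT_rev; do 3! apply: PT_snd.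
apply: (PT_foldl_incr (s := fun _ b s => tok_step s b) (q := fun=> 30)); [by pbd| | | |].
- by pt.
- by pt.
- by rewrite /tok_step /next_phase; pt.
move=> x b [p [mk [cur out]]]; rewrite /tok_step /=.
case: ifP => _; first by case: b; rewrite !(csz_pair, csz_cons, csz_nil, csz_bool, csz_nat, csz_Bn0, csz_Bn1) /=; lia.
case: ifP => _; first by case: b; rewrite !(csz_pair, csz_cons, csz_nil, csz_bool, csz_nat) /=; lia.
case: ifP => _; first by rewrite !(csz_pair, csz_cons, csz_nil, csz_bool, csz_nat) /=; lia.
rewrite !(csz_pair, csz_cons, csz_nil, csz_bool, csz_nat) /=.
have : next_phase p <= 4 by case: p => [|[|[|[|[|p]]]]] //; rewrite /next_phase /= nth_nil.
by have := csz_Bn_dval (rev cur); rewrite csz_rev; lia.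
Qed.

Lemma tokens_nat p out n w : p != 2 ->
  foldl tok_step (p, (false, ([::], out))) (encode_nat n ++ w)
  = foldl tok_step (next_phase p, (false, ([::], Bn n :: out))) w.
Proof.
move=> Hp.
have H d cur : foldl tok_step (p, (false, (cur, out))) (flatten [seq [:: true; b] | b <- d] ++ [:: false] ++ w)
    = foldl tok_step (next_phase p, (false, ([::], Bn (dval (rev (catrev d cur))) :: out))) w.
  elim: d cur => [|b d IH] cur /=; first by congr foldl; rewrite /tok_step /= (negPf Hp).
  have -> : tok_step (tok_step (p, (false, (cur, out))) true) b = (p, (false, (b :: cur, out))).
    by rewrite /tok_step /= (negPf Hp) /= (negPf Hp).
  exact: IH.
by rewrite /encode_nat -catA H catrevE cats0 revK dval_binary.
Qed.

Definition tokens_of (r : rtoken) : seq bnat :=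
  [:: if r.1 then Bn 1 else Bn 0; r.2.1; r.2.2].

Lemma tokens_encode_raw n m L :
  tokens (encode_raw n m L) = n :: m :: flatten [seq tokens_of r | r <- L].
Proof.
case: n m => [n] [m]; rewrite /tokens /encode_raw /tok_init !tokens_nat //=.
have H out : foldl tok_step (2, (false, ([::], out))) (flatten [seq encode_rtoken r | r <- L])
    = (2, (false, ([::], rev (flatten [seq tokens_of r | r <- L]) ++ out))).
  elim: L out => //= [[s [[p] [d]]] L IH] out /=.
  rewrite -catA tokens_nat // tokens_nat //= IH.
  by rewrite !rev_cons -!cats1 -!catA.
by rewrite H rev_cat revK.
Qed.

Definition rtoken_at (t : seq bnat) (k : nat) : rtoken :=
  (~~ bleq (nth (Bn 0) t (2 + 3 * k)) (Bn 0),
   (nth (Bn 0) t (3 + 3 * k), nth (Bn 0) t (4 + 3 * k))).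

Definition rtokens (K : nat) (t : seq bnat) : seq rtoken := [seq rtoken_at t k | k <- iota 0 K].

Lemma rtokens_of n m L : rtokens (size L) (n :: m :: flatten [seq tokens_of r | r <- L]) = L.
Proof.
rewrite /rtokens; elim: L => //= r L IH; congr (_ :: _).
  by case: r => [[] [p d]].
rewrite -[in RHS]IH -[1]/(1 + 0) iotaDl -map_comp; apply: eq_map => k /=.
by rewrite /rtoken_at; congr (_, (_, _)); rewrite mulnDr.
Qed.

Lemma PT_rtokens X {cX : coded X} (K : X -> nat) (t : X -> seq bnat) : PT K -> PT t ->
  PT (fun x => rtokens (K x) (t x)).
Proof. by apply: PT_app2; rewrite /rtokens /rtoken_at; pt. Qed.

(** Dimensions are written in binary but control loops, so they are needed in unary, which could be
    exponentially longer. Cutting at the length of the input does no harm: a query is longer than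
    its dimensions. *)
Definition truncate (B : nat) (n : bnat) : nat :=
  iter B (fun k => if bleq (Bn k.+1) n then k.+1 else k) 0.

Lemma truncateE B n : truncate B n = minn B (bv n).
Proof. by rewrite /truncate; elim: B => [|B /= ->]; rewrite /bleq /=; [lia|case: ifP; lia]. Qed.

Lemma PT_truncate X {cX : coded X} (B : X -> nat) (n : X -> bnat) : PT B -> PT n ->
  PT (fun x => truncate (B x) (n x)).
Proof.
apply: PT_app2; rewrite /truncate.
apply: (PT_iter (s := fun z k => if bleq (Bn k.+1) z.2 then k.+1 else k) (q := fun=> 2)); [by pbd|by pt|by pt| |].
- by pt.
- by move=> x b; case: ifP => _; rewrite !csz_nat; lia.
Qed.

Definition eqbits (a b : seq bool) : bool :=
  (size a == size b) &&
  all (fun i => if nth false a i then nth false b i else ~~ nth false b i) (iota 0 (size a)).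

Lemma eqbitsE a b : eqbits a b = (a == b).
Proof.
apply/idP/eqP => [/andP [/eqP E /allP H]|->]; last first.
  by rewrite /eqbits eqxx; apply/allP => i _; case: (nth _ _ _).
apply: (@eq_from_nth _ false) => // i Hi; have := H i; rewrite mem_iota /= add0n => /(_ Hi).
by case: (nth _ a i); case: (nth _ b i).
Qed.

Lemma PT_eqbits X {cX : coded X} (a b : X -> seq bool) : PT a -> PT b ->
  PT (fun x => eqbits (a x) (b x)).
Proof. by apply: PT_app2; rewrite /eqbits; pt. Qed.

Definition frac_of (r : rtoken) : bfrac :=
  (if r.1 then Bn 0 else r.2.1, (if r.1 then r.2.1 else Bn 0, r.2.2)).

Lemma PT_frac_of X {cX : coded X} (r : X -> rtoken) : PT r -> PT (fun x => frac_of (r x)).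
Proof. by apply: PT_app1; rewrite /frac_of; pt. Qed.

Ltac pt_user1 := lazymatch goal with
  | |- PT (fun x => encode_raw _ _ _) => apply: PT_encode_raw
  | |- PT (fun x => tokens _) => apply: PT_tokens
  | |- PT (fun x => rtokens _ _) => apply: PT_rtokens
  | |- PT (fun x => truncate _ _) => apply: PT_truncate
  | |- PT (fun x => eqbits _ _) => apply: PT_eqbits
  | |- PT (fun x => frac_of _) => apply: PT_frac_of
  | |- _ => pt_user0
  end.
Ltac pt_user ::= pt_user1.

(** * The verifier *)

(* Dimensions, then the entries of the query in the order of [encode_query]. *)
Definition data : Type := nat * (nat * seq bfrac).

Notation dn D := (fst D) (only parsing).
Notation dm D := (fst (snd D)) (only parsing).
Notation dl D := (snd (snd D)) (only parsing).

Definition e_c11 (D : data) : seq bfrac := slice (dl D) 0 (dn D).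
Definition e_c21 (D : data) : seq bfrac := slice (dl D) (dn D) (dn D).
Definition e_c22 (D : data) : bfrac := nth frac0 (dl D) (2 * dn D).
Definition e_row (D : data) (i : nat) : seq bfrac := slice (dl D) (2 * dn D + 1 + i * dn D) (dn D).
Definition e_col (D : data) (j : nat) : seq bfrac :=
  [seq nth frac0 (dl D) (2 * dn D + 1 + i * dn D + j) | i <- iota 0 (dm D)].
Definition e_A12 (D : data) : seq bfrac := slice (dl D) (2 * dn D + 1 + dm D * dn D) (dm D).
Definition e_b1 (D : data) : seq bfrac := slice (dl D) (2 * dn D + 1 + dm D * dn D + dm D) (dm D).
Definition e_p1 (D : data) : seq bfrac := slice (dl D) (2 * dn D + 1 + dm D * dn D + 2 * dm D) (dn D).
Definition e_p2 (D : data) : bfrac := nth frac0 (dl D) (3 * dn D + 1 + dm D * dn D + 2 * dm D).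
Definition entries (n m : nat) : nat := 3 * n + 2 + m * n + 2 * m.

Lemma PT_e X {cX : coded X} (D : X -> data) : PT D ->
  (PT (fun x => e_c11 (D x)) /\ PT (fun x => e_c21 (D x)) /\ PT (fun x => e_c22 (D x))) /\
  (PT (fun x => e_A12 (D x)) /\ PT (fun x => e_b1 (D x)) /\ PT (fun x => e_p1 (D x))) /\
  PT (fun x => e_p2 (D x)).
Proof.
move=> HD; do ! split; move: D HD; apply: PT_app1;
 by rewrite /e_c11 /e_c21 /e_c22 /e_A12 /e_b1 /e_p1 /e_p2; pt.
Qed.

Lemma PT_e_row X {cX : coded X} (D : X -> data) (i : X -> nat) : PT D -> PT i ->
  PT (fun x => e_row (D x) (i x)).
Proof. by apply: PT_app2; rewrite /e_row; pt. Qed.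

Lemma PT_e_col X {cX : coded X} (D : X -> data) (i : X -> nat) : PT D -> PT i ->
  PT (fun x => e_col (D x) (i x)).
Proof. by apply: PT_app2; rewrite /e_col; pt. Qed.

Ltac pt_user2 := lazymatch goal with
  | |- PT (fun x => e_c11 _) => refine (proj1 (proj1 (PT_e _)))
  | |- PT (fun x => e_c21 _) => refine (proj1 (proj2 (proj1 (PT_e _))))
  | |- PT (fun x => e_c22 _) => refine (proj2 (proj2 (proj1 (PT_e _))))
  | |- PT (fun x => e_A12 _) => refine (proj1 (proj1 (proj2 (PT_e _))))
  | |- PT (fun x => e_b1 _) => refine (proj1 (proj2 (proj1 (proj2 (PT_e _)))))
  | |- PT (fun x => e_p1 _) => refine (proj2 (proj2 (proj1 (proj2 (PT_e _)))))
  | |- PT (fun x => e_p2 _) => refine (proj2 (proj2 (PT_e _)))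
  | |- PT (fun x => e_row _ _) => apply: PT_e_row
  | |- PT (fun x => e_col _ _) => apply: PT_e_col
  | |- _ => pt_user1
  end.
Ltac pt_user ::= pt_user2.

Definition row_value (D : data) (xs : seq bfrac) (x2 : bfrac) (i : nat) : bfrac :=
  fadd (fdot (dn D) (e_row D i) xs) (fmul x2 (nth frac0 (e_A12 D) i)).

Definition check_feasible (D : data) (xs : seq bfrac) (x2 : bfrac) : bool :=
  all (fun i => fle (nth frac0 (e_b1 D) i) (row_value D xs x2 i)) (iota 0 (dm D))
  && (all (fun j => fle frac0 (nth frac0 xs j) && fle (nth frac0 xs j) frac1) (iota 0 (dn D))
  && (fle frac0 x2 && fle x2 frac1)).

(* Dual feasibility and complementary slackness; the multipliers of the bounds
   on x1 are read off the sign of the reduced cost. *)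
Definition check_dual (D : data) (xs : seq bfrac) (x2 : bfrac) (ys : seq bfrac) : bool :=
  all (fun i => fle frac0 (nth frac0 ys i) &&
        (fle (nth frac0 ys i) frac0 || fle (row_value D xs x2 i) (nth frac0 (e_b1 D) i)))
      (iota 0 (dm D))
  && all (fun j => (fle (fdot (dm D) (e_col D j) ys) (nth frac0 (e_c11 D) j)
                      || fle frac1 (nth frac0 xs j))
                && (fle (nth frac0 (e_c11 D) j) (fdot (dm D) (e_col D j) ys)
                      || fle (nth frac0 xs j) frac0)) (iota 0 (dn D)).

Definition objective (D : data) (xs : seq bfrac) (x2 : bfrac) : bfrac :=
  fadd (fdot (dn D) (e_c21 D) xs) (fmul (e_c22 D) x2).

Definition flt (x y : bfrac) : bool := ~~ fle y x.

(* The certificate lists x1', x2' and the multipliers of the m constraints. *)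
Definition check_improvement (D : data) (C : seq bfrac) : bool :=
  ~~ check_feasible D (e_p1 D) (e_p2 D)
  || (all (fun f => ~~ bleq f.2.2 (Bn 0)) C &&
     ((check_feasible D (slice C 0 (dn D)) (e_p2 D)
       && flt (fdot (dn D) (e_c11 D) (slice C 0 (dn D))) (fdot (dn D) (e_c11 D) (e_p1 D)))
     || (check_feasible D (slice C 0 (dn D)) (nth frac0 C (dn D))
         && (check_dual D (slice C 0 (dn D)) (nth frac0 C (dn D)) (slice C (dn D).+1 (dm D))
         && flt (objective D (slice C 0 (dn D)) (nth frac0 C (dn D)))
                (objective D (e_p1 D) (e_p2 D)))))).

(** A zero denominator or a negative zero. Together with a common factor of numerator and
    denominator, these are the ways in which a token can fail to be the code of a rational. *)
Definition check_entry (r : rtoken) : bool := bleq r.2.2 (Bn 0) || (r.1 && bleq r.2.1 (Bn 0)).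

Definition beq (m n : bnat) : bool := bleq m n && bleq n m.

(* The certificate exhibits an entry (g f) / (g e). *)
Definition check_common_factor (L : seq rtoken) (c : seq bnat) : bool :=
  bleq (Bn 2) (nth (Bn 0) c 0) &&
  has (fun r => beq r.2.1 (bmul (nth (Bn 0) c 0) (nth (Bn 0) c 3))
             && beq r.2.2 (bmul (nth (Bn 0) c 0) (nth (Bn 0) c 1))) L.

(** The parser never fails; whether it has read the string faithfully is decided afterwards by
    encoding the result again. *)
Definition parse_query (x : seq bool) : nat * (nat * seq rtoken) :=
  let n := truncate (size x) (nth (Bn 0) (tokens x) 0) in
  let m := truncate (size x) (nth (Bn 0) (tokens x) 1) in
  (n, (m, rtokens (entries n m) (tokens x))).

Definition data_of (q : nat * (nat * seq rtoken)) : data :=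
  (q.1, (q.2.1, [seq frac_of r | r <- q.2.2])).

(* A string that does not encode a query in reduced form is accepted too, being
   outside the language. *)
Definition verify_parsed (x : seq bool) (q : nat * (nat * seq rtoken)) (c : seq bnat) : bool :=
  ~~ eqbits (encode_raw (Bn q.1) (Bn q.2.1) q.2.2) x
  || (has check_entry q.2.2 || (check_common_factor q.2.2 c
  || check_improvement (data_of q) [seq frac_of r | r <- rtokens (q.1 + 1 + q.2.1) c])).

Definition verify (x y : seq bool) : bool := verify_parsed x (parse_query x) (tokens y).

Lemma PT_row_value X {cX : coded X} (D : X -> data) xs x2 (i : X -> nat) :
  PT D -> PT xs -> PT x2 -> PT i -> PT (fun x => row_value (D x) (xs x) (x2 x) (i x)).
Proof. by apply: PT_app4; rewrite /row_value; pt. Qed.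

Ltac pt_user3 := lazymatch goal with
  | |- PT (fun x => row_value _ _ _ _) => apply: PT_row_value
  | |- _ => pt_user2
  end.
Ltac pt_user ::= pt_user3.

Lemma PT_check_feasible X {cX : coded X} (D : X -> data) xs x2 :
  PT D -> PT xs -> PT x2 -> PT (fun x => check_feasible (D x) (xs x) (x2 x)).
Proof. by apply: PT_app3; rewrite /check_feasible; pt. Qed.

Lemma PT_check_dual X {cX : coded X} (D : X -> data) xs x2 ys :
  PT D -> PT xs -> PT x2 -> PT ys -> PT (fun x => check_dual (D x) (xs x) (x2 x) (ys x)).
Proof. by apply: PT_app4; rewrite /check_dual; pt. Qed.

Lemma PT_objective X {cX : coded X} (D : X -> data) xs x2 :
  PT D -> PT xs -> PT x2 -> PT (fun x => objective (D x) (xs x) (x2 x)).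
Proof. by apply: PT_app3; rewrite /objective; pt. Qed.

Ltac pt_user4 := lazymatch goal with
  | |- PT (fun x => check_feasible _ _ _) => apply: PT_check_feasible
  | |- PT (fun x => check_dual _ _ _ _) => apply: PT_check_dual
  | |- PT (fun x => objective _ _ _) => apply: PT_objective
  | |- _ => pt_user3
  end.
Ltac pt_user ::= pt_user4.

Lemma PT_check_improvement X {cX : coded X} (D : X -> data) (C : X -> seq bfrac) :
  PT D -> PT C -> PT (fun x => check_improvement (D x) (C x)).
Proof. by apply: PT_app2; rewrite /check_improvement /flt; pt. Qed.

Lemma PT_check_common_factor X {cX : coded X} (L : X -> seq rtoken) (C : X -> seq bnat) :
  PT L -> PT C -> PT (fun x => check_common_factor (L x) (C x)).
Proof. by apply: PT_app2; rewrite /check_common_factor /beq; pt. Qed.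

Lemma PT_verify : PT (fun z : seq bool * seq bool => verify z.1 z.2).
Proof.
have Hp : PT (fun z : seq bool * seq bool => parse_query z.1) by rewrite /parse_query /entries; pt.
have H : PT (fun z : seq bool * ((nat * (nat * seq rtoken)) * seq bnat) =>
    verify_parsed z.1 z.2.1 z.2.2).
  rewrite /verify_parsed; apply: PT_or; first by pt.
  apply: PT_or; first by pt; rewrite /check_entry; pt.
  apply: PT_or; first by apply: PT_check_common_factor; pt.
  by apply: PT_check_improvement; rewrite /data_of; pt.
exact: (PT_comp H (PT_pair (PT_fst PT_id) (PT_pair Hp (PT_tokens (PT_snd PT_id))))).
Qed.

(** * From coded functions to machines *)

Lemma run_push_word w s : run (push_word w) s (put R0 (w ++ get R0 s) s) (2 * size w).
Proof.
elim: w => [|b w IH] /=.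
  have -> : put R0 (get R0 s) s = s by case: s => [[[a b] c] d].
  by apply: run_exec; apply: ExecSkip.
rewrite mulnS addnC; apply: run_seq IH _; apply: run_exec.
have := ExecPush R0 b (put R0 (w ++ get R0 s) s).
by case: s => [[[a b0] c] d].
Qed.

Definition build (r : reg) : cmd :=
  While r isSome (Case r Skip
    (Seq (Pop r) (push_word (true :: enc (code false))))
    (Seq (Pop r) (push_word (true :: enc (code true))))).

Definition built (w e : seq bool) : seq bool :=
  foldl (fun e b => true :: enc (code b) ++ e) e w.

Lemma built_rev x e : built (rev x) (false :: e) = enc (code x) ++ e.
Proof.
by rewrite /built foldl_rev; elim: x => //= b x ->; rewrite -catA.
Qed.

Lemma run_build r w s : r <> R0 -> get r s = w ->
  run (build r) s (put R0 (built w (get R0 s)) (put r [::] s)) (11 * size w + 1).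
Proof.
move=> nr; elim: w s => [|b w IH] s E.
  have -> : put R0 (built [::] (get R0 s)) (put r [::] s) = s.
    by move: E; case: (s) => [[[a b] c] d]; case: (r) nr => //= _ ->.
  by apply: run_exec; apply: ExecStop; rewrite E.
set e := true :: enc (code b).
set s1 := put R0 (e ++ get R0 s) (put r w s).
have E1 : get r s1 = w by rewrite /s1; case: (s) => [[[a1 b1] c] d]; case: (r) nr.
have -> : put R0 (built (b :: w) (get R0 s)) (put r [::] s)
        = put R0 (built w (get R0 s1)) (put r [::] s1).
  by rewrite /s1; case: (s) => [[[a1 b1] c] d]; case: (r) nr.
apply: (@run_le _ _ _ (10 + (11 * size w + 1)).+1); last by rewrite /=; lia.
apply: run_loop (IH _ E1); first by rewrite E.
apply: (@run_le _ _ _ (1 + 2 * size e).+1); last by rewrite /e; case: (b).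
apply: run_case; rewrite E /=.
have H1 : run (Pop r) s (put r w s) 1 by have := ExecPop r s; rewrite E => /run_exec.
have H2 := run_push_word e (put r w s).
have E2 : put R0 (e ++ get R0 (put r w s)) (put r w s) = s1.
  by rewrite /s1; case: (s) => [[[a1 b1] c] d]; case: (r) nr.
rewrite E2 in H2; have := run_seq H1 H2.
by rewrite /e; case: (b).
Qed.

(** The code of a list is built on [R0] from its last item backwards, hence the preliminary
    reversal. *)
Definition input1 : cmd := Seq (pour R0 R3) (Seq (Push R0 false) (build R3)).

Lemma run_input1 x :
  run input1 (x, [::], [::], [::]) (enc (code x), [::], [::], [::]) (20 * size x + 4).
Proof.
apply: (@run_le _ _ _ ((5 * size x + 1) + (2 + (11 * size (rev x) + 1)))); last by rewrite size_rev; lia.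
apply: run_seq.
  by have := @run_pour R0 R3 (x, [::], [::], [::]) isT; rewrite /= cats0; exact.
apply: run_seq; first by apply: run_exec; exact: (ExecPush R0).
by have := @run_build R3 (rev x) ([:: false], [::], [::], rev x) (ltac:(done)) erefl;
   rewrite /= built_rev cats0.
Qed.

Definition input2 : cmd :=
  Seq (pour R0 R3) (Seq (pour R1 R2) (Seq (Push R0 false) (Seq (build R2)
    (Seq (Push R0 false) (Seq (build R3) (Push R0 true)))))).

Lemma run_input2 x y : run input2 (x, y, [::], [::])
  (enc (code (x, y)), [::], [::], [::]) (20 * (size x + size y) + 10).
Proof.
apply: (@run_le _ _ _ ((5 * size x + 1) + ((5 * size y + 1) + (2 + ((11 * size (rev y) + 1) +
  (2 + ((11 * size (rev x) + 1) + 2))))))); last by rewrite !size_rev; lia.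
apply: run_seq.
  by have := @run_pour R0 R3 (x, y, [::], [::]) isT; rewrite /= cats0; exact.
apply: run_seq.
  by have := @run_pour R1 R2 ([::], y, [::], rev x) isT; rewrite /= cats0; exact.
apply: run_seq; first by apply: run_exec; exact: (ExecPush R0).
apply: run_seq.
  by have := @run_build R2 (rev y) ([:: false], [::], rev y, rev x) (ltac:(done)) erefl;
   rewrite /= built_rev cats0; exact.
apply: run_seq; first by apply: run_exec; exact: (ExecPush R0).
apply: run_seq.
  by have := @run_build R3 (rev x) (false :: enc (code y), [::], [::], rev x) (ltac:(done)) erefl;
   rewrite /= built_rev; exact.
by apply: run_exec; exact: (ExecPush R0).
Qed.

Definition output_body : cmd :=
  Seq (Pop R0) (Case R0 Skip (Seq (Pop R0) (Push R1 false))
    (Seq (Pop R0) (Seq (Pop R0) (Seq (Pop R0) (Push R1 true))))).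

Definition output : cmd :=
  Seq (While R0 (fun o => o == Some true) output_body) (Seq (Pop R0) (pour R1 R0)).

Lemma run_output (w : seq bool) :
  run output (enc (code w), [::], [::], [::]) (w, [::], [::], [::]) (20 * size w + 3).
Proof.
have H v : run (While R0 (fun o => o == Some true) output_body) (enc (code w), v, [::], [::])
    ([:: false], catrev w v, [::], [::]) (8 * size w + 1).
  elim: w v => [|b w IH] v; first by apply: run_exec; apply: ExecStop.
  apply: (@run_le _ _ _ (7 + (8 * size w + 1)).+1); last by rewrite /=; lia.
  apply: run_loop (IH (b :: v)) => //.
  apply: (@run_le _ _ _ (1 + (if b then 1 + (1 + (1 + 2)) else 1 + 2).+1)); last by case: b.
  apply: (@run_seq _ _ _ (enc (code b) ++ enc (code w), v, [::], [::])).
    by apply: run_exec; exact: (ExecPop R0).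
  apply: run_case; case: b => /=; apply: run_exec.
    apply: ExecSeq; first exact: (ExecPop R0).
    apply: ExecSeq; first exact: (ExecPop R0).
    apply: ExecSeq; first exact: (ExecPop R0).
    exact: (ExecPush R1).
  by apply: ExecSeq; [exact: (ExecPop R0)|exact: (ExecPush R1)].
apply: (@run_le _ _ _ ((8 * size w + 1) + (1 + (5 * size (rev w) + 1)))); last by rewrite size_rev; lia.
apply: run_seq; first exact: H.
apply: run_seq; first by apply: run_exec; exact: (ExecPop R0).
have := @run_pour R1 R0 ([::], rev w, [::], [::]) isT.
by rewrite /= revK cats0; exact.
Qed.

Definition output_bool : cmd :=
  Case R0 Skip Skip (Seq (Pop R0) (Seq (Pop R0) (Seq (Pop R0) (Push R0 true)))).

Lemma run_output_bool (b : bool) :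
  run output_bool (enc (code b), [::], [::], [::]) ([:: b], [::], [::], [::]) 6.
Proof.
apply: (@run_le _ _ _ (if b then 1 + (1 + (1 + 2)) else 0).+1); last by case: b.
apply: run_case; case: b => /=; apply: run_exec; last exact: ExecSkip.
apply: ExecSeq; first exact: (ExecPop R0).
apply: ExecSeq; first exact: (ExecPop R0).
apply: ExecSeq; first exact: (ExecPop R0).
exact: (ExecPush R0).
Qed.

Lemma run_of_runs c t t' T : runs c [:: t] [:: t'] T ->
  run c (enc t, [::], [::], [::]) (enc t', [::], [::], [::]) T.
Proof. by move/(_ [::]); rewrite /encs /= !cats0. Qed.

Lemma PT_polytime (f : seq bool -> seq bool) : PT f -> polytime f.
Proof.
move=> Hf; have [r Hr] := PT_size Hf; case: Hf => c [p Hf].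
have [q Hq] : poly_bounded (fun n => (20 * n + 4) + (p.[4 * n + 1] + (20 * r.[4 * n + 1] + 3))) by pbd.
exists (machine_of (Seq input1 (Seq c output))), q => x.
have Hsz := csz_bits x.
have [t le Ht] : run (Seq input1 (Seq c output)) (args_store [:: x]) (f x, [::], [::], [::]) q.[size x].
  apply: run_le (Hq _).
  apply: run_seq; first exact: run_input1.
  apply: run_seq.
    by apply: run_le (leq_horner p Hsz); apply: run_of_runs (Hf x).
  apply: run_le (run_output (f x)) _; rewrite leq_add2r leq_mul2l /=.
  apply: leq_trans (leq_trans (Hr x) (leq_horner r Hsz)).
  by pose proof (size_csz (f x)); lia.
exact: machine_ofP Ht le.
Qed.

Lemma PT_verifier (V : seq bool -> seq bool -> bool) :
  PT (fun z : seq bool * seq bool => V z.1 z.2) ->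
  exists (M : machine) (p : {poly nat}), forall x y,
    computes_within M [:: x; y] [:: V x y] p.[size x + size y].
Proof.
case=> c [p Hf].
have [q Hq] : poly_bounded (fun n => (20 * n + 10) + (p.[4 * n + 3] + 6)) by pbd.
exists (machine_of (Seq input2 (Seq c output_bool))), q => x y.
have Hsz : csz (x, y) <= 4 * (size x + size y) + 3.
  by rewrite csz_pair /=; have := csz_bits x; have := csz_bits y; lia.
have [t le Ht] : run (Seq input2 (Seq c output_bool)) (args_store [:: x; y])
    ([:: V x y], [::], [::], [::]) q.[size x + size y].
  apply: run_le (Hq _).
  apply: run_seq; first exact: run_input2.
  apply: run_seq (run_output_bool _).
  by apply: run_le (leq_horner p Hsz); apply: run_of_runs (Hf (x, y)).
exact: machine_ofP Ht le.
Qed.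

Import Order.TTheory GRing.Theory Num.Theory.
Local Open Scope ring_scope.

(** * Vertices of rational polyhedra *)

Section Vertex.
Variables (R : realFieldType) (p k : nat) (A : 'M[rat]_(p, k)) (b : 'cV[rat]_p).

Local Notation real_mx := (map_mx (ratr : rat -> R)).

Definition slack (z : 'cV[R]_k) (i : 'I_p) : R := (real_mx A *m z) i 0 - ratr (b i 0).

(** Zeroing the other rows keeps the shape fixed and gives the rank of the tight subsystem. The
    matrix is rational although [z] is real. *)
Definition tight_rows (z : 'cV[R]_k) : 'M[rat]_(p, k) :=
  \matrix_(i, j) (if slack z i == 0 then A i j else 0).

Lemma row_tight_rows z i : row i (tight_rows z) = if slack z i == 0 then row i A else 0.
Proof. by apply/rowP => j; rewrite !mxE; case: ifP; rewrite ?mxE. Qed.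

(* Moves along a line that keeps the tight rows tight until one more row
   becomes tight. *)
Lemma tighter z : row_full A -> (forall i, 0 <= slack z i) -> ~~ row_full (tight_rows z) ->
  exists z', (forall i, 0 <= slack z' i) /\ (\rank (tight_rows z) < \rank (tight_rows z'))%N.
Proof.
move=> fullA Hz; rewrite -cokermx_eq0 => nz; set B := tight_rows z in nz *.
(* A direction in the kernel of the tight rows. Since [A] is injective some slack varies along it,
   and decreases after a change of sign if necessary. *)
have [v [Bv [i0 Hi0]]] : exists v : 'cV[rat]_k, B *m v = 0 /\ exists i0, (A *m v) i0 0 < 0.
  have [j Hj] : exists j, col j (cokermx B) != 0.
    apply/existsP; rewrite -negb_forall; apply: contra nz => /forallP H.
    by apply/eqP/matrixP => i j; have /eqP/colP/(_ i) := H j; rewrite !mxE.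
  set v := col j _ in Hj.
  have Bv : B *m v = 0 by rewrite /v colE mulmxA mulmx_coker mul0mx.
  have Av : A *m v != 0.
    by apply: contra Hj => /eqP Av; apply/eqP/(row_full_inj fullA); rewrite mulmx0.
  have [i Hi] : exists i, (A *m v) i 0 != 0.
    apply/existsP; rewrite -negb_forall; apply: contra Av => /forallP H.
    by apply/eqP/colP => i; rewrite (eqP (H i)) mxE.
  have [lt|gt|E] := ltgtP ((A *m v) i 0) 0.
  - by exists v; split=> //; exists i.
  - exists (- v); rewrite mulmxN Bv oppr0; split=> //; exists i.
    by rewrite mulmxN mxE oppr_lt0.
  - by rewrite E eqxx in Hi.
pose w : 'cV[R]_k := real_mx v.
pose dir i : R := ratr ((A *m v) i 0).
have slackD t i : slack (z + t *: w) i = slack z i + t * dir i.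
  rewrite /slack mulmxDr -scalemxAr /w -map_mxM mxE addrAC; congr (_ + _).
  by rewrite mxE; congr (_ * _); rewrite mxE.
have dir0 : dir i0 < 0 by rewrite /dir ltrq0.
have tight_dir i : slack z i = 0 -> dir i = 0.
  move=> E; rewrite /dir; have -> : (A *m v) i 0 = (B *m v) i 0.
    by rewrite !mxE; apply: eq_bigr => j _; rewrite mxE E eqxx.
  by rewrite Bv mxE raddf0.
(* Ratio test: [F i] is the time at which the decreasing row [i] becomes tight, and the smallest one
   is the step to take. *)
pose F i := slack z i / - dir i.
case: (@arg_minP _ _ _ i0 (fun i => dir i < 0) F dir0) => i1 Hi1 Hmin.
exists (z + F i1 *: w).
have F0 : 0 <= F i1 by rewrite /F divr_ge0 // oppr_ge0 ltW.
have Hz' i : 0 <= slack (z + F i1 *: w) i.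
  rewrite slackD; case: (ltP (dir i) 0) => Hd; last by rewrite addr_ge0 // mulr_ge0.
  by have := Hmin i Hd; rewrite /= /F ler_pdivlMr ?oppr_gt0 // -/(F i1); lra.
split=> //.
have E1 : slack (z + F i1 *: w) i1 = 0.
  by rewrite slackD /F invrN mulrN mulNr divfK ?lt_eqF // subrr.
apply: rank_ltmx; rewrite ltmxE; apply/andP; split.
  apply/row_subP => i; rewrite row_tight_rows; case: eqP => [E|_]; last exact: sub0mx.
  suff <- : row i (tight_rows (z + F i1 *: w)) = row i A by apply: row_sub.
  by rewrite row_tight_rows slackD E (tight_dir _ E) mulr0 addr0 eqxx.
apply/negP => /row_subP /(_ i1); rewrite row_tight_rows E1 eqxx => /submxP [C EC].
have : (row i1 A *m v) 0 0 = 0 by rewrite EC -mulmxA Bv mulmx0 mxE.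
have -> : (row i1 A *m v) 0 0 = (A *m v) i1 0.
  by rewrite !mxE; apply: eq_bigr => j _; rewrite mxE.
by move=> E; move: Hi1; rewrite /dir E raddf0 ltxx.
Qed.

(** Repeating [tighter] makes the tight rows of full rank. The point reached solves a nonsingular
    rational system, so it is rational even if [z] is not. *)
Lemma vertex z : row_full A -> (forall i, 0 <= slack z i) ->
  exists f : 'I_k -> 'I_p, rowsub f A \in unitmx /\
    forall i, b i 0 <= (A *m (invmx (rowsub f A) *m rowsub f b)) i 0.
Proof.
move=> fullA.
have [n] := ubnP (k - \rank (tight_rows z)); elim: n z => // n IH z le Hz.
case: (boolP (row_full (tight_rows z))) => [fullB|nfull]; last first.
  have [z' [Hz' lt]] := tighter fullA Hz nfull; apply: IH Hz'.
  have := rank_leq_col (tight_rows z'); lia.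
exists (fullrankfun fullB); set f := fullrankfun _.
have unitB := fullrowsub_unit fullB; rewrite -/f in unitB.
(* A nonsingular matrix has no zero row, so none of the selected rows is one that was zeroed. *)
have tight i : slack z (f i) = 0.
  apply/eqP; apply: contraTT unitB => ni.
  have Ei : row i (rowsub f (tight_rows z)) = 0.
    by rewrite row_rowsub row_tight_rows (negPf ni).
  apply/negP => U; have : delta_mx 0 i *m rowsub f (tight_rows z) = 0 :> 'rV_k by rewrite -rowE.
  move/(congr1 (mulmx^~ (invmx (rowsub f (tight_rows z))))); rewrite mulmxK // mul0mx.
  by move/rowP/(_ i); rewrite !mxE !eqxx => /eqP; rewrite oner_eq0.
have EA : rowsub f (tight_rows z) = rowsub f A.
  by apply/matrixP => i j; rewrite !mxE tight eqxx.
rewrite EA in unitB; split=> //.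
set y := invmx _ *m _.
have Ez : z = real_mx y.
  have U : real_mx (rowsub f A) \in unitmx by rewrite map_unitmx.
  have E : real_mx (rowsub f A) *m z = real_mx (rowsub f b).
    apply/colP => i; have /eqP := tight i; rewrite /slack subr_eq0 => /eqP.
    rewrite !mxE => <-; apply: eq_bigr => j _; by rewrite !mxE.
  by rewrite /y map_mxM -E map_invmx mulKmx.
move=> i; have := Hz i; rewrite /slack Ez -map_mxM [in X in X - _]mxE subr_ge0.
by rewrite ler_rat.
Qed.

End Vertex.

(** * Size of the solutions of linear systems *)

Section Cramer.
Variables (D : rat) (e : nat).

(* [x] becomes an integer with at most [e] bits when multiplied by the common
   denominator [D]. *)
Definition bounded_entry (x : rat) : Prop := D * x \is a Num.int /\ `|D * x| <= 2 ^+ e.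

Lemma det_int k (M : 'M[rat]_k) : (forall i j, M i j \is a Num.int) -> \det M \is a Num.int.
Proof.
move=> H; apply: rpred_sum => s _; apply: rpredM; last by apply: rpred_prod.
by rewrite rpredX // rpredN rpred1.
Qed.

Lemma det_bound k (M : 'M[rat]_k) (B : rat) : 0 <= B -> (forall i j, `|M i j| <= B) ->
  `|\det M| <= k`!%:R * B ^+ k.
Proof.
move=> B0 H; apply: le_trans (ler_norm_sum _ _ _) _.
rewrite -card_Sn mulrC mulr_natr -sumr_const.
apply: ler_sum => s _; rewrite normrM normrX normrN1 expr1n mul1r normr_prod.
by rewrite -[k in B ^+ k]card_ord -prodr_const; apply: ler_prod => i _; rewrite normr_ge0 H.
Qed.

Lemma fact_le_exp k : (k`! <= 2 ^ (k * k))%N.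
Proof.
elim: k => // k IH; rewrite factS.
apply: leq_trans (leq_mul (ltnW (ltn_expl k.+1 (isT : 1 < 2)%N)) IH) _.
by rewrite -expnD leq_pexp2l //; nia.
Qed.

(** The four terms pay for the number of summands in a numerator of Cramer's rule, for [k!], for a
    product of entries and for the right-hand side. *)
Definition cramer_bits (k : nat) : nat := k + k * k + k * e + e.

(** All coordinates share the denominator [T], the absolute determinant of the scaled matrix.
    Absolute values suffice, as the unknowns it is applied to are nonnegative. *)
Lemma cramer_size k (G : 'M[rat]_k) (b : 'cV[rat]_k) : D != 0 -> G \in unitmx ->
  (forall i j, bounded_entry (G i j)) -> (forall i, bounded_entry (b i 0)) ->
  exists (N : 'I_k -> nat) (T : nat), [/\ (0 < T)%N, (T <= 2 ^ cramer_bits k)%N,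
    forall j, (N j <= 2 ^ cramer_bits k)%N &
    forall j, `|(invmx G *m b) j 0| = (N j)%:R / T%:R].
Proof.
move=> D0 UG HG Hb; pose H := D *: G; pose c := D *: b.
have UH : H \in unitmx by rewrite unitmxZ ?unitfE.
have -> : invmx G *m b = invmx H *m c.
  by rewrite /c invmxZ // -scalemxAl -scalemxAr scalerA mulVf // scale1r.
have HiH i j : H i j \is a Num.int by rewrite mxE; case: (HG i j).
have HbH i j : `|H i j| <= 2 ^+ e by rewrite mxE; case: (HG i j).
have Hic i : c i 0 \is a Num.int by rewrite mxE; case: (Hb i).
have Hbc i : `|c i 0| <= 2 ^+ e by rewrite mxE; case: (Hb i).
clearbody H c.
have d0 : \det H != 0 by rewrite -unitfE -unitmxE.
have natP (x : rat) : x \is a Num.int -> exists n : nat, `|x| = n%:R.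
  by move=> /natr_norm_int /natrP.
have two_ge0 n : 0 <= 2 ^+ n :> rat by rewrite exprn_ge0.
have [T ET] := natP _ (det_int HiH).
have NP j : exists n : nat, `|(\adj H *m c) j 0| = n%:R.
  apply: natP; rewrite mxE; apply: rpred_sum => i _; apply: rpredM => //.
  rewrite mxE /cofactor rpredM ?rpredX ?rpredN ?rpred1 //; apply: det_int => a a'.
  by rewrite !mxE; apply: HiH.
pose N j := Num.trunc `|(\adj H *m c) j 0|.
have EN j : `|(\adj H *m c) j 0| = (N j)%:R.
  by rewrite /N; have [n ->] := NP j; rewrite natrK.
have natX (n m : nat) : n%:R <= 2 ^+ m :> rat -> (n <= 2 ^ m)%N.
  by rewrite -natrX ler_nat.
exists N, T; split.
- by rewrite -(ltr_nat rat) -ET normr_gt0.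
- apply: natX; rewrite -ET; apply: le_trans (det_bound (two_ge0 e) HbH) _.
  rewrite -exprM -!natrX -natrM ler_nat.
  apply: leq_trans (leq_mul (fact_le_exp k) (leqnn _)) _.
  by rewrite -expnD leq_pexp2l // /cramer_bits; nia.
- move=> j; apply: natX; rewrite -EN mxE; apply: le_trans (ler_norm_sum _ _ _) _.
  have Hk : forall i, true -> `|(\adj H) j i * c i 0| <= (2 ^ (k * k + k * e + e))%:R.
    move=> i _; rewrite normrM mxE /cofactor normrM normrX normrN1 expr1n mul1r.
    apply: le_trans (ler_pM (normr_ge0 _) (normr_ge0 _) (det_bound (two_ge0 e) _) (Hbc i)) _.
      by move=> a a'; rewrite !mxE; apply: HbH.
    rewrite -exprM -!natrX -!natrM ler_nat.
    have le : (k.-1`! <= 2 ^ (k * k))%N.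
      by apply: leq_trans (fact_le_exp _) _; rewrite leq_pexp2l //; nia.
    apply: leq_trans (leq_mul (leq_mul le (leqnn _)) (leqnn _)) _.
    by rewrite -!expnD leq_pexp2l //; nia.
  apply: le_trans (ler_sum _ Hk) _; rewrite sumr_const card_ord -(mulr_natr _ k) -natrM -natrX ler_nat.
  apply: leq_trans (leq_mul (leqnn _) (ltnW (ltn_expl k (isT : 1 < 2)%N))) _.
  by rewrite -expnD leq_pexp2l // /cramer_bits; nia.
- move=> j; rewrite /invmx UH -scalemxAl mxE normrM normfV ET.
  by rewrite EN mulrC.
Qed.

End Cramer.

Section SmallSolution.
Variables (R : realFieldType) (k : nat).
Local Notation real_mx := (map_mx (ratr : rat -> R)).

Definition satisfies (S : seq ('rV[rat]_k * rat)) (z : 'cV[R]_k) : Prop :=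
  forall r, r \in S -> ratr r.2 <= (real_mx r.1 *m z) 0 0.

(** With an extra unknown t >= 1, each row a x >= b becomes a x - b t >= 0 and the strict d x < v
    becomes v t - d x >= 1, which scaling can achieve. A vertex of this closed system divided by t
    is the solution. The sign constraints make the system injective, so that a vertex exists. *)
Lemma small_solution (S : seq ('rV[rat]_k * rat)) (d : 'rV[rat]_k) (v D : rat) (e : nat)
    (z : 'cV[R]_k) :
  D != 0 -> bounded_entry D e 1 ->
  (forall r, r \in S -> (forall j, bounded_entry D e (r.1 0 j)) /\ bounded_entry D e r.2) ->
  (forall j, bounded_entry D e (d 0 j)) -> bounded_entry D e v ->
  (forall j, (delta_mx 0 j, 0) \in S) ->
  satisfies S z -> (real_mx d *m z) 0 0 < ratr v ->
  exists (x : 'cV[rat]_k) (N : 'I_k -> nat) (T : nat),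
    [/\ [/\ (0 < T)%N, (T <= 2 ^ cramer_bits e k.+1)%N,
          forall j, (N j <= 2 ^ cramer_bits e k.+1)%N & forall j, x j 0 = (N j)%:R / T%:R],
      forall r, r \in S -> r.2 <= (r.1 *m x) 0 0 & (d *m x) 0 0 < v].
Proof.
move=> D0 g1 gS gd gv unitS Sz dz.
have g0 : bounded_entry D e 0 by split; rewrite mulr0 ?rpred0 // normr0 exprn_ge0.
have gN a : bounded_entry D e a -> bounded_entry D e (- a).
  by case=> i b; split; rewrite mulrN ?rpredN ?normrN.
pose hom (r : 'rV[rat]_k * rat) : 'rV[rat]_(k + 1) * rat := (row_mx r.1 (- r.2)%:M, 0).
pose S' := [seq hom r | r <- S] ++
  [:: (row_mx (- d) v%:M, 1); (row_mx 0 1%:M, 1)].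
pose p := size S'.
pose A : 'M[rat]_(p, k + 1) := \matrix_(i, j) (nth (0, 0) S' i).1 0 j.
pose b : 'cV[rat]_p := \col_i (nth (0, 0) S' i).2.
have rowA i : row i A = (nth (0, 0) S' i).1 by apply/rowP => j; rewrite !mxE.
have inA r : r \in S' -> exists i, row i A = r.1 /\ b i 0 = r.2.
  move=> rS; have ip : (index r S' < p)%N by rewrite index_mem.
  by exists (Ordinal ip); rewrite rowA mxE /= nth_index.
have goodS' r : r \in S' -> (forall j, bounded_entry D e (r.1 0 j)) /\ bounded_entry D e r.2.
  have gM a : bounded_entry D e a -> forall j : 'I_1, bounded_entry D e (a%:M 0 j).
    by move=> ga j; rewrite ord1 mxE.
  have gR (u : 'rV_k) (w : 'M_1) : (forall j, bounded_entry D e (u 0 j)) ->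
      (forall j, bounded_entry D e (w 0 j)) -> forall j, bounded_entry D e (row_mx u w 0 j).
    by move=> gu gw j; rewrite mxE; case: split.
  rewrite mem_cat => /orP [/mapP [r0 /gS [h1 h2] ->]|].
    by split=> //; apply: gR => //; apply: gM; apply: gN.
  rewrite !inE => /orP [] /eqP ->; split=> //; apply: gR.
  - by move=> j; rewrite mxE; apply: gN.
  - exact: gM.
  - by move=> j; rewrite mxE.
  - exact: gM.
have goodA i : (forall j, bounded_entry D e (A i j)) /\ bounded_entry D e (b i 0).
  have [h1 h2] := goodS' _ (mem_nth (0, 0) (ltn_ord i)).
  by split=> [j|]; rewrite mxE.
have unitA j : exists i, row i A = delta_mx 0 j /\ b i 0 >= 0.
  case: (split_ordP j) => j' ->.
    have /inA [i [Ei bi]] : hom (delta_mx 0 j', 0) \in S'.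
      by rewrite mem_cat map_f.
    exists i; rewrite Ei bi; split=> //; apply/rowP => l; rewrite !mxE /=.
    case: (split_ordP l) => l' ->; rewrite ?mxE /= ?ord1 ?eq_lshift //.
    by rewrite oppr0 mul0rn eq_rlshift.
  have /inA [i [Ei bi]] : (row_mx 0 1%:M, 1 : rat) \in S' by rewrite mem_cat !inE eqxx !orbT.
  exists i; rewrite Ei bi; split=> //; apply/rowP => l; rewrite !mxE /=.
  case: (split_ordP l) => l' ->; rewrite ?mxE /= ?eq_rshift ?eq_lrshift //.
  by rewrite !ord1.
have fullA : row_full A.
  rewrite -sub1mx; apply/row_subP => j; rewrite row1.
  by have [i [<- _]] := unitA j; apply: row_sub.
(* The scale must be at least 1 and make [s * (v - d z)] at least 1; with this choice the product is
   1 plus the gap. *)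
pose s : R := 1 + (ratr v - (real_mx d *m z) 0 0)^-1.
have dz' : 0 < ratr v - (real_mx d *m z) 0 0 by rewrite subr_gt0.
have s1 : 1 <= s by rewrite lerDl invr_ge0 ltW.
have s0 : 0 < s by apply: lt_le_trans s1.
pose z' : 'cV[R]_(k + 1) := col_mx (s *: z) s%:M.
have dotz' (u : 'rV[rat]_k) (a : rat) :
    (real_mx (row_mx u a%:M) *m z') 0 0 = s * ((real_mx u *m z) 0 0 + ratr a).
  rewrite map_row_mx mul_row_col mxE -scalemxAr [X in X + _]mxE mulrDr; congr (_ + _).
  by rewrite map_scalar_mx -scalar_mxM mxE eqxx mulr1n mulrC.
have slack_ge0 i : 0 <= slack A b z' i.
  have Ei : (real_mx A *m z') i 0 = (real_mx (nth (0, 0) S' i).1 *m z') 0 0.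
    by rewrite -rowA !mxE; apply: eq_bigr => j _; rewrite !mxE.
  rewrite /slack Ei [b i 0]mxE subr_ge0.
  have := mem_nth (0, 0) (ltn_ord i); move: (nth _ _ _) => r.
  rewrite mem_cat => /orP [/mapP [r0 rS ->] /=|].
    rewrite dotz' raddf0 mulr_ge0 ?(ltW s0) // rmorphN subr_ge0; exact: Sz.
  rewrite !inE => /orP [] /eqP -> /=; rewrite dotz' rmorph1.
    rewrite map_mxN mulNmx mxE addrC /s mulrDl mulVf ?gt_eqF // mul1r lerDr.
    exact: ltW.
  by rewrite map_mx0 mul0mx mxE add0r mulr1.
have [f [Uf Hf]] := vertex fullA slack_ge0.
have gA i j : bounded_entry D e (rowsub f A i j) by rewrite [_ i j]mxE; apply: (goodA (f i)).1.
have gb i : bounded_entry D e (rowsub f b i 0) by rewrite [_ i 0]mxE; apply: (goodA (f i)).2.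
have [N [T [T0 Tb Nb EN]]] := cramer_size D0 Uf gA gb.
move: (invmx _ *m _) Hf EN => y Hf EN.
have Ay i r : row i A = r -> b i 0 <= (r *m y) 0 0.
  by move=> <-; apply: le_trans (Hf i) _; rewrite -row_mul [leRHS]mxE.
have y0 j : 0 <= y j 0.
  have [i [Ei bi]] := unitA j; apply: le_trans bi _.
  by have := Ay _ _ Ei; rewrite -rowE [leRHS]mxE.
have Ey j : y j 0 = (N j)%:R / T%:R by rewrite -EN ger0_norm.
pose t := y (rshift k ord0) 0.
have t1 : 1 <= t.
  have /inA [i [Ei bi]] : (row_mx 0 1%:M, 1 : rat) \in S' by rewrite mem_cat !inE eqxx !orbT.
  have := Ay _ _ Ei; rewrite bi -[y]vsubmxK mul_row_col mul0mx add0r mul1mx /t.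
  by rewrite [dsubmx y 0 0]mxE.
have t0 : 0 < t by apply: lt_le_trans t1.
pose x := t^-1 *: usubmx y.
have doty (u : 'rV[rat]_k) (a : rat) : (row_mx u a%:M *m y) 0 0 = t * ((u *m x) 0 0 + a).
  rewrite -[y]vsubmxK mul_row_col mxE mulrDr; congr (_ + _).
    by rewrite /x -scalemxAr [in RHS]mxE mulrA mulfV ?gt_eqF // mul1r.
  by rewrite mul_scalar_mx mxE mulrC /t [dsubmx y 0 0]mxE.
have NT0 : (0 < N (rshift k ord0))%N.
  rewrite lt0n; apply/eqP => E; move: t0; rewrite /t Ey E mul0r ltxx //.
have T0' : T%:R != 0 :> rat by rewrite pnatr_eq0 -lt0n.
have le2 : (2 ^ cramer_bits e (k + 1) = 2 ^ cramer_bits e k.+1)%N by rewrite addn1.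
(* Dividing by the homogenising coordinate cancels [T], and the numerator of that coordinate becomes
   the common denominator. *)
exists x, (fun j => N (lshift 1 j)), (N (rshift k ord0)); rewrite -le2; split; first split=> //.
- move=> j; have N0 : (N (rshift k ord0))%:R != 0 :> rat by rewrite pnatr_eq0 -lt0n.
  by rewrite !mxE /t !Ey; field; rewrite T0' N0.
- move=> r rS; have /inA [i [Ei bi]] : hom r \in S' by rewrite mem_cat map_f.
  have := Ay _ _ Ei; rewrite bi doty pmulr_rge0 // subr_ge0 //.
- have /inA [i [Ei bi]] : (row_mx (- d) v%:M, 1 : rat) \in S' by rewrite mem_cat !inE eqxx !orbT.
  have := Ay _ _ Ei; rewrite bi doty mulNmx mxE => H.
  have : 0 < t * (- (d *m x) 0 0 + v) by apply: lt_le_trans H.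
  by rewrite pmulr_rgt0 // addrC subr_gt0.
Qed.

End SmallSolution.

(** * Farkas' lemma and optimality conditions *)

Section Farkas.
Variables (R : realFieldType) (n : nat).

(* Bartl's proof, by induction on the list of generators. *)
Lemma farkas (I : finType) (r : seq I) (g : I -> 'rV[R]_n) (c : 'rV[R]_n) : uniq r ->
  (forall d : 'cV[R]_n, (forall i, i \in r -> 0 <= (g i *m d) 0 0) -> 0 <= (c *m d) 0 0) ->
  exists l : I -> R, (forall i, 0 <= l i) /\ c = \sum_(i <- r) l i *: g i.
Proof.
elim: r g c => [|i0 r IH] g c /=.
  move=> _ H; exists (fun=> 0); split=> //; rewrite big_nil.
  apply/rowP => j; rewrite mxE.
  pose u : 'cV[R]_n := delta_mx j 0.
  have E s : (c *m (s *: u)) 0 0 = s * c 0 j.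
    rewrite -scalemxAr mxE; congr (_ * _); rewrite mxE (bigD1 j) //= /u !mxE !eqxx mulr1.
    by rewrite big1 ?addr0 // => i ne; rewrite mxE (negPf ne) mulr0.
  have h1 := H (1 *: u); have h2 := H (-1 *: u).
  rewrite !E in h1 h2; apply/eqP; rewrite eq_le.
  by have := h1 (fun i => ltac:(by [])); have := h2 (fun i => ltac:(by [])); lra.
move=> /andP [nr ur] H.
have [H'|nH] := boolp.pselect (forall d : 'cV[R]_n,
    (forall i, i \in r -> 0 <= (g i *m d) 0 0) -> 0 <= (c *m d) 0 0).
  have [l [l0 El]] := IH g c ur H'.
  exists (fun i => if i == i0 then 0 else l i); split=> [i|]; first by case: eqP.
  rewrite big_cons eqxx scale0r add0r {1}El; apply: eq_big_seq => i ir.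
  by case: eqP => // E; rewrite -E ir in nr.
have [d0 [Hd0 cd0]] : exists d0 : 'cV[R]_n,
    (forall i, i \in r -> 0 <= (g i *m d0) 0 0) /\ (c *m d0) 0 0 < 0.
  apply: boolp.contrapT => N; apply: nH => d Hd; rewrite leNgt; apply/negP => lt.
  by apply: N; exists d.
set al := - (g i0 *m d0) 0 0.
have al0 : 0 < al.
  rewrite /al oppr_gt0 ltNge; apply/negP => ge0; have := H d0; rewrite leNgt cd0.
  by move=> /(_ _) H0; suff : false by []; apply: H0 => i; rewrite inE => /orP [/eqP ->|/Hd0].
(* [g'] and [c'] are [g] and [c] composed with the projection along [d0] onto the hyperplane where
   [g i0] vanishes; [Ed] and [g0d] say so. There the hypothesis on [i0] holds for free, and the
   induction applies. *)
pose g' i := g i + ((g i *m d0) 0 0 / al) *: g i0.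
pose c' := c + ((c *m d0) 0 0 / al) *: g i0.
have Ed (u : 'rV[R]_n) (d : 'cV[R]_n) : ((u + ((u *m d0) 0 0 / al) *: g i0) *m d) 0 0
    = (u *m (d + ((g i0 *m d) 0 0 / al) *: d0)) 0 0.
  rewrite mulmxDl mulmxDr -scalemxAl -scalemxAr [LHS]mxE [RHS]mxE; congr (_ + _).
  by rewrite [LHS]mxE [RHS]mxE; ring.
have g0d (d : 'cV[R]_n) : (g i0 *m (d + ((g i0 *m d) 0 0 / al) *: d0)) 0 0 = 0.
  rewrite mulmxDr -scalemxAr [LHS]mxE [X in _ + X]mxE.
  have -> : (g i0 *m d0) 0 0 = - al by rewrite opprK.
  by rewrite mulrN divfK ?gt_eqF // subrr.
have [l [l0 El]] : exists l : I -> R, (forall i, 0 <= l i) /\ c' = \sum_(i <- r) l i *: g' i.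
  apply: IH => // d Hd; rewrite /c' Ed; apply: H => i.
  by rewrite inE => /orP [/eqP ->|ir]; [rewrite g0d|rewrite -Ed; apply: Hd].
pose m := \sum_(i <- r) l i * ((g i *m d0) 0 0 / al) - (c *m d0) 0 0 / al.
have m0 : 0 <= m.
  rewrite subr_ge0; apply: (@le_trans _ _ 0).
    by rewrite pmulr_lle0 ?invr_gt0 // ltW.
  rewrite big_seq; apply: sumr_ge0 => i ir.
  by rewrite mulr_ge0 // mulr_ge0 ?invr_ge0 ?(ltW al0) // Hd0.
exists (fun i => if i == i0 then m else l i); split=> [i|]; first by case: eqP.
rewrite big_cons eqxx.
have -> : \sum_(i <- r) (if i == i0 then m else l i) *: g i = \sum_(i <- r) l i *: g i.
  by apply: eq_big_seq => i ir; case: eqP => // E; rewrite -E ir in nr.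
have : c = c' - ((c *m d0) 0 0 / al) *: g i0 by rewrite /c' addrK.
rewrite El => ->; rewrite /m scalerBl scaler_suml addrAC; congr (_ - _).
by rewrite -big_split /=; apply: eq_bigr => i _; rewrite /g' scalerDr scalerA addrC.
Qed.

(** Finitely many slacks [s] with rates [d] admit a common positive step: a direction that respects
    the tight constraints is one along which a feasible point can really move. *)
Lemma small_step (I : finType) (s d : I -> R) :
  (forall i, 0 <= s i) -> (forall i, s i = 0 -> 0 <= d i) ->
  exists2 t, 0 < t & forall i, 0 <= s i + t * d i.
Proof.
move=> s0 sd.
suff [t t0 H] : exists2 t, 0 < t & forall i, i \in enum I -> 0 <= s i + t * d i.
  by exists t => // i; apply: H; rewrite mem_enum.
elim: (enum I) => [|i r [t t0 IH]]; first by exists 1.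
have [u u0 Hu] : exists2 u, 0 < u & forall w, 0 <= w <= u -> 0 <= s i + w * d i.
  have [d0|d0] := leP 0 (d i).
    by exists 1 => // w /andP [w0 _]; rewrite addr_ge0 // mulr_ge0.
  have si : 0 < s i.
    by rewrite lt_def s0 andbT; apply: contraTneq d0 => /sd; rewrite leNgt.
  exists (s i / - d i); first by rewrite divr_gt0 // oppr_gt0.
  by move=> w /andP [_]; rewrite ler_pdivlMr ?oppr_gt0 //; lra.
exists (Num.min t u); first by rewrite lt_min t0.
have m0 : 0 <= Num.min t u by rewrite le_min !ltW.
move=> j; rewrite inE => /orP [/eqP ->|jr].
  by apply: Hu; rewrite m0 ge_min lexx orbT.
have := IH j jr; have [d0|d0] := leP 0 (d j).
  by move=> _; rewrite addr_ge0 // mulr_ge0.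
have : Num.min t u <= t by rewrite ge_min lexx.
by nra.
Qed.

End Farkas.

(** * Values of the data handled by the verifier *)

Definition fval (x : bfrac) : rat := ((bv x.1)%:R - (bv x.2.1)%:R) / (bv x.2.2)%:R.
Definition fpos (x : bfrac) : bool := (0 < bv x.2.2)%N.

Lemma fpos_neq0 x : fpos x -> (bv x.2.2)%:R != 0 :> rat.
Proof. by rewrite /fpos pnatr_eq0 -lt0n. Qed.

Lemma fpos_add x y : fpos x -> fpos y -> fpos (fadd x y).
Proof. by rewrite /fpos /= muln_gt0 => -> ->. Qed.

Lemma fpos_mul x y : fpos x -> fpos y -> fpos (fmul x y).
Proof. by rewrite /fpos /= muln_gt0 => -> ->. Qed.

Lemma fval_add x y : fpos x -> fpos y -> fval (fadd x y) = fval x + fval y.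
Proof.
move=> /fpos_neq0 hx /fpos_neq0 hy; rewrite /fval /= !natrD !natrM.
by field; rewrite hx hy.
Qed.

Lemma fval_mul x y : fpos x -> fpos y -> fval (fmul x y) = fval x * fval y.
Proof.
move=> /fpos_neq0 hx /fpos_neq0 hy; rewrite /fval /= !natrD !natrM.
by field; rewrite hx hy.
Qed.

Lemma fleE x y : fpos x -> fpos y -> fle x y = (fval x <= fval y).
Proof.
move=> px py; have hx : 0 < (bv x.2.2)%:R :> rat by rewrite ltr0n.
have hy : 0 < (bv y.2.2)%:R :> rat by rewrite ltr0n.
have E a b : (a <= b)%N = (a%:R <= b%:R :> rat) by rewrite ler_nat.
rewrite /fle /bleq /fval /= E !natrD !natrM ler_pdivrMr // mulrAC ler_pdivlMr //.
by apply/idP/idP; lra.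
Qed.

Lemma fval0 : fval frac0 = 0. Proof. by rewrite /fval subrr mul0r. Qed.
Lemma fval1 : fval frac1 = 1. Proof. by []. Qed.

Definition denotes (n : nat) (xs : seq bfrac) (X : 'cV[rat]_n) : Prop :=
  forall j : 'I_n, fpos (nth frac0 xs j) /\ fval (nth frac0 xs j) = X j 0.

Lemma fdotP n us vs (U V : 'cV[rat]_n) : denotes us U -> denotes vs V ->
  fpos (fdot n us vs) /\ fval (fdot n us vs) = \sum_j U j 0 * V j 0.
Proof.
move=> HU HV; pose f a i := fadd a (fmul (nth frac0 us i) (nth frac0 vs i)).
have H (l : seq 'I_n) a : fpos a -> fpos (foldl f a (map val l)) /\
    fval (foldl f a (map val l)) = fval a + \sum_(j <- l) U j 0 * V j 0.
  elim: l a => [|j l IH] a pa; first by rewrite big_nil addr0.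
  have [[p1 v1] [p2 v2]] := (HU j, HV j).
  have p3 := fpos_mul p1 p2; have [p4 v4] := IH _ (fpos_add pa p3).
  rewrite /= -/f; split=> //; rewrite [LHS]v4.
  by rewrite big_cons fval_add // fval_mul // v1 v2 addrA.
rewrite /fdot -val_enum_ord -/f; have [-> ->] := H (enum 'I_n) frac0 isT.
by rewrite fval0 add0r big_enum.
Qed.

Definition rtoken_of (q : rat) : rtoken :=
  (numq q < 0, (Bn `|numq q|%N, Bn `|denq q|%N)).

Lemma fval_rtoken_of q : fval (frac_of (rtoken_of q)) = q.
Proof.
rewrite /fval /frac_of /= -[RHS]divq_num_den; congr (_ / _).
  case: (ltP (numq q) 0) => h /=; rewrite ?sub0r ?subr0 pmulrn abszE.
    by rewrite ltr0_norm // rmorphN opprK.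
  by rewrite ger0_norm.
by rewrite pmulrn abszE normr_denq.
Qed.

Lemma fpos_rtoken_of q : fpos (frac_of (rtoken_of q)).
Proof. by rewrite /fpos /= absz_gt0 denq_neq0. Qed.

Section Entries.
Variable Q : query.
Local Notation n := (qn Q).
Local Notation m := (qm Q).
Local Notation P := (program Q).

Definition col_entries (k : nat) (v : 'cV[rat]_k) : seq rat := [seq v i 0 | i <- enum 'I_k].
Definition mx_entries (k l : nat) (M : 'M[rat]_(k, l)) : seq rat :=
  flatten [seq [seq M i j | j <- enum 'I_l] | i <- enum 'I_k].

Definition query_entries : seq rat :=
  col_entries (c11 P) ++ col_entries (c21 P) ++ c22 P :: mx_entries (A11 P)
  ++ col_entries (A12 P) ++ col_entries (b1 P) ++ col_entries (point1 Q) ++ [:: point2 Q].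

Lemma size_col_entries k (v : 'cV[rat]_k) : size (col_entries v) = k.
Proof. by rewrite size_map size_enum_ord. Qed.

Lemma size_mx_entries k l (M : 'M[rat]_(k, l)) : size (mx_entries M) = (k * l)%N.
Proof.
rewrite size_flatten /shape -map_comp sumnE big_map.
rewrite (eq_bigr (fun=> l)) => [|i _]; last by rewrite /= size_map size_enum_ord.
by rewrite big_enum /= sum_nat_const card_ord.
Qed.

Lemma size_query_entries : size query_entries = entries n m.
Proof.
by rewrite !size_cat /= !size_cat /= !size_col_entries size_mx_entries /entries; lia.
Qed.

Lemma nth_col_entries k (v : 'cV[rat]_k) (i : 'I_k) : nth 0 (col_entries v) i = v i 0.
Proof. by rewrite (nth_map i) ?size_enum_ord // nth_ord_enum. Qed.

Lemma nth_flatten_rows (T : Type) (x0 : T) (l : nat) (rows : seq (seq T)) i j :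
  (forall r, (r < size rows)%N -> size (nth [::] rows r) = l) -> (i < size rows)%N -> (j < l)%N ->
  nth x0 (flatten rows) (i * l + j) = nth x0 (nth [::] rows i) j.
Proof.
elim: rows i => [|r rows IH] [|i] //= H lt lj.
  by rewrite nth_cat (H 0%N) // add0n lj.
rewrite nth_cat (H 0%N) // mulSn -addnA ltnNge leq_addr /= addKn IH // => r0 Hr.
exact: (H r0.+1).
Qed.

Lemma nth_mx_entries k l (M : 'M[rat]_(k, l)) (i : 'I_k) (j : 'I_l) :
  nth 0 (mx_entries M) (i * l + j) = M i j.
Proof.
rewrite /mx_entries; set rows := map _ _.
have Sr : size rows = k by rewrite size_map size_enum_ord.
have Er (r : 'I_k) : nth [::] rows r = [seq M r j | j <- enum 'I_l].
  by rewrite (nth_map r) ?size_enum_ord // nth_ord_enum.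
rewrite nth_flatten_rows ?Sr //; first by rewrite Er (nth_map j) ?size_enum_ord // nth_ord_enum.
move=> r Hr; rewrite (Er (Ordinal Hr)) size_map size_enum_ord //.
Qed.

Ltac skip_entries := rewrite nth_cat ?size_col_entries ?size_mx_entries.

Lemma entry_c11 (j : 'I_n) : nth 0 query_entries j = c11 P j 0.
Proof. by skip_entries; rewrite ltn_ord nth_col_entries. Qed.

Lemma nth_shift (T : Type) (x0 : T) (s t : seq T) k i : size s = k ->
  nth x0 (s ++ t) (k + i) = nth x0 t i.
Proof. by move=> <-; rewrite nth_cat ltnNge leq_addr /= addKn. Qed.

Lemma entry_c21 (j : 'I_n) : nth 0 query_entries (n + j)%N = c21 P j 0.
Proof.
rewrite nth_shift ?size_col_entries //.
by skip_entries; rewrite ltn_ord nth_col_entries.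
Qed.

Lemma entry_c22 : nth 0 query_entries (2 * n)%N = c22 P.
Proof.
rewrite mul2n -addnn nth_shift ?size_col_entries //.
by rewrite -[X in nth _ _ X]addn0 nth_shift ?size_col_entries.
Qed.

Lemma entry_tail i : nth 0 query_entries (2 * n + 1 + i)%N =
  nth 0 (mx_entries (A11 P) ++ col_entries (A12 P) ++ col_entries (b1 P)
    ++ col_entries (point1 Q) ++ [:: point2 Q]) i.
Proof.
rewrite mul2n -addnn -!addnA nth_shift ?size_col_entries //.
by rewrite nth_shift ?size_col_entries.
Qed.

Lemma entry_A11 (i : 'I_m) (j : 'I_n) :
  nth 0 query_entries (2 * n + 1 + i * n + j)%N = A11 P i j.
Proof.
rewrite -addnA entry_tail; skip_entries.
have -> : (i * n + j < m * n)%N.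
  by apply: leq_trans (leq_mul (ltn_ord i) (leqnn n)); rewrite mulSn addnC ltn_add2r.
exact: nth_mx_entries.
Qed.

Lemma entry_A12 (i : 'I_m) : nth 0 query_entries (2 * n + 1 + m * n + i)%N = A12 P i 0.
Proof.
rewrite -addnA entry_tail nth_shift ?size_mx_entries //.
by skip_entries; rewrite ltn_ord nth_col_entries.
Qed.

Lemma entry_b1 (i : 'I_m) : nth 0 query_entries (2 * n + 1 + m * n + m + i)%N = b1 P i 0.
Proof.
have -> : (2 * n + 1 + m * n + m + i = 2 * n + 1 + (m * n + (m + i)))%N by lia.
rewrite entry_tail nth_shift ?size_mx_entries // nth_shift ?size_col_entries //.
by skip_entries; rewrite ltn_ord nth_col_entries.
Qed.

Lemma entry_p1 (j : 'I_n) : nth 0 query_entries (2 * n + 1 + m * n + 2 * m + j)%N = point1 Q j 0.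
Proof.
have -> : (2 * n + 1 + m * n + 2 * m + j = 2 * n + 1 + (m * n + (m + (m + j))))%N by lia.
rewrite entry_tail nth_shift ?size_mx_entries //.
rewrite nth_shift ?size_col_entries // nth_shift ?size_col_entries //.
by skip_entries; rewrite ltn_ord nth_col_entries.
Qed.

Lemma entry_p2 : nth 0 query_entries (3 * n + 1 + m * n + 2 * m)%N = point2 Q.
Proof.
have -> : (3 * n + 1 + m * n + 2 * m = 2 * n + 1 + (m * n + (m + (m + (n + 0)))))%N by lia.
rewrite entry_tail nth_shift ?size_mx_entries // nth_shift ?size_col_entries //.
by rewrite nth_shift ?size_col_entries // nth_shift ?size_col_entries.
Qed.

Definition raw_entries : seq rtoken := [seq rtoken_of q | q <- query_entries].

Lemma encode_col k (v : 'cV[rat]_k) :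
  encode_mx v = flatten [seq encode_rtoken r | r <- [seq rtoken_of q | q <- col_entries v]].
Proof.
rewrite /encode_mx /col_entries -!map_comp; congr flatten; apply: eq_map => i /=.
by rewrite enum_ordSl enum_ord0 /= cats0.
Qed.

Lemma encode_entries k l (M : 'M[rat]_(k, l)) :
  encode_mx M = flatten [seq encode_rtoken r | r <- [seq rtoken_of q | q <- mx_entries M]].
Proof.
rewrite /encode_mx /mx_entries; elim: (enum 'I_k) => //= i r ->.
by rewrite !map_cat flatten_cat -!map_comp.
Qed.

Lemma encode_queryE : encode_query Q = encode_raw (Bn n) (Bn m) raw_entries.
Proof.
rewrite /encode_query /encode_raw /raw_entries /query_entries !(encode_col, encode_entries).
by rewrite -cat1s !map_cat !flatten_cat /= !cats0 -!catA.
Qed.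

Definition query_data : data := data_of (n, (m, raw_entries)).

Lemma denotes_entry k : fpos (nth frac0 (query_data).2.2 k) /\
  fval (nth frac0 (query_data).2.2 k) = nth 0 query_entries k.
Proof.
rewrite /= /raw_entries -map_comp; have [lt|ge] := ltnP k (size query_entries).
  by rewrite (nth_map 0) //= fval_rtoken_of fpos_rtoken_of.
by rewrite !nth_default ?size_map // fval0.
Qed.

Lemma nth_slice l o k i : (i < k)%N -> nth frac0 (slice l o k) i = nth frac0 l (o + i).
Proof. by move=> lt; rewrite (nth_map 0%N) ?size_iota // nth_iota // add0n. Qed.

Lemma denotes_slice o k (v : 'cV[rat]_k) :
  (forall i : 'I_k, nth 0 query_entries (o + i) = v i 0) ->
  denotes (slice (query_data).2.2 o k) v.
Proof.
by move=> H j; rewrite nth_slice // -H; have [] := denotes_entry (o + j).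
Qed.

Lemma denotes_c11 : denotes (e_c11 query_data) (c11 P).
Proof. by apply: denotes_slice => i; rewrite entry_c11. Qed.
Lemma denotes_c21 : denotes (e_c21 query_data) (c21 P).
Proof. by apply: denotes_slice => i; rewrite entry_c21. Qed.
Lemma denotes_A12 : denotes (e_A12 query_data) (A12 P).
Proof. by apply: denotes_slice => i; rewrite entry_A12. Qed.
Lemma denotes_b1 : denotes (e_b1 query_data) (b1 P).
Proof. by apply: denotes_slice => i; rewrite entry_b1. Qed.
Lemma denotes_p1 : denotes (e_p1 query_data) (point1 Q).
Proof. by apply: denotes_slice => i; rewrite entry_p1. Qed.
Lemma denotes_row (i : 'I_m) : denotes (e_row query_data i) (row i (A11 P))^T.
Proof. by apply: denotes_slice => j; rewrite entry_A11 !mxE. Qed.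
Lemma denotes_col (j : 'I_n) : denotes (e_col query_data j) (col j (A11 P)).
Proof.
move=> i; rewrite (nth_map 0%N) ?size_iota // nth_iota // add0n mxE -entry_A11.
exact: denotes_entry.
Qed.

End Entries.

Lemma all_iotaP (p : pred nat) n : all p (iota 0 n) <-> forall i : 'I_n, p i.
Proof.
split=> [/allP H i|H]; first by apply: H; rewrite mem_iota add0n /=.
by apply/allP => i; rewrite mem_iota => /= lt; apply: (H (Ordinal lt)).
Qed.

Lemma ratr_le1 (R : numFieldType) (x : rat) : (ratr x <= 1 :> R) = (x <= 1).
Proof. by rewrite -[1](rmorph1 (ratr : rat -> R)) ler_rat. Qed.

Lemma ratr_ge1 (R : numFieldType) (x : rat) : (1 <= ratr x :> R) = (1 <= x).
Proof. by rewrite -[1](rmorph1 (ratr : rat -> R)) ler_rat. Qed.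

(** * Meaning of the Boolean checks *)

Section Checks.
Variables (R : realType) (Q : query).
Local Notation n := (qn Q).
Local Notation m := (qm Q).
Local Notation P := (program Q).
Local Notation D := (query_data Q).
Local Notation real_mx := (map_mx (ratr : rat -> R)).

Lemma dotE k (c : 'cV[rat]_k) (x : 'cV[R]_k) : dot c x = \sum_j ratr (c j 0) * x j 0.
Proof. by rewrite /dot mxE; apply: eq_bigr => j _; rewrite !mxE. Qed.

Lemma dot_ratr k (c X : 'cV[rat]_k) : dot c (real_mx X) = ratr (\sum_j c j 0 * X j 0).
Proof.
by rewrite dotE rmorph_sum; apply: eq_bigr => j _; rewrite rmorphM mxE.
Qed.

Lemma lower_rowE (z : 'cV[R]_n) (t : R) i :
  (real_mx (A11 P) *m z + t *: real_mx (A12 P)) i 0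
  = \sum_j ratr (A11 P i j) * z j 0 + t * ratr (A12 P i 0).
Proof. by rewrite !mxE; congr (_ + _); apply: eq_bigr => j _; rewrite mxE. Qed.

Variables (xs : seq bfrac) (X : 'cV[rat]_n) (x2 : bfrac) (y : rat).
Hypotheses (HX : denotes xs X) (px2 : fpos x2) (vx2 : fval x2 = y).

Definition rat_row (i : 'I_m) : rat := \sum_j A11 P i j * X j 0 + y * A12 P i 0.

Lemma lower_row_ratr i :
  (real_mx (A11 P) *m real_mx X + ratr y *: real_mx (A12 P)) i 0 = ratr (rat_row i).
Proof.
rewrite lower_rowE rmorphD rmorphM rmorph_sum; congr (_ + _).
by apply: eq_bigr => j _; rewrite rmorphM mxE.
Qed.

Lemma row_valueP (i : 'I_m) : fpos (row_value D xs x2 i) /\ fval (row_value D xs x2 i) = rat_row i.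
Proof.
have [p1 v1] := fdotP (denotes_row i) HX; have [p2 v2] := denotes_A12 i.
rewrite /row_value fval_add ?fval_mul ?fpos_mul // v1 vx2 v2; split.
  by rewrite fpos_add // fpos_mul.
by rewrite /rat_row; congr (_ + _); apply: eq_bigr => j _; rewrite !mxE.
Qed.

Lemma check_feasibleP : check_feasible D xs x2 <-> lower_feasible P (ratr y : R) (real_mx X).
Proof.
have E1 (i : 'I_m) : fle (nth frac0 (e_b1 D) i) (row_value D xs x2 i)
    = (real_mx (b1 P) i 0 <= (real_mx (A11 P) *m real_mx X + ratr y *: real_mx (A12 P)) i 0).
  have [p1 v1] := denotes_b1 i; have [p2 v2] := row_valueP i.
  by rewrite fleE // v1 v2 lower_row_ratr mxE ler_rat.
have E2 (j : 'I_n) : fle frac0 (nth frac0 xs j) && fle (nth frac0 xs j) frac1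
    = (0 <= real_mx X j 0 <= 1).
  have [p1 v1] := HX j.
  by rewrite !fleE // v1 fval0 fval1 mxE ler0q ratr_le1.
have E3 : fle frac0 x2 && fle x2 frac1 = (0 <= (ratr y : R) <= 1).
  by rewrite !fleE // vx2 fval0 fval1 ler0q ratr_le1.
split.
  case/and3P => /all_iotaP h1 /all_iotaP h2 /andP h3; split=> [i|j|].
  - by rewrite -E1; apply: h1.
  - by rewrite -E2; apply: h2.
  - by rewrite -E3; apply/andP.
case=> h1 h2 h3; apply/and3P; split; last by rewrite E3.
- by apply/all_iotaP => i; rewrite E1.
- by apply/all_iotaP => j; rewrite E2.
Qed.

Lemma check_dualP ys (Y : 'cV[rat]_m) : denotes ys Y ->
  check_dual D xs x2 ys <->
  (forall i, 0 <= Y i 0 /\ (Y i 0 <= 0 \/ rat_row i <= b1 P i 0)) /\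
  (forall j, (\sum_i A11 P i j * Y i 0 <= c11 P j 0 \/ 1 <= X j 0) /\
             (c11 P j 0 <= \sum_i A11 P i j * Y i 0 \/ X j 0 <= 0)).
Proof.
move=> HY.
have E1 (i : 'I_m) : fle frac0 (nth frac0 ys i) &&
    (fle (nth frac0 ys i) frac0 || fle (row_value D xs x2 i) (nth frac0 (e_b1 D) i))
    = (0 <= Y i 0) && ((Y i 0 <= 0) || (rat_row i <= b1 P i 0)).
  have [p1 v1] := denotes_b1 i; have [p2 v2] := row_valueP i; have [p3 v3] := HY i.
  by rewrite !fleE // v1 v2 v3 fval0.
have E2 (j : 'I_n) : (fle (fdot m (e_col D j) ys) (nth frac0 (e_c11 D) j)
                      || fle frac1 (nth frac0 xs j))
                && (fle (nth frac0 (e_c11 D) j) (fdot m (e_col D j) ys)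
                      || fle (nth frac0 xs j) frac0)
    = ((\sum_i A11 P i j * Y i 0 <= c11 P j 0) || (1 <= X j 0)) &&
      ((c11 P j 0 <= \sum_i A11 P i j * Y i 0) || (X j 0 <= 0)).
  have [p1 v1] := denotes_c11 j; have [p2 v2] := HX j.
  have [p3 v3] := fdotP (denotes_col j) HY.
  have Es : \sum_i (col j (A11 P)) i 0 * Y i 0 = \sum_i A11 P i j * Y i 0.
    by apply: eq_bigr => i _; rewrite mxE.
  by rewrite !fleE // v1 v2 v3 fval0 fval1 Es.
split.
  case/andP => /all_iotaP h1 /all_iotaP h2; split=> [i|j].
    by have := h1 i; rewrite E1 => /andP [-> /orP].
  by have := h2 j; rewrite E2 => /andP [/orP ? /orP ?].
case=> h1 h2; apply/andP; split; apply/all_iotaP.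
  by move=> i; rewrite E1; have [-> /orP ->] := h1 i.
by move=> j; rewrite E2; have [/orP -> /orP ->] := h2 j.
Qed.

Lemma objectiveP : fpos (objective D xs x2) /\
  ratr (fval (objective D xs x2)) = upper_objective P (real_mx X) (ratr y).
Proof.
have [p1 v1] := fdotP (@denotes_c21 Q) HX; have [p2 v2] := denotes_entry Q (2 * n).
rewrite /objective /e_c22 fval_add ?fval_mul ?fpos_mul // v1 v2 vx2 entry_c22; split.
  by rewrite fpos_add // fpos_mul.
by rewrite /upper_objective dot_ratr rmorphD rmorphM.
Qed.

End Checks.

(** * Soundness of the verifier *)

Section Soundness.
Variables (R : realType) (Q : query).
Local Notation n := (qn Q).
Local Notation m := (qm Q).
Local Notation P := (program Q).
Local Notation D := (query_data Q).
Local Notation real_mx := (map_mx (ratr : rat -> R)).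

(** The conditions at the bounds give c (x' - x) >= s (x' - x) coordinate by coordinate; exchanging
    sums turns the right-hand side into Y (A x' - A x), whose terms are nonnegative because a
    positive multiplier sits on a tight row. *)
Lemma kkt_optimal (x : 'cV[R]_n) (t : R) (Y : 'I_m -> R) :
  let row i := (real_mx (A11 P) *m x + t *: real_mx (A12 P)) i 0 in
  let s j := \sum_i ratr (A11 P i j) * Y i in
  lower_feasible P t x ->
  (forall i, 0 <= Y i /\ (Y i <= 0 \/ row i <= ratr (b1 P i 0))) ->
  (forall j, (s j <= ratr (c11 P j 0) \/ 1 <= x j 0) /\
             (ratr (c11 P j 0) <= s j \/ x j 0 <= 0)) ->
  lower_optimal P t x.
Proof.
move=> row s Fx HY Hs; split=> // x' [F1 F2 _]; have [G1 G2 _] := Fx.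
rewrite !dotE -subr_ge0 -sumrB; apply: (@le_trans _ _ (\sum_j s j * (x' j 0 - x j 0))); last first.
  apply: ler_sum => j _; rewrite -mulrBr.
  have /andP [x0 x1] := G2 j; have /andP [y0 y1] := F2 j.
  by case: (Hs j) => [[h1|h1] [h2|h2]]; nra.
have -> : \sum_j s j * (x' j 0 - x j 0) =
    \sum_i Y i * ((real_mx (A11 P) *m x' + t *: real_mx (A12 P)) i 0 - row i).
  transitivity (\sum_j \sum_i (ratr (A11 P i j) * Y i) * (x' j 0 - x j 0)).
    by apply: eq_bigr => j _; rewrite mulr_suml.
  rewrite exchange_big; apply: eq_bigr => i _; rewrite /row !lower_rowE.
  rewrite opprD addrACA subrr addr0 -sumrB mulr_sumr; apply: eq_bigr => j _.
  by rewrite -mulrBr; ring.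
apply: sumr_ge0 => i _; have [Y0 [Yi|ti]] := HY i.
  by have -> : Y i = 0 by [apply/eqP; rewrite eq_le Yi]; rewrite mul0r.
rewrite mulr_ge0 // subr_ge0; apply: le_trans ti _.
by have := F1 i; rewrite mxE.
Qed.

Lemma check_improvement_sound C : check_improvement D C -> ~ query_optimal R Q.
Proof.
rewrite /check_improvement => H [[Fp Op] Up].
have [p2p p2v] := denotes_entry Q (3 * n + 1 + m * n + 2 * m); rewrite entry_p2 in p2v.
case/orP: H => [/negP|]; first by apply; apply/(check_feasibleP R (@denotes_p1 Q) p2p p2v).
case/andP => /(all_nthP frac0) pC H.
(* A certificate that is too short is read as completed by [frac0], which has a positive
   denominator. *)
have dC o k : denotes (slice C o k) (\col_(j < k) fval (nth frac0 (slice C o k) j)).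
  move=> j; rewrite mxE; split=> //; rewrite nth_slice //.
  have [lt|ge] := ltnP (o + j) (size C); last by rewrite nth_default.
  have := pC _ lt.
  by rewrite /bleq /fpos /= leqn0 lt0n.
have pn : fpos (nth frac0 C n).
  have [lt|ge] := ltnP n (size C); last by rewrite nth_default.
  by have := pC _ lt; rewrite /bleq /fpos /= leqn0 lt0n.
case/orP: H => [/andP [/(check_feasibleP R (dC _ _) p2p p2v) F]|].
  have [q1 w1] := fdotP (@denotes_c11 Q) (dC 0%N n).
  have [q2 w2] := fdotP (@denotes_c11 Q) (@denotes_p1 Q).
  rewrite /flt fleE // w1 w2 -(ler_rat R) -!dot_ratr => /negP; apply; exact: Op.
case/and3P => /(check_feasibleP R (dC _ _) pn erefl) F /(check_dualP (dC _ _) pn erefl (dC _ _)) [h1 h2].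
have [q1 w1] := objectiveP R (dC 0%N n) pn erefl.
have [q2 w2] := objectiveP R (@denotes_p1 Q) p2p p2v.
rewrite /flt fleE // -(ler_rat R) w1 w2 => /negP; apply; apply: Up.
apply: (kkt_optimal (Y := fun i => ratr (fval (nth frac0 (slice C n.+1 m) i)))) => //.
  move=> i; rewrite ler0q lerq0 lower_row_ratr ler_rat; have := h1 i; rewrite !mxE; exact.
move=> j; have := h2 j; rewrite !mxE.
have -> : \sum_i ratr (A11 P i j) * ratr (fval (nth frac0 (slice C n.+1 m) i))
   = ratr (\sum_i A11 P i j * (\col_i fval (nth frac0 (slice C n.+1 m) i)) i 0) :> R.
  by rewrite rmorph_sum; apply: eq_bigr => i _; rewrite rmorphM mxE.
by rewrite !ler_rat lerq0 ratr_ge1.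
Qed.

Lemma size_encode_nat k : size (encode_nat k) = (2 * size (binary k)).+1.
Proof.
rewrite size_cat addn1 size_flatten /shape -map_comp sumnE big_map.
by rewrite (eq_bigr (fun=> 2%N)) // big_const_seq count_predT iter_addn_0.
Qed.

Lemma size_encode_rtokens L : (3 * size L <= size (flatten [seq encode_rtoken r | r <- L]))%N.
Proof.
elim: L => //= r L IH; rewrite size_cat /= size_cat !size_encode_nat; lia.
Qed.

Lemma entries_leq_size : (3 * entries n m <= size (encode_query Q))%N.
Proof.
have H := size_encode_rtokens (raw_entries Q); rewrite size_map size_query_entries in H.
by rewrite encode_queryE /encode_raw 2!size_cat; apply: leq_trans H _; rewrite addnA leq_addl.
Qed.

Lemma parse_encode : parse_query (encode_query Q) = (n, (m, raw_entries Q)).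
Proof.
have E := tokens_encode_raw (Bn n) (Bn m) (raw_entries Q); rewrite -encode_queryE in E.
have lens := entries_leq_size; rewrite /entries in lens.
rewrite /parse_query E /= !truncateE /=.
have -> : minn (size (encode_query Q)) n = n by lia.
have -> : minn (size (encode_query Q)) m = m by lia.
by rewrite -(size_query_entries Q) -(size_map rtoken_of) rtokens_of.
Qed.

(** On the encoding of a query the tests for malformed strings cannot succeed, numerators and
    denominators being coprime; acceptance therefore comes from an improvement. *)
Lemma verify_sound c : verify (encode_query Q) c -> ~ query_optimal R Q.
Proof.
rewrite /verify parse_encode /verify_parsed eqbitsE /= -encode_queryE eqxx /=.
case/or3P.
- rewrite has_map => /hasP [q _]; rewrite /check_entry /bleq /= !leqn0 !absz_eq0.
  by rewrite (negPf (denq_neq0 q)) /=; case: eqP => [->|]; rewrite ?ltxx ?andbF.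
- case/andP; rewrite {1}/bleq [bv (Bn 2)]/= => g2; rewrite has_map => /hasP [q _]; rewrite /beq /bleq /= -!eqn_leq.
  move: (bv (nth _ _ 0)) (bv (nth _ _ 1)) (bv (nth _ _ 3)) g2 => g e f g2 /andP [/eqP E1 /eqP E2].
  have := coprime_num_den q; rewrite E1 E2 /coprime -muln_gcdr.
  by rewrite muln_eq1 => /andP [/eqP g1]; move: g2; rewrite g1.
- exact: check_improvement_sound.
Qed.

End Soundness.

(** * Necessity of the optimality conditions *)

Section Necessity.
Variables (R : realType) (n m : nat) (P : bilevel n m).
Local Notation real_mx := (map_mx (ratr : rat -> R)).

Lemma lower_rowDZ (x d : 'cV[R]_n) (t e : R) i :
  (real_mx (A11 P) *m (x + e *: d) + t *: real_mx (A12 P)) i 0 =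
  (real_mx (A11 P) *m x + t *: real_mx (A12 P)) i 0 + e * (row i (real_mx (A11 P)) *m d) 0 0.
Proof.
rewrite mulmxDr -scalemxAr [LHS]mxE [X in X + _]mxE [X in _ = X + _]mxE addrAC; congr (_ + _ + _).
by rewrite mxE -row_mul [X in _ = _ * X]mxE.
Qed.

(** Farkas' lemma on the active constraints: a direction respecting them with negative cost would,
    by [small_step], lead to a cheaper feasible point. The multipliers of the two bounds on each
    variable are then eliminated, leaving sign conditions on the reduced costs. *)
Lemma kkt_necessary (x : 'cV[R]_n) (t : R) : lower_optimal P t x ->
  exists Y : 'cV[R]_m,
    (forall i, 0 <= Y i 0 /\ (ratr (b1 P i 0) <
       (real_mx (A11 P) *m x + t *: real_mx (A12 P)) i 0 -> Y i 0 = 0)) /\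
    (forall j, (0 < x j 0 -> ratr (c11 P j 0) <= \sum_i ratr (A11 P i j) * Y i 0) /\
               (x j 0 < 1 -> \sum_i ratr (A11 P i j) * Y i 0 <= ratr (c11 P j 0))).
Proof.
case=> [[F1 F2 F3] Hopt].
pose I : finType := ('I_m + ('I_n + 'I_n))%type.
pose g (i : I) : 'rV[R]_n := match i with
  | inl i => row i (real_mx (A11 P))
  | inr (inl j) => delta_mx 0 j
  | inr (inr j) => - delta_mx 0 j end.
pose s (i : I) : R := match i with
  | inl i => (real_mx (A11 P) *m x + t *: real_mx (A12 P)) i 0 - ratr (b1 P i 0)
  | inr (inl j) => x j 0
  | inr (inr j) => 1 - x j 0 end.
have s0 i : 0 <= s i.
  case: i => [i|[j|j]] /=; first by rewrite subr_ge0; have := F1 i; rewrite mxE.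
    by have /andP [] := F2 j.
  by rewrite subr_ge0; have /andP [] := F2 j.
have Hd (d : 'cV[R]_n) : (forall i, i \in [seq i <- enum I | s i == 0] -> 0 <= (g i *m d) 0 0) ->
    0 <= ((real_mx (c11 P))^T *m d) 0 0.
  move=> Hact.
  have [|e e0 He] := @small_step _ I s (fun i => (g i *m d) 0 0) s0.
    by move=> i si; apply: Hact; rewrite mem_filter mem_enum si eqxx.
  have : dot (c11 P) x <= dot (c11 P) (x + e *: d).
    apply: Hopt; split=> // [i|j].
      rewrite [X in X <= _]mxE lower_rowDZ.
      by have := He (inl i); rewrite /= addrAC subr_ge0.
    have h1 := He (inr (inl j)); have h2 := He (inr (inr j)).
    have Er : ((delta_mx 0 j : 'rV[R]_n) *m d) 0 0 = d j 0 by rewrite -rowE mxE.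
    have En : ((- delta_mx 0 j : 'rV[R]_n) *m d) 0 0 = - d j 0 by rewrite mulNmx mxE Er.
    rewrite /= Er in h1; rewrite /= En in h2.
    by rewrite mxE [X in _ + X]mxE; apply/andP; split; lra.
  rewrite /dot mulmxDr -scalemxAr [X in _ <= X]mxE lerDl [X in 0 <= X]mxE.
  by rewrite pmulr_rge0.
have [l [l0 El]] := farkas (filter_uniq _ (enum_uniq I)) Hd.
pose l' i := if s i == 0 then l i else 0.
have {}El : (real_mx (c11 P))^T = \sum_i l' i *: g i.
  rewrite El big_filter -big_enum /= big_mkcond; apply: eq_bigr => i _.
  by rewrite /l'; case: eqP => //; rewrite scale0r.
have l'0 i : 0 <= l' i by rewrite /l'; case: eqP.
exists (\col_i l' (inl i)).
have Ec j : ratr (c11 P j 0) = \sum_i ratr (A11 P i j) * (\col_i l' (inl i)) i 0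
    + l' (inr (inl j)) - l' (inr (inr j)).
  have := congr1 (fun M : 'rV[R]_n => M 0 j) El; rewrite !mxE => ->.
  rewrite big_sumType /= big_sumType /= mxE [X in _ + X]mxE addrA; congr (_ + _ + _).
  - by rewrite summxE; apply: eq_bigr => i _; rewrite !mxE mulrC.
  - rewrite summxE (bigD1 j) //= !mxE !eqxx mulr1 big1 ?addr0 // => i ne.
    by rewrite !mxE eq_sym (negPf ne) andbF mulr0.
  - rewrite summxE (bigD1 j) //= !mxE !eqxx mulrN mulr1 big1 ?addr0 // => i ne.
    by rewrite !mxE eq_sym (negPf ne) andbF oppr0 mulr0.
split=> [i|j].
  rewrite mxE; split=> // lt; rewrite /l' /= subr_eq0 gt_eqF //.
rewrite Ec; split=> h.
  have -> : l' (inr (inl j)) = 0 by rewrite /l' /= gt_eqF.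
  by rewrite addr0 gerBl.
have -> : l' (inr (inr j)) = 0 by rewrite /l' /= subr_eq0 gt_eqF.
by rewrite subr0 lerDl.
Qed.

End Necessity.

Lemma size_flatten_mem (S : eqType) (T : Type) (f : S -> seq T) q l : q \in l ->
  (size (f q) <= size (flatten (map f l)))%N.
Proof.
elim: l => //= a l IH; rewrite inE size_cat => /orP [/eqP ->|/IH le]; first exact: leq_addr.
exact: leq_trans le (leq_addl _ _).
Qed.

(** * Bit sizes of the entries and of their products *)

Section Sizes.
Variable Q : query.
Local Notation n := (qn Q).
Local Notation m := (qm Q).
Local Notation P := (program Q).
Local Notation s := (size (encode_query Q)).

Lemma entry_size q : q \in query_entries Q -> (`|numq q| < 2 ^ s)%N /\ (`|denq q| < 2 ^ s)%N.
Proof.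
move=> Hq; have H : (size (encode_rtoken (rtoken_of q)) <= s)%N.
  rewrite encode_queryE /encode_raw 2!size_cat.
  apply: leq_trans (leq_trans (leq_addl _ _) (leq_addl _ _)).
  rewrite /raw_entries -map_comp.
  exact: (size_flatten_mem (encode_rtoken \o rtoken_of) Hq).
move: H; rewrite /= size_cat !size_encode_nat /= => H.
by rewrite -!size_binary_leq; split; lia.
Qed.

Lemma dims_size : (n <= s)%N /\ (m <= s)%N /\ (size (query_entries Q) <= s)%N.
Proof.
have := entries_leq_size Q; rewrite size_query_entries {1 2}/entries /entries.
by rewrite /entries; lia.
Qed.

Definition common_den : rat := \prod_(q <- query_entries Q) (denq q)%:~R.

Lemma common_den_int : common_den \is a Num.int.
Proof. by apply: rpred_prod => q _; apply: intr_int. Qed.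

Lemma prod_den_bound (l : seq rat) : {subset l <= query_entries Q} ->
  `|\prod_(q <- l) (denq q)%:~R| <= 2 ^+ (s * size l) :> rat.
Proof.
elim: l => [|q l IH] H; first by rewrite big_nil normr1 muln0.
rewrite big_cons normrM /= mulnS exprD; apply: ler_pM => //.
  have [_ h] := entry_size (H q (mem_head _ _)).
  by rewrite -intr_norm -abszE -pmulrn -natrX ler_nat ltnW.
by apply: IH => a al; apply: H; rewrite inE al orbT.
Qed.

Lemma common_den_bound : `|common_den| <= 2 ^+ (s * s).
Proof.
apply: le_trans (prod_den_bound _) _ => //.
by rewrite ler_eXn2l ?ltr1n // leq_mul2l; have [_ [_ ->]] := dims_size; rewrite orbT.
Qed.

Lemma common_den_neq0 : common_den != 0.
Proof.
apply: (big_ind (fun x => x != 0)); [exact: oner_neq0|exact: mulf_neq0|].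
by move=> q _; rewrite intr_eq0 denq_eq0.
Qed.

Lemma common_den_entry q : q \in query_entries Q ->
  common_den * q \is a Num.int /\ `|common_den * q| <= 2 ^+ (s * s + s).
Proof.
move=> Hq; rewrite /common_den (big_rem q) //= mulrAC [_ * q]mulrC -numqE.
split; first by rewrite rpredM ?intr_int //; apply: rpred_prod => a _; apply: intr_int.
have sub : {subset rem q (query_entries Q) <= query_entries Q} by move=> a; apply: mem_rem.
rewrite normrM exprD mulrC; apply: ler_pM => //.
  apply: le_trans (prod_den_bound sub) _; rewrite ler_eXn2l ?ltr1n // leq_mul2l.
  have [_ [_ h]] := dims_size; rewrite (leq_trans _ h) ?orbT //.
  by rewrite size_rem // leq_pred.
have [h _] := entry_size Hq.
by rewrite -intr_norm -abszE -pmulrn -natrX ler_nat ltnW.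
Qed.

(** The systems contain the objective values of the given point, sums of products of two entries:
    hence the square of the common denominator as multiplier, and the extra bits for the number of
    summands. *)
Definition entry_bits : nat := 2 * (s * s) + 3 * s + 2.
Local Notation good := (bounded_entry (common_den ^+ 2) entry_bits).

Lemma good_weaken x k : common_den ^+ 2 * x \is a Num.int -> (k <= entry_bits)%N ->
  `|common_den ^+ 2 * x| <= 2 ^+ k -> good x.
Proof. by move=> h1 h2 h3; split=> //; apply: le_trans h3 _; rewrite ler_eXn2l ?ltr1n. Qed.

Lemma good0 : good 0.
Proof. by split; rewrite mulr0 ?rpred0 // normr0 exprn_ge0. Qed.

Lemma goodN x : good x -> good (- x).
Proof. by case=> a b; split; rewrite mulrN ?rpredN ?normrN. Qed.

Lemma good1 : good 1.
Proof.
apply: (@good_weaken _ (s * s + s * s)); rewrite ?mulr1.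
- by rewrite rpredX // common_den_int.
- by rewrite /entry_bits; lia.
- by rewrite expr2 normrM exprD; apply: ler_pM; rewrite ?common_den_bound.
Qed.

Lemma good_entry q : q \in query_entries Q -> good q.
Proof.
move=> /common_den_entry [h1 h2]; apply: (@good_weaken _ (s * s + (s * s + s))).
- by rewrite expr2 -mulrA rpredM ?common_den_int.
- by rewrite /entry_bits; lia.
- by rewrite expr2 -mulrA normrM exprD; apply: ler_pM; rewrite ?common_den_bound.
Qed.

Lemma good_prod q q' : q \in query_entries Q -> q' \in query_entries Q ->
  common_den ^+ 2 * (q * q') \is a Num.int /\
  `|common_den ^+ 2 * (q * q')| <= 2 ^+ (2 * (s * s) + 2 * s).
Proof.
move=> /common_den_entry [h1 h2] /common_den_entry [h3 h4].
rewrite expr2 mulrACA; split; first exact: rpredM.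
have -> : (2 * (s * s) + 2 * s = (s * s + s) + (s * s + s))%N by lia.
by rewrite normrM exprD; apply: ler_pM.
Qed.

Lemma good_dot (k : nat) (u v : 'cV[rat]_k) (a b : rat) : (k <= s)%N ->
  (forall j, u j 0 \in query_entries Q) -> (forall j, v j 0 \in query_entries Q) ->
  a = 0 \/ a \in query_entries Q -> b \in query_entries Q ->
  good (\sum_j u j 0 * v j 0 + a * b).
Proof.
move=> ks Hu Hv Ha Hb; set B : rat := 2 ^+ (2 * (s * s) + 2 * s).
have B0 : 0 <= B by rewrite exprn_ge0.
have [h1 h2] : common_den ^+ 2 * (a * b) \is a Num.int /\ `|common_den ^+ 2 * (a * b)| <= B.
  case: Ha => [->|Ha]; last exact: good_prod.
  by rewrite mul0r mulr0 rpred0 normr0.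
apply: (@good_weaken _ (2 * (s * s) + 2 * s + s.+1)).
- rewrite mulrDr rpredD //; rewrite mulr_sumr; apply: rpred_sum => j _.
  by have [] := good_prod (Hu j) (Hv j).
- by rewrite /entry_bits; lia.
rewrite exprD -/B mulrDr; apply: le_trans (ler_normD _ _) _.
have h3 : `|common_den ^+ 2 * (\sum_j u j 0 * v j 0)| <= B * k%:R.
  rewrite mulr_sumr; apply: le_trans (ler_norm_sum _ _ _) _.
  rewrite mulr_natr -[k in B *+ k]card_ord -sumr_const; apply: ler_sum => j _.
  by have [] := good_prod (Hu j) (Hv j).
apply: le_trans (lerD h3 h2) _.
rewrite -[X in _ * _ + X]mulr1 -mulrDr natr1; apply: ler_wpM2l => //.
rewrite -natrX ler_nat; apply: leq_trans (ltnW (ltn_expl s.+1 (isT : (1 < 2)%N))).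
by rewrite ltnS.
Qed.

End Sizes.

(** * Certificates as solutions of linear systems *)

Section Completeness.
Variables (R : realType) (Q : query).
Local Notation n := (qn Q).
Local Notation m := (qm Q).
Local Notation P := (program Q).
Local Notation s := (size (encode_query Q)).
Local Notation D := (query_data Q).
Local Notation real_mx := (map_mx (ratr : rat -> R)).
Local Notation good := (bounded_entry (common_den Q ^+ 2) (entry_bits Q)).
Local Notation k := (n + (1 + m))%N.

(* The unknowns of the linear systems are x1', x2' and the multipliers. *)
Definition row3 (u : 'rV[rat]_n) (a : rat) (w : 'rV[rat]_m) : 'rV[rat]_k :=
  row_mx u (row_mx a%:M w).

Definition col3 (F : fieldType) (x : 'cV[F]_n) (t : F) (y : 'cV[F]_m) : 'cV[F]_k :=
  col_mx x (col_mx t%:M y).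

Lemma dot3 u a w (x : 'cV[R]_n) t y :
  (real_mx (row3 u a w) *m col3 x t y) 0 0
  = (real_mx u *m x) 0 0 + ratr a * t + (real_mx w *m y) 0 0.
Proof.
rewrite /row3 /col3 !map_row_mx !mul_row_col [LHS]mxE [X in _ + X]mxE addrA; congr (_ + _ + _).
by rewrite map_scalar_mx -scalar_mxM mxE.
Qed.

Lemma dot3_rat u a w (x : 'cV[rat]_n) t y :
  (row3 u a w *m col3 x t y) 0 0 = (u *m x) 0 0 + a * t + (w *m y) 0 0.
Proof.
rewrite /row3 /col3 !mul_row_col [LHS]mxE [X in _ + X]mxE addrA; congr (_ + _ + _).
by rewrite -scalar_mxM mxE.
Qed.

Definition good_row l (u : 'rV[rat]_l) : Prop := forall j, good (u 0 j).

Lemma good_row3 u a w : good_row u -> good a -> good_row w -> good_row (row3 u a w).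
Proof.
move=> gu ga gw j; rewrite mxE; case: split => // i; rewrite mxE; case: split => // i'.
by rewrite ord1 mxE.
Qed.

Lemma good_row0 l : good_row (0 : 'rV_l).
Proof. by move=> j; rewrite mxE; apply: good0. Qed.

Lemma good_rowN l (u : 'rV_l) : good_row u -> good_row (- u).
Proof. by move=> gu j; rewrite mxE; apply: goodN. Qed.

Lemma good_delta l (i : 'I_l) : good_row (delta_mx 0 i).
Proof. by move=> j; rewrite mxE; case: (_ && _); [apply: good1|apply: good0]. Qed.

Lemma mem_col_entries l (v : 'cV[rat]_l) i : v i 0 \in col_entries v.
Proof. by apply/mapP; exists i; rewrite ?mem_enum. Qed.

Lemma mem_c11 j : c11 P j 0 \in query_entries Q.
Proof. by rewrite /query_entries mem_cat mem_col_entries. Qed.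
Lemma mem_c21 j : c21 P j 0 \in query_entries Q.
Proof. by rewrite /query_entries 2!mem_cat mem_col_entries orbT. Qed.
Lemma mem_c22 : c22 P \in query_entries Q.
Proof. by rewrite /query_entries 2!mem_cat inE eqxx !orbT. Qed.
Lemma mem_A11 i j : A11 P i j \in query_entries Q.
Proof.
rewrite /query_entries 2!mem_cat inE mem_cat; apply/or4P; apply: Or44; apply/orP; left.
by apply/flatten_mapP; exists i; rewrite ?mem_enum // map_f // mem_enum.
Qed.
Lemma mem_A12 i : A12 P i 0 \in query_entries Q.
Proof. by rewrite /query_entries 2!mem_cat inE 2!mem_cat mem_col_entries !orbT. Qed.
Lemma mem_b1 i : b1 P i 0 \in query_entries Q.
Proof. by rewrite /query_entries 2!mem_cat inE 3!mem_cat mem_col_entries !orbT. Qed.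
Lemma mem_p1 j : point1 Q j 0 \in query_entries Q.
Proof. by rewrite /query_entries 2!mem_cat inE 4!mem_cat mem_col_entries !orbT. Qed.
Lemma mem_p2 : point2 Q \in query_entries Q.
Proof. by rewrite /query_entries 2!mem_cat inE 4!mem_cat inE eqxx !orbT. Qed.

Definition constraint : Type := 'rV[rat]_k * rat.

(** Nonnegativity of all unknowns, multipliers included, and lower-level feasibility. Every
    constraint is a lower bound, so upper bounds appear with a minus sign. The nonnegativity rows
    are those required by [small_solution]. *)
Definition base_system : seq constraint :=
  [seq (delta_mx 0 j, 0) | j <- enum 'I_k]
  ++ [seq (row3 (row i (A11 P)) (A12 P i 0) 0, b1 P i 0) | i <- enum 'I_m]
  ++ [seq (row3 (- delta_mx 0 j) 0 0, -1) | j <- enum 'I_n]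
  ++ [:: (row3 0 (-1) 0, -1)].

Definition good_constraint (r : constraint) : Prop := good_row r.1 /\ good r.2.

Lemma good_map (T : eqType) (l : seq T) (f : T -> constraint) (r : constraint) :
  (forall i, good_constraint (f i)) -> r \in [seq f i | i <- l] -> good_constraint r.
Proof. by move=> H /mapP [i _ ->]. Qed.

Lemma good_A11 i : good_row (row i (A11 P)).
Proof. by move=> j; rewrite mxE; apply: good_entry; apply: mem_A11. Qed.

Lemma good_A11_col j : good_row (col j (A11 P))^T.
Proof. by move=> i; rewrite !mxE; apply: good_entry; apply: mem_A11. Qed.

Ltac good := first
  [ exact: good0 | exact: good1 | exact: good_row0 | exact: good_delta
  | exact: good_A11 | exact: good_A11_col
  | exact: (good_entry (mem_A12 _)) | exact: (good_entry (mem_b1 _))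
  | exact: (good_entry (mem_c11 _)) | exact: (good_entry mem_p2)
  | apply: good_row3; good | apply: good_rowN; good | apply: goodN; good
  | split; good ].

Lemma good_base r : r \in base_system -> good_constraint r.
Proof.
rewrite /base_system !mem_cat => /or4P [] .
- by apply: good_map => j; good.
- by apply: good_map => j; good.
- by apply: good_map => j; good.
- by rewrite inE => /eqP ->; good.
Qed.

Lemma unit_base j : (delta_mx 0 j, 0) \in base_system.
Proof. by rewrite /base_system mem_cat; apply/orP; left; apply/mapP; exists j; rewrite ?mem_enum. Qed.

Lemma real_delta l (j : 'I_l) (x : 'cV[R]_l) : (real_mx (delta_mx 0 j : 'rV_l) *m x) 0 0 = x j 0.
Proof.
have -> : real_mx (delta_mx 0 j : 'rV_l) = delta_mx 0 j.
  by apply/matrixP => a b; rewrite !mxE rmorph_nat.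
by rewrite -rowE mxE.
Qed.

Lemma real_Ndelta l (j : 'I_l) (x : 'cV[R]_l) : (real_mx (- delta_mx 0 j : 'rV_l) *m x) 0 0 = - x j 0.
Proof. by rewrite map_mxN mulNmx mxE real_delta. Qed.

Lemma rat_delta l (j : 'I_l) (x : 'cV[rat]_l) : ((delta_mx 0 j : 'rV_l) *m x) 0 0 = x j 0.
Proof. by rewrite -rowE mxE. Qed.

Lemma rat_Ndelta l (j : 'I_l) (x : 'cV[rat]_l) : ((- delta_mx 0 j : 'rV_l) *m x) 0 0 = - x j 0.
Proof. by rewrite mulNmx mxE rat_delta. Qed.

Lemma real_row0 l (x : 'cV[R]_l) : (real_mx (0 : 'rV_l) *m x) 0 0 = 0.
Proof. by rewrite map_mx0 mul0mx mxE. Qed.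

Lemma rat_row0 l (x : 'cV[rat]_l) : ((0 : 'rV_l) *m x) 0 0 = 0.
Proof. by rewrite mul0mx mxE. Qed.

Lemma real_A11 i (x : 'cV[R]_n) : (real_mx (row i (A11 P)) *m x) 0 0 = (real_mx (A11 P) *m x) i 0.
Proof. by rewrite map_row -row_mul mxE. Qed.

Lemma satisfies_cat (S1 S2 : seq constraint) (z : 'cV[R]_k) :
  satisfies S1 z -> satisfies S2 z -> satisfies (S1 ++ S2) z.
Proof. by move=> H1 H2 r; rewrite mem_cat => /orP [/H1|/H2]. Qed.

Lemma satisfies_map (T : eqType) (l : seq T) (f : T -> constraint) (z : 'cV[R]_k) :
  (forall i, i \in l -> ratr (f i).2 <= (real_mx (f i).1 *m z) 0 0) ->
  satisfies [seq f i | i <- l] z.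
Proof. by move=> H r /mapP [i il ->]; apply: H. Qed.

Lemma satisfies_base (x : 'cV[R]_n) t (y : 'cV[R]_m) :
  lower_feasible P t x -> (forall i, 0 <= y i 0) -> satisfies base_system (col3 x t y).
Proof.
move=> [F1 F2 /andP [t0 t1]] y0; rewrite /base_system.
apply: satisfies_cat; last apply: satisfies_cat; last apply: satisfies_cat.
- apply: satisfies_map => j _ /=; rewrite real_delta rmorph0 /col3.
  case: (split_ordP j) => j' ->; first by rewrite col_mxEu; have /andP [] := F2 j'.
  rewrite col_mxEd; case: (split_ordP j') => i ->; first by rewrite col_mxEu ord1 mxE.
  by rewrite col_mxEd.
- apply: satisfies_map => i _ /=; rewrite dot3 real_row0 addr0 real_A11.
  have := F1 i; rewrite mxE => /le_trans; apply; rewrite mxE lerD2l.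
  by rewrite [X in X <= _]mxE [X in _ * X]mxE mulrC.
- apply: satisfies_map => j _ /=; rewrite dot3 real_row0 real_Ndelta rmorphN rmorph1 rmorph0.
  by have /andP [_] := F2 j; lra.
- move=> r; rewrite inE => /eqP -> /=; rewrite dot3 !real_row0 rmorphN rmorph1; lra.
Qed.

Lemma rat_A11 i (x : 'cV[rat]_n) t (y : 'cV[rat]_m) :
  (row3 (row i (A11 P)) (A12 P i 0) 0 *m col3 x t y) 0 0 = rat_row x t i.
Proof.
rewrite dot3_rat rat_row0 addr0 mxE [A12 _ _ _ * _]mulrC; congr (_ + _).
by apply: eq_bigr => j _; rewrite mxE.
Qed.

Lemma base_feasible (x : 'cV[rat]_n) t (y : 'cV[rat]_m) :
  (forall r, r \in base_system -> r.2 <= (r.1 *m col3 x t y) 0 0) ->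
  lower_feasible P (ratr t : R) (real_mx x) /\ (forall i, 0 <= y i 0).
Proof.
move=> H.
have H0 j : 0 <= col3 x t y j 0 by have := H _ (unit_base j); rewrite /= rat_delta.
split; last first.
  by move=> i; have := H0 (rshift n (rshift 1 i)); rewrite /col3 !col_mxEd.
split=> [i|j|].
- rewrite lower_row_ratr mxE ler_rat -(rat_A11 i x t y).
  apply: (H (_, _)); rewrite /base_system !mem_cat; apply/or4P; apply: Or42.
  by apply/mapP; exists i; rewrite ?mem_enum.
- rewrite mxE ler0q ratr_le1; have := H0 (lshift _ j); rewrite /col3 col_mxEu => -> /=.
  have : (row3 (- delta_mx 0 j) 0 0, -1 : rat) \in base_system.
    rewrite /base_system !mem_cat; apply/or4P; apply: Or43.
    by apply/mapP; exists j; rewrite ?mem_enum.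
  by move/H => /=; rewrite dot3_rat rat_row0 rat_Ndelta; lra.
- rewrite ler0q ratr_le1; have := H0 (rshift n (lshift m ord0)).
  rewrite /col3 col_mxEd col_mxEu mxE /= => -> /=.
  have : (row3 0 (-1) 0, -1 : rat) \in base_system.
    by rewrite /base_system !mem_cat mem_head !orbT.
  by move/H => /=; rewrite dot3_rat !rat_row0; lra.
Qed.

(** Certificates are read by the tokenizer for queries, hence the two dummy dimensions in front. *)
Definition certificate (N : 'I_k -> nat) (T : nat) : seq bool :=
  encode_raw (Bn 0) (Bn 0) [seq (false, (Bn (N j), Bn T)) | j <- enum 'I_k].

Definition certificate_entries (N : 'I_k -> nat) (T : nat) : seq bfrac :=
  [seq frac_of r | r <- rtokens (n + 1 + m) (tokens (certificate N T))].

Lemma certificate_entriesE N T :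
  certificate_entries N T = [seq (Bn (N j), (Bn 0, Bn T)) | j <- enum 'I_k].
Proof.
rewrite /certificate_entries /certificate tokens_encode_raw.
set L := map _ (enum 'I_k).
have -> : (n + 1 + m = size L)%N by rewrite size_map size_enum_ord addnA.
by rewrite rtokens_of /L -map_comp.
Qed.

Lemma size_certificate N T b : (forall j, N j <= 2 ^ b)%N -> (T <= 2 ^ b)%N ->
  (size (certificate N T) <= 2 + k * (4 * b + 7))%N.
Proof.
move=> HN HT; rewrite /certificate /encode_raw 2!size_cat !size_encode_nat binary0 /=.
rewrite addnA leq_add2l -map_comp.
have Hb a : (a <= 2 ^ b -> size (binary a) <= b.+1)%N.
  by move=> le; rewrite size_binary_leq; apply: leq_ltn_trans le _; rewrite ltn_exp2l.
set f := _ \o _; have Hf j : (size (f j) <= 4 * b + 7)%N.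
  rewrite /f /= size_cat !size_encode_nat.
  by have := Hb _ (HN j); have := Hb _ HT; lia.
clearbody f; rewrite -[X in (_ <= X * _)%N](size_enum_ord k).
elim: (enum _) => //= j l IH; by rewrite size_cat mulSn leq_add.
Qed.

Section Certificate.
Variables (N : 'I_k -> nat) (T : nat) (z : 'cV[rat]_k).
Hypotheses (T0 : (0 < T)%N) (Hz : forall j, z j 0 = (N j)%:R / T%:R).
Local Notation C := (certificate_entries N T).
Local Notation x := (usubmx z).
Local Notation t := (z (rshift n (lshift m ord0)) 0).
Local Notation y := (dsubmx (dsubmx z)).

Lemma certificate_col3 : z = col3 x t y.
Proof.
rewrite /col3 -{1}[z]vsubmxK; congr col_mx; rewrite -{1}[dsubmx z]vsubmxK; congr col_mx.
by apply/matrixP => a b; rewrite !ord1 !mxE eqxx.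
Qed.

Lemma nth_certificate (j : 'I_k) : fpos (nth frac0 C j) /\ fval (nth frac0 C j) = z j 0.
Proof.
rewrite certificate_entriesE (nth_map j) ?size_enum_ord // nth_ord_enum; split=> //.
by rewrite /fval /= subr0 Hz.
Qed.

Lemma denotes_cert_x : denotes (slice C 0 n) x.
Proof. by move=> j; rewrite nth_slice // mxE; apply: (nth_certificate (lshift _ j)). Qed.

Lemma denotes_cert_t : fpos (nth frac0 C n) /\ fval (nth frac0 C n) = t.
Proof. by have := nth_certificate (rshift n (lshift m ord0)); rewrite /= addn0. Qed.

Lemma denotes_cert_y : denotes (slice C n.+1 m) y.
Proof.
move=> i; rewrite nth_slice // !mxE addSnnS -add1n.
exact: (nth_certificate (rshift n (rshift 1 i))).
Qed.

Lemma certificate_pos : all (fun f => ~~ bleq f.2.2 (Bn 0)) C.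
Proof. by rewrite certificate_entriesE all_map; apply/allP => j _; rewrite /bleq /= -ltnNge. Qed.

End Certificate.

End Completeness.

(** * Completeness of the verifier *)

Section Improvement.
Variables (R : realType) (Q : query).
Local Notation n := (qn Q).
Local Notation m := (qm Q).
Local Notation P := (program Q).
Local Notation D := (query_data Q).
Local Notation real_mx := (map_mx (ratr : rat -> R)).
Local Notation k := (n + (1 + m))%N.
Local Notation good := (bounded_entry (common_den Q ^+ 2) (entry_bits Q)).
Local Notation xpart z := (usubmx z).
Local Notation tpart z := (z (rshift n (lshift m ord0)) 0).
Local Notation ypart z := (dsubmx (dsubmx z)).

Definition small_certificate (N : 'I_k -> nat) (T : nat) : Prop :=
  (T <= 2 ^ cramer_bits (entry_bits Q) k.+1)%N /\
  (forall j, (N j <= 2 ^ cramer_bits (entry_bits Q) k.+1)%N).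

Lemma find_certificate (S : seq (constraint Q)) (d : 'rV[rat]_k) (v : rat) (z : 'cV[R]_k) :
  (forall r, r \in S -> good_constraint r) -> (forall j, good (d 0 j)) -> good v ->
  satisfies (base_system Q ++ S) z -> (real_mx d *m z) 0 0 < ratr v ->
  exists (w : 'cV[rat]_k) (N : 'I_k -> nat) (T : nat),
    [/\ small_certificate N T, (0 < T)%N, forall j, w j 0 = (N j)%:R / T%:R,
      forall r, r \in base_system Q ++ S -> r.2 <= (r.1 *m w) 0 0 & (d *m w) 0 0 < v].
Proof.
move=> gS gd gv Sz dz.
have D0 : common_den Q ^+ 2 != 0 by rewrite expf_neq0 ?common_den_neq0.
have gS' r : r \in base_system Q ++ S -> (forall j, good (r.1 0 j)) /\ good r.2.
  by rewrite mem_cat => /orP [/good_base|/gS].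
have uS j : (delta_mx 0 j, 0) \in base_system Q ++ S by rewrite mem_cat unit_base.
have [w [N [T [[T0 Tb Nb Ew] H1 H2]]]] := small_solution D0 (good1 Q) gS' gd gv uS Sz dz.
by exists w, N, T.
Qed.

Lemma good_objective : good (\sum_j c21 P j 0 * point1 Q j 0 + c22 P * point2 Q).
Proof.
have [le _] := dims_size Q.
apply: (@good_dot Q n (c21 P) (point1 Q) (c22 P) (point2 Q)) => //.
- exact: mem_c21.
- exact: mem_p1.
- by right; apply: mem_c22.
- exact: mem_p2.
Qed.

Lemma good_lower_objective : good (\sum_j c11 P j 0 * point1 Q j 0).
Proof.
suff : good (\sum_j c11 P j 0 * point1 Q j 0 + 0 * point2 Q) by rewrite mul0r addr0.
have [le _] := dims_size Q; apply: good_dot => //.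
- exact: mem_c11.
- exact: mem_p1.
- by left.
- exact: mem_p2.
Qed.

Lemma improve_lower (x1 : 'cV[R]_n) : lower_feasible P (ratr (point2 Q)) x1 ->
  dot (c11 P) x1 < dot (c11 P) (real_mx (point1 Q)) ->
  exists N T, small_certificate N T /\ check_improvement D (certificate_entries N T).
Proof.
move=> Fx lt.
(* Two opposite inequalities fix the upper-level variable at its given value; [z] takes zero
   multipliers. *)
pose S : seq (constraint Q) :=
  [:: (row3 0 1 0, point2 Q); (row3 0 (-1) 0, - point2 Q)].
pose d : 'rV[rat]_k := row3 (c11 P)^T 0 0.
pose z : 'cV[R]_k := col3 x1 (ratr (point2 Q)) 0.
have gS r : r \in S -> good_constraint r.
  have gp := good_entry (mem_p2 Q); have g1 := good1 Q.
  rewrite !inE => /orP [] /eqP ->; split=> //=; try exact: goodN.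
    by apply: good_row3 => //; apply: good_row0.
  by apply: good_row3; [apply: good_row0|apply: goodN|apply: good_row0].
have gd j : good (d 0 j).
  apply: good_row3; [|exact: good0|exact: good_row0].
  by move=> i; rewrite mxE; apply: good_entry; apply: mem_c11.
have Sz : satisfies (base_system Q ++ S) z.
  apply: satisfies_cat; first by apply: satisfies_base => // i; rewrite mxE.
  move=> r; rewrite !inE => /orP [] /eqP -> /=; rewrite dot3 !real_row0 ?rmorphN rmorph1; lra.
have Ed (F : fieldType) (f : {rmorphism rat -> F}) (x : 'cV[F]_n) :
    (map_mx f (c11 P)^T *m x) 0 0 = \sum_j f (c11 P j 0) * x j 0.
  by rewrite mxE; apply: eq_bigr => j _; rewrite !mxE.
have dz : (real_mx d *m z) 0 0 < ratr (\sum_j c11 P j 0 * point1 Q j 0).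
  rewrite dot3 real_row0 rmorph0 mul0r !addr0 Ed -dot_ratr; move: lt.
  by rewrite [X in X < _]dotE.
have [w [N [T [small T0 Ew Hw dw]]]] := find_certificate gS gd good_lower_objective Sz dz.
exists N, T; split=> //; rewrite (certificate_col3 w) in Hw dw.
have Ht : tpart w = point2 Q.
  have h1 := Hw (row3 0 1 0, point2 Q); have h2 := Hw (row3 0 (-1) 0, - point2 Q).
  rewrite !mem_cat !inE !eqxx !orbT in h1 h2; have {}h1 := h1 isT; have {}h2 := h2 isT.
  by rewrite /= !dot3_rat !rat_row0 in h1 h2; lra.
have [Fw _] := base_feasible R (fun r Hr => Hw r ltac:(by rewrite mem_cat Hr)).
have [p2p p2v] := denotes_entry Q (3 * n + 1 + m * n + 2 * m); rewrite entry_p2 in p2v.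
have HX := denotes_cert_x T0 Ew.
have C1 : check_feasible D (slice (certificate_entries N T) 0 n) (e_p2 D).
  by apply/(check_feasibleP R HX p2p p2v); rewrite -Ht.
have C2 : flt (fdot n (e_c11 D) (slice (certificate_entries N T) 0 n)) (fdot n (e_c11 D) (e_p1 D)).
  have [q1 w1] := fdotP (@denotes_c11 Q) HX.
  have [q2 w2] := fdotP (@denotes_c11 Q) (@denotes_p1 Q).
  rewrite /flt fleE // w1 w2 -ltNge; move: dw.
  rewrite dot3_rat rat_row0 mul0r !addr0 [X in X < _]mxE.
  by under eq_bigr => j _ do rewrite mxE.
by rewrite /check_improvement (certificate_pos N T0) C1 C2 orbT.
Qed.

Lemma improve_upper (x1 : 'cV[R]_n) (t : R) : lower_optimal P t x1 ->
  upper_objective P x1 t < upper_objective P (real_mx (point1 Q)) (ratr (point2 Q)) ->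
  exists N T, small_certificate N T /\ check_improvement D (certificate_entries N T).
Proof.
move=> Ox lt; have [Fx _] := Ox; have [Y [HY Hs]] := kkt_necessary Ox.
pose val i := (real_mx (A11 P) *m x1 + t *: real_mx (A12 P)) i 0.
(* Complementary slackness is a disjunction for each row and each variable. The branch taken by the
   real optimum is recorded, and [S1] to [S6] impose the same branches on the unknowns. *)
pose tight i := val i <= ratr (b1 P i 0).
pose zero j := x1 j 0 <= 0.
pose one j := 1 <= x1 j 0.
pose S1 : seq (constraint Q) := [seq (row3 (- row i (A11 P)) (- A12 P i 0) 0, - b1 P i 0) | i <- enum tight].
pose S2 : seq (constraint Q) := [seq (row3 0 0 (- delta_mx 0 i), 0) | i <- enum (predC tight)].
pose S3 : seq (constraint Q) := [seq (row3 (- delta_mx 0 j) 0 0, 0) | j <- enum zero].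
pose S4 : seq (constraint Q) := [seq (row3 (delta_mx 0 j) 0 0, 1) | j <- enum one].
pose S5 : seq (constraint Q) := [seq (row3 0 0 (col j (A11 P))^T, c11 P j 0) | j <- enum (predC zero)].
pose S6 : seq (constraint Q) := [seq (row3 0 0 (- (col j (A11 P))^T), - c11 P j 0) | j <- enum (predC one)].
pose S := S1 ++ S2 ++ S3 ++ S4 ++ S5 ++ S6.
pose d : 'rV[rat]_k := row3 (c21 P)^T (c22 P) 0.
pose z : 'cV[R]_k := col3 x1 t Y.
have gS r : r \in S -> good_constraint r.
  have gA12 i := good_entry (mem_A12 i); have gb i := good_entry (mem_b1 i).
  have gc j := good_entry (mem_c11 j); have g0 := good0 Q; have g1 := good1 Q.
  have gr0 l := @good_row0 Q l.
  rewrite !mem_cat; case/orP; [|case/orP; [|case/orP; [|case/orP; [|case/orP]]]];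
    apply: good_map => i; split=> //=; try (by apply: goodN); apply: good_row3 => //;
    try (by apply: goodN).
  - by apply: good_rowN; apply: good_A11.
  - by apply: good_rowN; apply: good_delta.
  - by apply: good_rowN; apply: good_delta.
  - by apply: good_delta.
  - by apply: good_A11_col.
  - by apply: good_rowN; apply: good_A11_col.
have gd j : good (d 0 j).
  apply: good_row3; [|exact: good_entry (mem_c22 Q)|exact: good_row0].
  by move=> i; rewrite mxE; apply: good_entry; apply: mem_c21.
have real_col j : (real_mx (col j (A11 P))^T *m Y) 0 0 = \sum_i ratr (A11 P i j) * Y i 0.
  by rewrite mxE; apply: eq_bigr => i _; rewrite !mxE.
have val_i i : (real_mx (A11 P) *m x1) i 0 + ratr (A12 P i 0) * t = val i.
  by rewrite /val [RHS]mxE [X in _ = _ + X]mxE [X in _ = _ + t * X]mxE mulrC.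
have Sz : satisfies (base_system Q ++ S) z.
  apply: satisfies_cat; first by apply: satisfies_base => // i; have [] := HY i.
  apply: satisfies_cat; [|apply: satisfies_cat; [|apply: satisfies_cat;
    [|apply: satisfies_cat; [|apply: satisfies_cat]]]].
  - apply: satisfies_map => i; rewrite mem_enum => ti /=; rewrite dot3 real_row0 addr0.
    rewrite map_mxN mulNmx [X in X + _]mxE real_A11 !rmorphN mulNr -opprD val_i lerN2.
    exact: ti.
  - apply: satisfies_map => i; rewrite mem_enum => ti /=.
    rewrite dot3 real_row0 real_Ndelta !rmorph0 mul0r !add0r.
    have [_ ->] := HY i; rewrite ?oppr0 //.
    by move: ti; rewrite inE /= /tight -ltNge.
  - apply: satisfies_map => j; rewrite mem_enum => zj /=.
    by rewrite dot3 real_row0 real_Ndelta !rmorph0 mul0r !addr0 oppr_ge0.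
  - apply: satisfies_map => j; rewrite mem_enum => zj /=.
    by rewrite dot3 real_row0 real_delta !rmorph0 rmorph1 mul0r !addr0.
  - apply: satisfies_map => j; rewrite mem_enum => zj /=.
    rewrite dot3 real_row0 real_col !rmorph0 mul0r !add0r; have [h _] := Hs j; apply: h.
    by move: zj; rewrite inE /= /zero -ltNge.
  - apply: satisfies_map => j; rewrite mem_enum => zj /=.
    rewrite dot3 real_row0 map_mxN mulNmx [X in _ + X]mxE real_col !rmorph0 rmorphN mul0r !add0r lerN2.
    have [_ h] := Hs j; apply: h.
    by move: zj; rewrite inE /= /one -ltNge.
have dz : (real_mx d *m z) 0 0 < ratr (\sum_j c21 P j 0 * point1 Q j 0 + c22 P * point2 Q).
  have -> : ratr (\sum_j c21 P j 0 * point1 Q j 0 + c22 P * point2 Q)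
      = upper_objective P (real_mx (point1 Q)) (ratr (point2 Q)) :> R.
    by rewrite /upper_objective dot_ratr rmorphD rmorphM.
  rewrite dot3 real_row0 addr0; move: lt.
  by rewrite {1}/upper_objective {1}/dot map_trmx.
have [w [N [T [small T0 Ew Hw dw]]]] := find_certificate gS gd good_objective Sz dz.
exists N, T; split=> //; rewrite (certificate_col3 w) in Hw dw.
have [Fw Yw] := base_feasible R (fun r Hr => Hw r ltac:(by rewrite mem_cat Hr)).
have HX := denotes_cert_x T0 Ew; have [pt vt] := denotes_cert_t T0 Ew.
have HYw := denotes_cert_y T0 Ew.
have C1 : check_feasible D (slice (certificate_entries N T) 0 n) (nth frac0 (certificate_entries N T) n).
  exact/(check_feasibleP R HX pt vt).
have C2 : check_dual D (slice (certificate_entries N T) 0 n) (nth frac0 (certificate_entries N T) n)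
    (slice (certificate_entries N T) n.+1 m).
  have rat_col j : ((col j (A11 P))^T *m ypart w) 0 0 = \sum_i A11 P i j * ypart w i 0.
    by rewrite mxE; apply: eq_bigr => i _; rewrite !mxE.
  have inS r : r \in S -> r.2 <= (r.1 *m col3 (xpart w) (tpart w) (ypart w)) 0 0.
    by move=> h; apply: Hw; rewrite mem_cat h orbT.
  apply/(check_dualP HX pt vt HYw); split=> [i|j].
    split; first exact: Yw.
    case: (boolP (tight i)) => ti.
      right; have : (row3 (- row i (A11 P)) (- A12 P i 0) 0, - b1 P i 0) \in S.
        by rewrite /S mem_cat; apply/orP; left; apply/mapP; exists i; rewrite ?mem_enum.
      move/inS => /=; rewrite dot3_rat rat_row0 addr0 mulNmx mxE mulNr -opprD lerN2.
      move=> h; apply: (le_trans _ h); rewrite /rat_row [X in _ <= X + _]mxE [A12 P i 0 * _]mulrC lerD2r.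
      by rewrite le_eqVlt; apply/orP; left; apply/eqP; apply: eq_bigr => j _; rewrite [row _ _ _ _]mxE.
    left; have : (row3 0 0 (- delta_mx 0 i), 0 : rat) \in S.
      rewrite /S 2!mem_cat; apply/or3P; apply: Or32; apply/mapP; exists i => //.
      by rewrite mem_enum.
    by move/inS => /=; rewrite dot3_rat rat_row0 rat_Ndelta mul0r !add0r oppr_ge0.
  split.
    case: (boolP (one j)) => oj.
      right; have : (row3 (delta_mx 0 j) 0 0, 1 : rat) \in S.
        rewrite /S 4!mem_cat; apply/orP; right; apply/or4P; apply: Or43.
        by apply/mapP; exists j; rewrite ?mem_enum.
      by move/inS => /=; rewrite dot3_rat rat_row0 rat_delta mul0r !addr0.
    left; have : (row3 0 0 (- (col j (A11 P))^T), - c11 P j 0) \in S.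
      rewrite /S !mem_cat; do 5! (apply/orP; right); apply/mapP; exists j => //.
      by rewrite mem_enum.
    by move/inS => /=; rewrite dot3_rat rat_row0 mul0r !add0r mulNmx mxE rat_col lerN2.
  case: (boolP (zero j)) => zj.
    right; have : (row3 (- delta_mx 0 j) 0 0, 0 : rat) \in S.
      rewrite /S 3!mem_cat; apply/or4P; apply: Or43.
      by apply/mapP; exists j; rewrite ?mem_enum.
    by move/inS => /=; rewrite dot3_rat rat_row0 rat_Ndelta mul0r !addr0 oppr_ge0.
  left; have : (row3 0 0 (col j (A11 P))^T, c11 P j 0) \in S.
    rewrite /S !mem_cat; do 4! (apply/orP; right); apply/orP; left; apply/mapP; exists j => //.
    by rewrite mem_enum.
  by move/inS => /=; rewrite dot3_rat rat_row0 mul0r !add0r rat_col.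
have C3 : flt (objective D (slice (certificate_entries N T) 0 n) (nth frac0 (certificate_entries N T) n))
                (objective D (e_p1 D) (e_p2 D)).
  have [p2p p2v] := denotes_entry Q (3 * n + 1 + m * n + 2 * m); rewrite entry_p2 in p2v.
  have [q1 w1] := objectiveP R HX pt vt.
  have [q2 w2] := objectiveP R (@denotes_p1 Q) p2p p2v.
  rewrite /flt fleE // -(ler_rat R) w1 w2 -ltNge /upper_objective !dot_ratr -!rmorphM -!rmorphD ltr_rat.
  move: dw; rewrite dot3_rat rat_row0 addr0 mxE.
  by under eq_bigr => j _ do rewrite mxE.
by rewrite /check_improvement (certificate_pos N T0) C1 C2 C3 !orbT.
Qed.

Lemma verify_complete : ~ query_optimal R Q ->
  exists y, (size y <= 2 + k * (4 * cramer_bits (entry_bits Q) k.+1 + 7))%N /\ verify (encode_query Q) y.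
Proof.
move=> nopt.
have V y : check_improvement D [seq frac_of r | r <- rtokens (n + 1 + m) (tokens y)] ->
    verify (encode_query Q) y.
  by move=> H; rewrite /verify parse_encode /verify_parsed /= H !orbT.
case: (boolP (check_feasible D (e_p1 D) (e_p2 D))) => F; last first.
  by exists [::]; split=> //; apply: V; rewrite /check_improvement F.
suff [N [T [[TB NB] H]]] : exists N T, small_certificate N T /\ check_improvement D (certificate_entries N T).
  by exists (certificate N T); split; [exact: size_certificate|exact: V].
have [p2p p2v] := denotes_entry Q (3 * n + 1 + m * n + 2 * m); rewrite entry_p2 in p2v.
have {}F : lower_feasible P (ratr (point2 Q) : R) (real_mx (point1 Q)).
  exact/(check_feasibleP R (@denotes_p1 Q) p2p p2v).
have [Hl|Hl] := boolp.pselect (exists x1, lower_feasible P (ratr (point2 Q)) x1 /\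
    dot (c11 P) x1 < dot (c11 P) (real_mx (point1 Q))).
  by have [x1 [F1 lt]] := Hl; apply: improve_lower F1 lt.
have [Hu|Hu] := boolp.pselect (exists x1 t, lower_optimal P t x1 /\
    upper_objective P x1 t < upper_objective P (real_mx (point1 Q)) (ratr (point2 Q))).
  by have [x1 [t [O1 lt]]] := Hu; apply: improve_upper O1 lt.
exfalso; apply: nopt; split; first split=> // x1' F1.
  by rewrite leNgt; apply/negP => lt; apply: Hl; exists x1'.
move=> x1' t' O1; rewrite leNgt; apply/negP => lt; apply: Hu; exists x1', t'; split=> //.
Qed.

End Improvement.

(** * Membership in coNP *)

Definition rval (r : rtoken) : rat :=
  (if r.1 then - (bv r.2.1)%:Z else (bv r.2.1)%:Z)%:~R / (bv r.2.2)%:Z%:~R.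

Lemma rtoken_of_rval r : (0 < bv r.2.2)%N -> ~~ (r.1 && (bv r.2.1 == 0%N)) ->
  coprime (bv r.2.1) (bv r.2.2) -> rtoken_of (rval r) = r.
Proof.
case: r => [s [[p] [d]]] /= d0 sp co.
have co' : coprime `|if s then - p%:Z else p%:Z|%N `|d%:Z|%N by case: (s); rewrite ?abszN.
rewrite /rtoken_of /rval /= coprimeq_num // coprimeq_den //=.
have -> : (d%:Z == 0) = false by apply/eqP; lia.
have -> : Num.sg d%:Z = 1 by apply: gtr0_sg; lia.
rewrite mul1r; congr (_, (Bn _, Bn _)) => //.
  by case: s sp {co'} => //= p0; apply/idP; lia.
by case: (s); rewrite ?abszN.
Qed.

Lemma split_size (T : Type) (l : seq T) a b : size l = (a + b)%N ->
  exists l1 l2, [/\ l = l1 ++ l2, size l1 = a & size l2 = b].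
Proof.
move=> E; exists (take a l), (drop a l).
by rewrite cat_take_drop size_drop E addKn size_takel // E leq_addr.
Qed.

Lemma col_entriesK k l : size l = k -> col_entries (\col_(i < k) l`_i) = l.
Proof.
move=> E; apply: (@eq_from_nth _ 0); rewrite size_col_entries // => i lt.
by rewrite (nth_col_entries _ (Ordinal lt)) mxE.
Qed.

Lemma mx_entriesK k j l : size l = (k * j)%N -> mx_entries (\matrix_(a < k, b < j) l`_(a * j + b)) = l.
Proof.
move=> E; apply: (@eq_from_nth _ 0); rewrite size_mx_entries // => i lt.
have j0 : (0 < j)%N by case: (j) lt => //; rewrite muln0.
have la : (i %/ j < k)%N by rewrite ltn_divLR.
have lb : (i %% j < j)%N by rewrite ltn_mod.
by rewrite {1}(divn_eq i j) (nth_mx_entries _ (Ordinal la) (Ordinal lb)) mxE /= -divn_eq.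
Qed.

Lemma query_of_entries n m (l : seq rat) : size l = entries n m ->
  exists Q, [/\ qn Q = n, qm Q = m & query_entries Q = l].
Proof.
move=> E.
have {}E : size l = (n + (n + (1 + (m * n + (m + (m + (n + 1)))))))%N by rewrite E /entries; lia.
have [l1 [r1 [-> E1 {}E]]] := split_size E.
have [l2 [r2 [-> E2 {}E]]] := split_size E.
have [l3 [r3 [-> E3 {}E]]] := split_size E.
have [l4 [r4 [-> E4 {}E]]] := split_size E.
have [l5 [r5 [-> E5 {}E]]] := split_size E.
have [l6 [r6 [-> E6 {}E]]] := split_size E.
have [l7 [l8 [-> E7 E8]]] := split_size E.
case: l3 E3 => [|c [|? ?]] // _; case: l8 E8 => [|p [|? ?]] // _.
exists (@Query n m (Bilevel (\col_(i < n) l1`_i) (\col_(i < n) l2`_i) c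
  (\matrix_(a < m, b < n) l4`_(a * n + b)) (\col_(i < m) l5`_i) (\col_(i < m) l6`_i))
  (\col_(i < n) l7`_i) p); split=> //.
by rewrite /query_entries /= !col_entriesK // mx_entriesK.
Qed.

Lemma size_flatten_nth (S T : Type) (f : S -> seq T) x0 l i : (i < size l)%N ->
  (size (f (nth x0 l i)) <= size (flatten (map f l)))%N.
Proof.
elim: l i => [|a l IH] [|i] //= lt; rewrite size_cat; first exact: leq_addr.
exact: leq_trans (IH _ lt) (leq_addl _ _).
Qed.

Lemma size_encode_rtoken r : size (encode_rtoken r) =
  (2 * size (binary (bv r.2.1)) + 2 * size (binary (bv r.2.2))).+3.
Proof. by rewrite /= size_cat !size_encode_nat; lia. Qed.

(** A string that survives parsing and encoding, with all tokens canonical, encodes the query made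
    of their values. Otherwise a test fires; only a common factor needs a certificate. *)
Lemma verify_invalid x : ~ (exists Q, encode_query Q = x) ->
  exists y, (size y <= 6 * size x + 10)%N /\ verify x y.
Proof.
move=> noQ.
suff : exists y, (size y <= 6 * size x + 10)%N /\
  [|| ~~ eqbits (encode_raw (Bn (parse_query x).1) (Bn (parse_query x).2.1) (parse_query x).2.2) x,
   has check_entry (parse_query x).2.2 | check_common_factor (parse_query x).2.2 (tokens y)].
  move=> [y [Hy /or3P H]]; exists y; split=> //; rewrite /verify /verify_parsed.
  by case: H => ->; rewrite ?orbT.
have Sz : size (parse_query x).2.2 = entries (parse_query x).1 (parse_query x).2.1.
  by rewrite size_map size_iota.
move: (parse_query x) Sz => [n [m L]] /= Sz.
case: (boolP (eqbits _ _)) => [|_]; last by exists [::].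
rewrite eqbitsE => /eqP Ex.
case: (boolP (has check_entry L)) => [_|nL]; first by exists [::].
pose r0 : rtoken := (false, (Bn 0, Bn 1)).
have Hb i : (i < size L)%N -> (bv (nth r0 L i).2.1 < 2 ^ size x)%N /\ (bv (nth r0 L i).2.2 < 2 ^ size x)%N.
  move=> lt; have := size_flatten_nth encode_rtoken r0 lt.
  have : (size (flatten [seq encode_rtoken r | r <- L]) <= size x)%N.
    by rewrite -Ex /encode_raw 2!size_cat addnA leq_addl.
  rewrite size_encode_rtoken => h1 h2; have := leq_trans h2 h1.
  by rewrite -!size_binary_leq; split; lia.
have Hpos i : (i < size L)%N -> (0 < bv (nth r0 L i).2.2)%N /\
    ~~ ((nth r0 L i).1 && (bv (nth r0 L i).2.1 == 0%N)).
  move=> lt; move: nL; rewrite -all_predC => /(all_nthP r0) /(_ i lt) /=.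
  by rewrite /check_entry /bleq /= !leqn0 negb_or lt0n => /andP [].
have [/(all_nthP r0) co|] := boolP (all (fun r => coprime (bv r.2.1) (bv r.2.2)) L).
  exfalso; apply: noQ.
  have [|Q [En Em EL]] := @query_of_entries n m [seq rval r | r <- L]; first by rewrite size_map.
  exists Q; rewrite encode_queryE En Em -Ex; congr encode_raw.
  rewrite /raw_entries EL -map_comp; apply: (@eq_from_nth _ r0); rewrite size_map // => i lt.
  rewrite (nth_map r0) //=; have [h1 h2] := Hpos i lt.
  by apply: rtoken_of_rval => //; apply: co.
rewrite -has_predC => /(has_nthP r0) [i lt /= nco].
have [b1 b2] := Hb i lt; have [p1 p2] := Hpos i lt.
set r := nth r0 L i in nco b1 b2 p1 p2.
set g := gcdn (bv r.2.1) (bv r.2.2) in nco.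
have g0 : (0 < g)%N by rewrite gcdn_gt0 p1 orbT.
have g2 : (1 < g)%N by move: nco; rewrite /coprime -/g; lia.
pose f := (bv r.2.1 %/ g)%N; pose e := (bv r.2.2 %/ g)%N.
have Ef : (bv r.2.1 = g * f)%N by rewrite mulnC divnK // dvdn_gcdl.
have Ee : (bv r.2.2 = g * e)%N by rewrite mulnC divnK // dvdn_gcdr.
(* The tokens 0, 1 and 3 of this string are [g], [e] and [f], where [check_common_factor] looks for
   them. *)
exists (encode_raw (Bn g) (Bn e) [:: (false, (Bn f, Bn 1))]); split.
  rewrite /encode_raw 2!size_cat /= cats0 size_cat !size_encode_nat.
  have hb a b : (a <= b)%N -> (b < 2 ^ size x)%N -> (size (binary a) <= size x)%N.
    by move=> h1 h2; rewrite size_binary_leq; apply: leq_ltn_trans h1 h2.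
  have c1 : (size (binary g) <= size x)%N by apply: hb b2; apply: dvdn_leq p1 (dvdn_gcdr _ _).
  have c2 := hb _ _ (leq_div (bv r.2.2) g) b2.
  have c3 := hb _ _ (leq_div (bv r.2.1) g) b1.
  have c4 : (size (binary 1) <= 1)%N by rewrite size_binary_leq.
  by move: c1 c2 c3; rewrite -/g -/e -/f /=; lia.
rewrite tokens_encode_raw /check_common_factor /= [bleq _ _]g2 /=.
apply/(has_nthP r0); exists i => //; rewrite -/r /beq /bleq /= Ef Ee.
by rewrite !leqnn.
Qed.

Lemma membership (R : realType) : coNP (language_of encode_query (@query_optimal R)).
Proof.
have [M [p Hp]] := PT_verifier PT_verify.
(* [K s] bounds the number of unknowns after homogenisation, n + m + 2, and [e s] is
   [entry_bits]. *)
pose K s := (2 * s + 3)%N; pose e s := (2 * (s * s) + 3 * s + 2)%N.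
have [q Hq] : poly_bounded (fun s => 6 * s + 10 +
    (2 + K s * (4 * (K s + K s * K s + K s * e s + e s) + 7)))%N.
  by rewrite /K /e; pbd.
exists verify, M, p, q; split=> // x; split; last first.
  by move=> [y [_ Hy]] [Q [Ex opt]]; move: Hy; rewrite -Ex => /(verify_sound (R := R)); apply.
move=> nL.
have [[Q Ex]|noQ] := boolp.pselect (exists Q, encode_query Q = x); last first.
  have [y [Hy Vy]] := verify_invalid noQ; exists y; split=> //.
  by apply: leq_trans Hy (leq_trans (leq_addr _ _) (Hq _)).
have [|y [Hy Vy]] := @verify_complete R Q; first by move=> opt; apply: nL; exists Q.
exists y; rewrite -Ex; split=> //; apply: leq_trans Hy (leq_trans _ (Hq _)).
apply: leq_trans (leq_addl _ _); rewrite leq_add2l.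
have [h1 [h2 _]] := dims_size Q.
set s := size (encode_query Q) in h1 h2 *.
have hk : ((qn Q + (1 + qm Q)).+1 <= K s)%N by rewrite /K; lia.
have hk' : (qn Q + (1 + qm Q) <= K s)%N by apply: ltnW.
rewrite /cramer_bits /entry_bits -/s -/(e s).
apply: leq_mul => //; rewrite leq_add2r leq_mul2l /= leq_add2r.
by apply: leq_add; [apply: leq_add => //; apply: leq_mul|apply: leq_mul].
Qed.

(** * Networks of truncated affine gates as linear programs *)

(* [(p, q)] stands for p - q. *)
Definition sint : Type := nat * nat.
Definition ival (c : sint) : int := c.1%:Z - c.2%:Z.
Definition sadd (c d : sint) : sint := (c.1 + d.1, c.2 + d.2)%N.

(* The gate [(a, (b, l))] in position i stands for the constraint
   v_i + sum_((j, c) in l) c v_j + a x2 >= b. *)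
Definition gate : Type := sint * (sint * seq (nat * sint)).

(** An index may occur several times in a gate, as when two literals of a clause share a variable;
    its coefficients add up. *)
Definition coef (l : seq (nat * sint)) (j : nat) : sint :=
  foldl (fun c e => if e.1 == j then sadd c e.2 else c) (0, 0)%N l.

Definition gate0 : gate := ((0, 0), ((0, 0), [::]))%N.

Definition matrix_entry (gs : seq gate) (i j : nat) : sint :=
  sadd (if i == j then (1, 0)%N else (0, 0)%N) (coef (nth gate0 gs i).2.2 j).

Definition weight (l : seq (nat * sint)) : nat := sumn [seq (e.2.1 + e.2.2)%N | e <- l].

(* The lower-level costs decrease so fast that the lower-level optimum sets each
   v_i in turn to the positive part of its lower bound. *)
Definition network_query (gs : seq gate) (s : nat) : query :=
  let g := size gs in
  @Query g g (Bilevel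
    (\col_(i < g) (2 ^ (s * (g - i.+1)))%N%:R)
    (\col_(i < g) (if i.+1 == g then -1 else 0))
    0
    (\matrix_(i < g, j < g) (ival (matrix_entry gs i j))%:~R)
    (\col_(i < g) (ival (nth gate0 gs i).1)%:~R)
    (\col_(i < g) (ival (nth gate0 gs i).2.1)%:~R))
    (\col_(i < g) (nat_of_bool (i == 0 :> nat))%:R) 0.

Lemma ival_sadd c d : ival (sadd c d) = ival c + ival d.
Proof. by rewrite /ival /= !PoszD; lia. Qed.

Lemma coefE l j : ival (coef l j) = \sum_(e <- l | e.1 == j) ival e.2.
Proof.
rewrite /coef; set f := (fun _ => _).
suff H c : ival (foldl f c l) = ival c + \sum_(e <- l | e.1 == j) ival e.2 by rewrite H add0r.
elim: l c => [|e l IH] c /=; first by rewrite big_nil addr0.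
by rewrite IH big_cons /f; case: ifP => _; rewrite ?ival_sadd ?addrA.
Qed.

Lemma coef_sum (R : numDomainType) g (l : seq (nat * sint)) (v : nat -> R) :
  (forall e, e \in l -> e.1 < g)%N ->
  \sum_(j < g) (ival (coef l j))%:~R * v j = \sum_(e <- l) (ival e.2)%:~R * v e.1.
Proof.
move=> Hl; rewrite (eq_bigr (fun j : 'I_g => \sum_(e <- l | e.1 == j) (ival e.2)%:~R * v e.1)); last first.
  move=> j _; rewrite coefE rmorph_sum mulr_suml; apply: eq_bigr => e /eqP ->.
  by [].
rewrite (exchange_big_dep predT) //= big_seq [RHS]big_seq; apply: eq_bigr => e /Hl le.
by rewrite (big_pred1 (Ordinal le)) // => j; rewrite -val_eqE eq_sym.
Qed.

Lemma coef_norm (R : numDomainType) l j : `|(ival (coef l j))%:~R| <= (weight l)%:R :> R.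
Proof.
rewrite coefE rmorph_sum; apply: le_trans (ler_norm_sum _ _ _) _.
rewrite /weight sumnE big_map natr_sum big_mkcond; apply: ler_sum => e _.
case: ifP => _; last by rewrite ler0n.
rewrite -intr_norm -[X in _ <= X]/((e.2.1 + e.2.2)%N%:Z%:~R) ler_int /ival; lia.
Qed.

Section Network.
Variables (R : realType) (gs : seq gate) (s : nat).
Local Notation g := (size gs).
Local Notation Q := (network_query gs s).
Hypothesis gs_ordered : forall i, (i < g)%N -> forall e, e \in (nth gate0 gs i).2.2 -> (e.1 < i)%N.
Hypothesis gs_weight : forall i, (i < g)%N -> (2 * weight (nth gate0 gs i).2.2 + 1 <= 2 ^ s)%N.

Definition pre (t : R) (v : nat -> R) (i : nat) : R :=
  (ival (nth gate0 gs i).2.1)%:~R - (ival (nth gate0 gs i).1)%:~R * t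
  - \sum_(e <- (nth gate0 gs i).2.2) (ival e.2)%:~R * v e.1.

Fixpoint values (t : R) (i : nat) : seq R :=
  if i is i'.+1 then rcons (values t i') (Num.max 0 (pre t (nth 0 (values t i')) i')) else [::].

Definition value (t : R) (i : nat) : R := nth 0 (values t i.+1) i.

Lemma size_values t i : size (values t i) = i.
Proof. by elim: i => //= i IH; rewrite size_rcons IH. Qed.

Lemma nth_values t i j : (j < i)%N -> nth 0 (values t i) j = value t j.
Proof.
elim: i => // i IH; rewrite ltnS leq_eqVlt => /orP [/eqP -> //|lt].
by rewrite /= nth_rcons size_values lt IH.
Qed.

Lemma valueE t i : (i < g)%N -> value t i = Num.max 0 (pre t (value t) i).
Proof.
move=> lt; rewrite /value /= nth_rcons size_values ltnn eqxx; congr (Num.max 0 (_ - _)).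
by apply: eq_big_seq => e /(gs_ordered lt) le; rewrite nth_values.
Qed.

Lemma row_sumE (v : 'cV[R]_g) (f : nat -> R) (i : 'I_g) (t : R) : (forall j : 'I_g, v j 0 = f j) ->
  (map_mx ratr (A11 (program Q)) *m v + t *: map_mx ratr (A12 (program Q))) i 0
    - map_mx ratr (b1 (program Q)) i 0 = f i - pre t f i.
Proof.
move=> Hv; rewrite lower_rowE /= !mxE !ratr_int /pre.
have -> : \sum_j ratr ((\matrix_(i, j) (ival (matrix_entry gs i j))%:~R) i j) * v j 0
   = f i + \sum_(e <- (nth gate0 gs i).2.2) (ival e.2)%:~R * f e.1.
  rewrite -(@coef_sum _ g); last first.
    by move=> e /(gs_ordered (ltn_ord i)) le; apply: ltn_trans le _.
  have -> : f i = \sum_(j < g) (i == j)%:R * f j.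
    rewrite (bigD1 i) //= eqxx mul1r big1 ?addr0 // => j ne.
    by rewrite eq_sym (negPf ne) mul0r.
  rewrite -big_split; apply: eq_bigr => j _ /=; rewrite mxE ratr_int Hv -mulrDl.
  by rewrite /matrix_entry ival_sadd rmorphD -val_eqE; case: (_ == _).
by lra.
Qed.

(** Let S be the sum of the |d j| and T the weighted sum over j < k. By induction T >= S, so W T + d
    k >= (2 C + 1) S + d k, and this is at least S + |d k| because a negative d k is at least - C
    S. *)
Lemma telescoped (C W : R) (d : nat -> R) k : 0 <= C -> 2 * C + 1 <= W ->
  (forall i, (i < k)%N -> - d i <= C * \sum_(j < i) `|d j|) ->
  \sum_(j < k) `|d j| <= \sum_(j < k) W ^+ (k - j.+1) * d j.
Proof.
move=> C0 HW; elim: k => [|k IH] H; first by rewrite !big_ord0.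
have {}IH := IH (fun i lt => H i (ltnW lt)).
rewrite !big_ord_recr /= subnn expr0 mul1r.
have -> : \sum_(j < k) W ^+ (k.+1 - j.+1) * d j = W * \sum_(j < k) W ^+ (k - j.+1) * d j.
  rewrite mulr_sumr; apply: eq_bigr => j _; rewrite mulrA -exprS; congr (_ ^+ _ * _).
  by have := ltn_ord j; lia.
have := H k (ltnSn k); set S := \sum_(j < k) `|d j| in IH *; set T := \sum_(j < k) _ in IH *.
have S0 : 0 <= S by apply: sumr_ge0.
move=> Hk; have h1 : W * S <= W * T by apply: ler_wpM2l => //; lra.
have h2 : (2 * C + 1) * S <= W * S by apply: ler_wpM2r.
have : `|d k| <= d k + 2 * (C * S).
  by rewrite ler_norml; apply/andP; split; have := mulr_ge0 C0 S0; lra.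
nra.
Qed.

Hypothesis value01 : forall t, 0 <= t <= 1 -> forall i, (i < g)%N -> value t i <= 1.

Definition value_vec (t : R) : 'cV[R]_g := \col_(i < g) value t i.

Lemma value_ge0 t i : (i < g)%N -> 0 <= value t i.
Proof. by move=> lt; rewrite valueE // le_max lexx. Qed.

Lemma value_vec_feasible t : 0 <= t <= 1 -> lower_feasible (program Q) t (value_vec t).
Proof.
move=> t01; split=> // [i|j].
  have := @row_sumE (value_vec t) (value t) i t (fun j => ltac:(by rewrite mxE)).
  move/eqP; rewrite -subr_ge0 => /eqP ->.
  by rewrite subr_ge0 [X in _ <= X]valueE // le_max lexx orbT.
by rewrite mxE value_ge0 //= value01.
Qed.

(** The excess cost dominates the l1 distance to the network state; optimality and uniqueness of
    that state both follow. *)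
Lemma lower_gap t x : lower_feasible (program Q) t x ->
  \sum_i `|x i 0 - value t i| <= dot (c11 (program Q)) x - dot (c11 (program Q)) (value_vec t).
Proof.
case=> [F1 F2 t01].
pose f (j : nat) : R := if insub j is Some i then x i 0 else 0.
have fE (j : 'I_g) : x j 0 = f j by rewrite /f valK.
pose d j := f j - value t j.
(* A variable falls below its gate value only as far as the errors of earlier variables lower its
   bound. The constant is the C with 2 C + 1 = 2 ^ s, and [gs_weight] bounds the coefficients by
   it. *)
have Hd i : (i < g)%N -> - d i <= ((2 ^ s)%:R - 1) / 2 * \sum_(j < i) `|d j|.
  move=> lt; have fi : f i = x (Ordinal lt) 0 by rewrite fE.
  have S0 : 0 <= \sum_(j < i) `|d j| by apply: sumr_ge0.
  have C0 : 0 <= ((2 ^ s)%:R - 1) / 2 :> R.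
    by rewrite divr_ge0 // subr_ge0 ler1n expn_gt0.
  have [ge0 _] := andP (F2 (Ordinal lt)); rewrite -fi in ge0.
  rewrite /d opprB valueE //; case: (leP (pre t (value t) i) 0) => hp.
    by rewrite sub0r; have := mulr_ge0 C0 S0; lra.
  have h := F1 (Ordinal lt); rewrite -subr_ge0 (row_sumE (Ordinal lt) t fE) in h.
  have : pre t (value t) i - f i <= pre t (value t) i - pre t f i by move: h; rewrite /=; lra.
  move/le_trans; apply; rewrite /pre opprB addrC addrA subrK -sumrB.
  rewrite -[X in X <= _]/(\sum_(e <- (nth gate0 gs i).2.2) _).
  have -> : \sum_(e <- (nth gate0 gs i).2.2) ((ival e.2)%:~R * f e.1 - (ival e.2)%:~R * value t e.1)
    = \sum_(j < i) (ival (coef (nth gate0 gs i).2.2 j))%:~R * d j.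
    rewrite coef_sum; last exact: gs_ordered.
    by apply: eq_bigr => e _; rewrite -mulrBr.
  rewrite mulr_sumr; apply: ler_sum => j _; apply: le_trans (ler_norm _) _.
  rewrite normrM; apply: ler_wpM2r => //; apply: le_trans (coef_norm _ _ _) _.
  have := gs_weight lt; rewrite -(ler_nat R) natrD natrM; lra.
have := @telescoped (((2 ^ s)%:R - 1) / 2) (2 ^ s)%:R d g.
have E1 : \sum_i `|x i 0 - value t i| = \sum_(j < g) `|d j|.
  by apply: eq_bigr => i _; rewrite fE.
have E2 : dot (c11 (program Q)) x - dot (c11 (program Q)) (value_vec t)
    = \sum_(j < g) (2 ^ s)%:R ^+ (g - j.+1) * d j.
  rewrite !dotE -sumrB; apply: eq_bigr => i _; rewrite -mulrBr !mxE fE; congr (_ * _).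
  by rewrite ratr_nat expnM -natrX.
rewrite E1 E2; apply => //; last by lra.
by rewrite divr_ge0 // subr_ge0 ler1n expn_gt0.
Qed.

Lemma value_vec_optimal t : 0 <= t <= 1 -> lower_optimal (program Q) t (value_vec t).
Proof.
move=> t01; split; first exact: value_vec_feasible.
by move=> x /lower_gap h; rewrite -subr_ge0; apply: le_trans h; apply: sumr_ge0.
Qed.

Lemma value_vec_unique t x : lower_optimal (program Q) t x -> x = value_vec t.
Proof.
move=> [Fx Ox]; have [_ _ t01] := Fx; have := Ox _ (value_vec_feasible t01).
rewrite -subr_le0 => h2; have {h2}h := le_trans (lower_gap Fx) h2.
apply/colP => i; apply/eqP; rewrite [X in _ == X]mxE -subr_eq0 -normr_le0.
apply: le_trans h; rewrite (bigD1 i) //= lerDl; exact: sumr_ge0.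
Qed.

(** The bilevel feasible pairs are exactly the network states, on which the upper objective is minus
    the last gate. The hypothesis on [value 0] identifies the queried point with the state at x2 =
    0. *)
Lemma network_optimal : (0 < g)%N -> (forall i, (i < g)%N -> value 0 i = (i == 0%N)%:R) -> (1 < g)%N ->
  query_optimal R Q <-> (forall t, 0 <= t <= 1 -> value t g.-1 <= 0).
Proof.
move=> g0 H0 g1.
have obj t : upper_objective (program Q) (value_vec t) t = - value t g.-1.
  rewrite /upper_objective dotE /= rmorph0 mul0r addr0.
  have lt : (g.-1 < g)%N by rewrite prednK.
  rewrite (bigD1 (Ordinal lt)) //= !mxE /= prednK // eqxx rmorphN rmorph1 mulN1r big1 ?addr0 //.
  move=> j ne; rewrite !mxE; case: eqP => [E|_]; last by rewrite rmorph0 mul0r.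
  by case/negP: ne; apply/eqP/val_inj => /=; apply: succn_inj; rewrite E prednK.
have E0 : map_mx ratr (point1 Q) = value_vec 0 :> 'cV[R]_g.
  by apply/colP => i; rewrite !mxE H0 // ratr_nat.
have z01 : 0 <= (0 : R) <= 1 by rewrite lexx ler01.
have v0 : value 0 g.-1 = 0 by rewrite H0 ?prednK //; case: (g) g1 => [|[|?]].
rewrite /query_optimal /bilevel_optimal /bilevel_feasible E0 /= rmorph0; split.
  case=> _ H t t01; have := H _ _ (value_vec_optimal t01).
  by rewrite !obj v0 oppr0 oppr_ge0.
move=> H; split; first exact: value_vec_optimal.
move=> x t Ox; have [[_ _ t01] _] := Ox.
by rewrite (value_vec_unique Ox) !obj v0 oppr0 oppr_ge0 H.
Qed.

End Network.

(** * Satisfiability as a network *)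

(* [(b, k)]: the variable k has the value b. *)
Definition literal : Type := bool * nat.
Definition clause : Type := seq literal.

Definition satisfying (tau : nat -> bool) (F : seq clause) : bool :=
  all (has (fun l : literal => tau l.2 == l.1)) F.

(* With u = min(1, 2 x2), the gates hold w = 1 - u, r_0 = max(0, 2 x2 - u),
   h_k = max(0, 2 r_k - u) and r_(k+1) = max(0, u + 4 h_k - 4 r_k). For u = 1 the
   map from r_k to r_(k+1) sends [0, 1/4] and [3/4, 1] onto [0, 1], so x2 can
   be chosen to make each r_k fall in the first interval (the variable k is
   false) or in the second one (it is true). *)
Definition gate_w : gate := ((2, 0), ((1, 0), [::]))%N.

(** Here, as in all gates, coefficients have the sign opposite to that in the affine function, being
    on the left-hand side of the constraint, and u is written 1 - w. Positions 2k - 1 and 2k hold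
    r_(k-1) and h_(k-1). *)
Definition gate_r (k : nat) : gate :=
  (if k == 0 then ((0, 2), ((0, 1), [:: (0, (0, 1))]))
   else ((0, 0), ((1, 0), [:: (2 * k, (0, 4)); (2 * k - 1, (4, 0)); (0, (1, 0))])))%N.

Definition gate_h (k : nat) : gate :=
  ((0, 0), ((0, 1), [:: (1 + 2 * k, (0, 2)); (0, (0, 1))]))%N.

(* 2 h_k and 2 h_k + 2 u - 4 r_k reach u only if the variable k is true,
   respectively false. *)
Definition literal_terms (l : literal) : seq (nat * sint) :=
  if l.1 then [:: ((2 + 2 * l.2)%N, (2, 0)%N)]
  else [:: ((2 + 2 * l.2)%N, (2, 0)%N); ((1 + 2 * l.2)%N, (0, 4)%N); (0%N, (0, 2)%N)].

(* The positive part of u minus the sum of the values of the literals. *)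
Definition gate_clause (C : clause) : gate :=
  ((0, 0)%N, ((1%N, size (flatten [seq if l.1 then [::] else [:: tt; tt] | l <- C])),
    (0%N, (1, 0)%N) :: flatten [seq literal_terms l | l <- C])).

(* The positive part of u minus the sum of the values of the clauses. *)
Definition gate_out (N c : nat) : gate :=
  ((0, 0)%N, ((1, 0)%N, (0%N, (1, 0)%N) :: [seq ((1 + 2 * N + i)%N, (1, 0)%N) | i <- iota 0 c])).

(* Position 0 holds w = 1 - u, positions 1 + 2k and 2 + 2k hold r_k and h_k,
   then come the clauses and the output. *)
Definition sat_gates (N : nat) (F : seq clause) : seq gate :=
  gate_w :: flatten [seq [:: gate_r k; gate_h k] | k <- iota 0 N]
  ++ [seq gate_clause C | C <- F] ++ [:: gate_out N (size F)].

(** Gate weights are linear in the size of the formula, so a base with linearly many bits is ample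
    for [sat_weight], and the costs keep polynomial length in binary. *)
Definition sat_shift (F : seq clause) : nat := (5 + size (flatten F) + size F)%N.

Definition sat_query (N : nat) (F : seq clause) : query :=
  network_query (sat_gates N F) (sat_shift F).

Section SatNetwork.
Variables (R : realType) (N : nat) (F : seq clause).
Hypothesis wfF : all (all (fun l : literal => l.2 < N)%N) F.
Local Notation gs := (sat_gates N F).
Local Notation g := (size gs).

Lemma size_pairs : size (flatten [seq [:: gate_r k; gate_h k] | k <- iota 0 N]) = (2 * N)%N.
Proof.
rewrite size_flatten /shape -map_comp sumnE big_map (eq_bigr (fun=> 2%N)) //.
by rewrite big_const_seq count_predT size_iota iter_addn_0.
Qed.

Lemma size_gates : g = (2 + 2 * N + size F)%N.
Proof. by rewrite /= !size_cat size_pairs size_map /=; lia. Qed.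

Lemma nth_pair k b : (k < N)%N -> (b < 2)%N ->
  nth gate0 gs (1 + (k * 2 + b)) = nth gate0 [:: gate_r k; gate_h k] b.
Proof.
move=> lk lb; rewrite /= nth_cat size_pairs.
have -> : (k * 2 + b < 2 * N)%N by lia.
rewrite nth_flatten_rows ?size_map ?size_iota //.
  by rewrite (nth_map 0%N) ?size_iota // nth_iota.
by move=> i Hi; rewrite (nth_map 0%N) ?size_iota.
Qed.

Lemma nth_r k : (k < N)%N -> nth gate0 gs (1 + 2 * k) = gate_r k.
Proof. by move=> lk; rewrite -[RHS](nth_pair (b := 0%N) lk) // addn0 mulnC. Qed.

Lemma nth_h k : (k < N)%N -> nth gate0 gs (2 + 2 * k) = gate_h k.
Proof.
by move=> lk; rewrite -[RHS](nth_pair (b := 1%N) lk) //; congr nth; lia.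
Qed.

Lemma nth_clause c : (c < size F)%N -> nth gate0 gs (1 + 2 * N + c) = gate_clause (nth [::] F c).
Proof.
move=> lc; rewrite -addnA /= nth_cat size_pairs ltnNge leq_addr /= add0n addKn.
by rewrite nth_cat size_map lc (nth_map [::]).
Qed.

Lemma nth_out : nth gate0 gs (1 + 2 * N + size F) = gate_out N (size F).
Proof.
rewrite -addnA /= nth_cat size_pairs ltnNge leq_addr /= add0n addKn.
by rewrite nth_cat size_map ltnn subnn.
Qed.

Inductive position : nat -> Prop :=
  | PosW : position 0
  | PosR k : (k < N)%N -> position (1 + 2 * k)
  | PosH k : (k < N)%N -> position (2 + 2 * k)
  | PosC c : (c < size F)%N -> position (1 + 2 * N + c)
  | PosO : position (1 + 2 * N + size F).

Lemma positionP i : (i < g)%N -> position i.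
Proof.
rewrite size_gates => lt; case: (posnP i) => [->|i0]; first exact: PosW.
have [h|h] := leqP i (2 * N).
  case: (boolP (odd i)) => oi.
    have -> : i = (1 + 2 * i./2)%N by lia.
    by apply: PosR; lia.
  have -> : i = (2 + 2 * (i./2).-1)%N by lia.
  by apply: PosH; lia.
have [h'|h'] := ltnP (i - (1 + 2 * N)) (size F).
  by rewrite -(subnKC h); apply: PosC.
have -> : i = (1 + 2 * N + size F)%N by lia.
exact: PosO.
Qed.

Lemma clause_lt c l : (c < size F)%N -> l \in nth [::] F c -> (l.2 < N)%N.
Proof. by move=> lc; move/allP: wfF => /(_ _ (mem_nth [::] lc)) /allP; apply. Qed.

Lemma sat_ordered i : (i < g)%N -> forall e, e \in (nth gate0 gs i).2.2 -> (e.1 < i)%N.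
Proof.
move=> /positionP [|k lk|k lk|c lc|] e.
- by [].
- rewrite nth_r // /gate_r; case: eqP => [->|/eqP k0]; rewrite !inE.
    by move=> /eqP -> /=.
  by move=> /or3P [] /eqP -> /=; lia.
- by rewrite nth_h // !inE => /orP [] /eqP -> /=; lia.
- rewrite nth_clause // inE => /orP [/eqP -> //|/flatten_mapP [[b k] /(clause_lt lc) /= lt]].
  rewrite /literal_terms; case: ifP => _; rewrite !inE; first by move=> /eqP -> /=; lia.
  by move=> /or3P [] /eqP -> /=; lia.
- rewrite nth_out inE => /orP [/eqP -> //|/mapP [j]]; rewrite mem_iota => /= lj -> /=; lia.
Qed.

Lemma weight_cat l l' : weight (l ++ l') = (weight l + weight l')%N.
Proof. by rewrite /weight map_cat sumn_cat. Qed.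

Lemma sat_weight i : (i < g)%N -> (2 * weight (nth gate0 gs i).2.2 + 1 <= 2 ^ sat_shift F)%N.
Proof.
have big a : (a <= 8 * (size (flatten F) + size F) + 9 -> 2 * a + 1 <= 2 ^ sat_shift F)%N.
  move=> le; rewrite /sat_shift -addnA expnD.
  have := ltn_expl (size (flatten F) + size F) (isT : (1 < 2)%N); lia.
move=> /positionP [|k lk|k lk|c lc|]; apply: big.
- by [].
- by rewrite nth_r // /gate_r; case: eqP => _; rewrite /weight /=; lia.
- by rewrite nth_h // /weight /=; lia.
- rewrite nth_clause //= -cat1s weight_cat.
  have h : (size (nth [::] F c) <= size (flatten F))%N.
    by have := size_flatten_nth id [::] lc; rewrite map_id.
  have : (weight (flatten [seq literal_terms l | l <- nth [::] F c]) <= 8 * size (nth [::] F c))%N.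
    elim: (nth [::] F c) => //= l C IH; rewrite weight_cat mulnS leq_add //.
    by rewrite /literal_terms; case: ifP => _; rewrite /weight /=.
  have -> : weight [:: (0, (1, 0))%N] = 1%N by [].
  by move: h; lia.
- rewrite nth_out /= -cat1s weight_cat.
  have -> : weight [seq ((1 + 2 * N + i)%N, (1, 0)%N) | i <- iota 0 (size F)] = size F.
    rewrite /weight -map_comp sumnE big_map (eq_bigr (fun=> 1%N)) //.
    by rewrite big_const_seq count_predT size_iota iter_addn_0 mul1n.
  have -> : weight [:: (0, (1, 0))%N] = 1%N by [].
  by lia.
Qed.

Section Values.
Variable t : R.
Hypothesis t01 : 0 <= t <= 1.
Local Notation V := (value gs t).
Local Notation u := (1 - V 0%N).
Local Notation r k := (V (1 + 2 * k)%N).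
Local Notation h k := (V (2 + 2 * k)%N).

Definition literal_value (l : literal) : R :=
  if l.1 then 2 * h l.2 else 2 * h l.2 - 4 * r l.2 + 2 * u.

Lemma valE i : (i < g)%N -> V i = Num.max 0 (pre gs t V i).
Proof. exact: valueE sat_ordered _ _. Qed.

Lemma lt_g i : (i < 2 + 2 * N + size F)%N -> (i < g)%N.
Proof. by rewrite size_gates. Qed.

Lemma value_w : V 0%N = Num.max 0 (1 - 2 * t).
Proof.
rewrite valE; last by apply: lt_g; lia.
by rewrite /pre /= big_nil; congr Num.max; rewrite /ival /=; lra.
Qed.

Lemma value_r0 : (0 < N)%N -> r 0%N = Num.max 0 (2 * t - u).
Proof.
move=> N0; rewrite valE; last by apply: lt_g; lia.
rewrite /pre nth_r // /gate_r /= big_cons big_nil /=.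
by congr Num.max; rewrite /ival /=; lra.
Qed.

Lemma value_rS k : (k.+1 < N)%N -> r k.+1 = Num.max 0 (4 * h k - 4 * r k + u).
Proof.
move=> lk; rewrite valE; last by apply: lt_g; lia.
rewrite /pre nth_r // /gate_r /= !big_cons big_nil /=.
have -> : (2 * k.+1 = 2 + 2 * k)%N by lia.
have -> : (2 + 2 * k - 1 = 1 + 2 * k)%N by lia.
by congr Num.max; rewrite /ival /=; lra.
Qed.

Lemma value_h k : (k < N)%N -> h k = Num.max 0 (2 * r k - u).
Proof.
move=> lk; rewrite valE; last by apply: lt_g; lia.
rewrite /pre nth_h // /gate_h /= !big_cons big_nil /=.
by congr Num.max; rewrite /ival /=; lra.
Qed.

Lemma value_clause c : (c < size F)%N ->
  V (1 + 2 * N + c)%N = Num.max 0 (u - \sum_(l <- nth [::] F c) literal_value l).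
Proof.
move=> lc; rewrite valE; last by apply: lt_g; lia.
rewrite /pre nth_clause // /gate_clause /= big_cons /=; congr Num.max.
(* A negative literal contains 2 u = 2 - 2 w; these constants 2 are gathered in the bound of the
   gate, where they are counted in unary as the size of a list of units. *)
have -> : \sum_(l <- nth [::] F c) literal_value l =
    (size (flatten [seq if l.1 then [::] else [:: tt; tt] | l <- nth [::] F c]))%:R
    + \sum_(e <- flatten [seq literal_terms l | l <- nth [::] F c]) (ival e.2)%:~R * V e.1.
  elim: (nth [::] F c) => [|l C IH] /=; first by rewrite !big_nil addr0.
  rewrite big_cons IH big_cat /= size_cat natrD /literal_value /literal_terms.
  by case: ifP => _; rewrite !big_cons big_nil /ival /=; lra.
by rewrite /ival /= rmorphB /= -!pmulrn; lra.
Qed.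

Lemma value_out : V (1 + 2 * N + size F)%N =
  Num.max 0 (u - \sum_(c < size F) V (1 + 2 * N + c)%N).
Proof.
rewrite valE; last by apply: lt_g; lia.
rewrite /pre nth_out /gate_out /= big_cons big_map /=; congr Num.max.
have -> : \sum_(c < size F) V (1 + 2 * N + c)%N
    = \sum_(j <- iota 0 (size F)) (ival (1, 0)%N)%:~R * V (1 + 2 * N + j)%N.
  rewrite -val_enum_ord big_map big_enum /=.
  by apply: eq_bigr => i _; rewrite /ival /= mul1r.
by rewrite /ival /=; lra.
Qed.

Lemma u01 : 0 <= u <= 1.
Proof. by rewrite value_w; case/andP: t01 => t0 t1; case: (leP (1 - 2 * t) 0) => ?; lra. Qed.

Lemma bits_bound k : (k < N)%N -> 0 <= r k <= u /\ 0 <= h k <= u.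
Proof.
have Hh j : (j < N)%N -> 0 <= r j <= u -> 0 <= h j <= u.
  by move=> lj; rewrite value_h //; case: (leP (2 * r j - u) 0) => ?; case/andP: u01; lra.
elim: k => [|k IH] lk.
  have Hr : 0 <= r 0%N <= u.
    rewrite value_r0 //; case/andP: t01 => t0 t1; move: value_w u01 => ->.
    by case: (leP (1 - 2 * t) 0) => ?; case: (leP _ 0) => ?; lra.
  by split=> //; apply: Hh.
have [Hr _] := IH (ltnW lk).
have Hr' : 0 <= r k.+1 <= u.
  rewrite value_rS // value_h; last exact: ltnW.
  by case: (leP (2 * r k - u) 0) => ?; case: (leP _ 0) => ?; case/andP: u01; lra.
by split=> //; apply: Hh.
Qed.

Lemma literal_value_ge0 l : (l.2 < N)%N -> 0 <= literal_value l.
Proof.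
move=> lt; have [Hr Hh] := bits_bound lt; rewrite /literal_value; case: ifP => _; first by lra.
by rewrite value_h //; case: (leP (2 * r l.2 - u) 0) => ?; lra.
Qed.

(** This keeps the gates within the bounds of the program and makes them vanish at x2 = 0, where u =
    0. *)
Lemma values_bound i : (0 < i)%N -> (i < g)%N -> V i <= u.
Proof.
move=> i0 /positionP H; have /andP [u0 _] := u01.
have max_le x : x <= u -> Num.max 0 x <= u by rewrite ge_max u0.
case: H i0 => [|k lk|k lk|c lc|] // _.
- by have [/andP []] := bits_bound lk.
- by have [_ /andP []] := bits_bound lk.
- rewrite value_clause //; apply: max_le; rewrite gerBl big_seq; apply: sumr_ge0 => l lC.
  exact: literal_value_ge0 (clause_lt lc lC).
- rewrite value_out; apply: max_le; rewrite gerBl; apply: sumr_ge0 => c _.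
  by rewrite value_clause // le_max lexx.
Qed.

(** Valid for every x2, even if some r_k lies between the two intervals: reading variable k as h_k >
    0, an unsatisfied literal is worth exactly 0, since a positive h_k equals 2 r_k - u. An
    unsatisfied clause is thus worth u and cancels the output. *)
Lemma sat_of_value : 0 < V (1 + 2 * N + size F)%N ->
  satisfying (fun k => 0 < h k) F.
Proof.
move=> out0; have lt_out : (1 + 2 * N + size F < g)%N by rewrite size_gates; lia.
have u0 : 0 < u by apply: lt_le_trans out0 (values_bound _ lt_out).
apply/(all_nthP [::]) => c lc; apply/negPn/negP => /hasPn nsat.
have Hc : V (1 + 2 * N + c)%N = u.
  rewrite value_clause // big_seq big1 ?subr0; last first.
    move=> l lC; have := nsat l lC; have lt := clause_lt lc lC.
    have [Hr Hh] := bits_bound lt; move: Hr Hh; rewrite /literal_value value_h //.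
    by case: l lt lC => [[] k] /= lt lC; case: (leP (2 * r k - u) 0) => hk;
      rewrite ?ltxx ?hk //=; lra.
  by apply: max_r; apply: ltW.
move: out0; rewrite value_out (bigD1 (Ordinal lc)) //= Hc lt_max ltxx /= subr_gt0 gtrDl.
rewrite ltNge sumr_ge0 // => j _; rewrite value_clause // le_max lexx //.
Qed.

End Values.

(** The two inverse branches of the expanding map, composed backwards from 0: the orbit of this
    point visits the intervals prescribed by [tau]. *)
Fixpoint rho (tau : nat -> bool) (k n : nat) : R :=
  if n is n'.+1 then
    let x := rho tau k.+1 n' in if tau k then (3 + x) / 4 else (1 - x) / 4
  else 0.

Lemma rho01 tau k n : 0 <= rho tau k n <= 1.
Proof. by elim: n k => [|n IH] k /=; [lra|have := IH k.+1; case: ifP => _; lra]. Qed.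

Lemma value_of_sat tau : satisfying tau F ->
  exists2 t : R, 0 <= t <= 1 & 0 < value gs t (1 + 2 * N + size F).
Proof.
(* For x2 >= 1/2 one has u = 1 and r_0 = 2 x2 - 1, so this choice makes r_0 equal to
   [rho tau 0 N]. *)
move=> sat; pose t := (rho tau 0 N + 1) / 2.
have t01 : 0 <= t <= 1 by have := rho01 tau 0 N; rewrite /t; lra.
exists t => //.
have Vw : value gs t 0 = 0.
  rewrite value_w //; apply: max_l; rewrite /t; have := rho01 tau 0 N; lra.
have Vh k : (k < N)%N -> value gs t (1 + 2 * k) = rho tau k (N - k) ->
    value gs t (2 + 2 * k) = if tau k then 2 * rho tau k (N - k) - 1 else 0.
  move=> lk Er; rewrite value_h // Er Vw subr0.
  have -> : (N - k = (N - k.+1).+1)%N by lia.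
  have := rho01 tau k.+1 (N - k.+1); rewrite /=.
  by case: (tau k) => Hx; case: (leP _ 0) => ?; lra.
have Vr k : (k < N)%N -> value gs t (1 + 2 * k) = rho tau k (N - k).
  elim: k => [|k IH] lk.
    rewrite value_r0 // Vw subn0 /t; have := rho01 tau 0 N.
    by case: (leP _ 0) => ?; lra.
  have Ek := IH (ltnW lk); rewrite value_rS // Vh // ?(ltnW lk) // Ek Vw.
  have := rho01 tau k.+1 (N - k.+1).
  have -> : (N - k = (N - k.+1).+1)%N by lia.
  by rewrite /=; case: (tau k) => Hx; case: (leP _ 0) => ?; lra.
have Vl l : (l.2 < N)%N -> tau l.2 == l.1 -> 1 <= literal_value t l.
  case: l => b k /= lk; rewrite /literal_value /= Vh ?Vr // Vw.
  have := rho01 tau k.+1 (N - k.+1).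
  have -> : (N - k = (N - k.+1).+1)%N by lia.
  by case: b; rewrite /=; case: (tau k) => //= Hx _; lra.
rewrite value_out // Vw big1 ?subr0; first by rewrite lt_max ltr01 orbT.
move=> c _; rewrite value_clause // Vw subr0; apply: max_l.
have /hasP [l lC sl] := allP sat _ (mem_nth [::] (ltn_ord c)).
rewrite subr_le0 (big_rem l) //=; apply: le_trans (Vl l (clause_lt (ltn_ord c) lC) sl) _.
rewrite lerDl big_seq; apply: sumr_ge0 => l' /mem_rem lC'.
exact: literal_value_ge0 (clause_lt (ltn_ord c) lC').
Qed.

Lemma sat_queryP : query_optimal R (sat_query N F) <-> ~ (exists tau, satisfying tau F).
Proof.
have g1 : (1 < g)%N by rewrite size_gates; lia.
have z01 : 0 <= (0 : R) <= 1 by rewrite lexx ler01.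
have Hg : g.-1 = (1 + 2 * N + size F)%N by rewrite size_gates.
rewrite /sat_query network_optimal ?Hg //.
- split=> [H [tau /value_of_sat [t t01]]|H t t01]; first by rewrite ltNge H.
  rewrite leNgt; apply/negP => /(sat_of_value t01) sat; apply: H; eexists; exact: sat.
- exact: sat_ordered.
- exact: sat_weight.
- move=> t t01 i lt; case: (posnP i) => [->|i0].
    by have := u01 t01; lra.
  by apply: le_trans (values_bound t01 i0 lt) _; have := u01 t01; lra.
move=> i lt; have V0 : value gs (0 : R) 0 = 1.
  by rewrite value_w // mulr0 subr0; apply: max_r; lra.
case: (posnP i) => [->|i0]; first by rewrite V0.
have := values_bound z01 i0 lt; rewrite V0 subrr => le0.
by apply/eqP; rewrite eq_le le0 valE // le_max lexx.
Qed.

End SatNetwork.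

(* Computing the encoding of the network program *)
Local Close Scope ring_scope.

(** One of the two truncated differences is 0, so their sum is the absolute value. *)
Definition stoken (c : sint) : rtoken :=
  (~~ (c.2 <= c.1), (Bn ((c.1 - c.2) + (c.2 - c.1)), Bn 1)).

Lemma stokenE c : rtoken_of (ival c)%:~R = stoken c.
Proof.
rewrite /rtoken_of numq_int denq_int /stoken /ival; congr (_, (Bn _, _)); last by lia.
by apply/idP/idP; lia.
Qed.

Definition raw_network (gs : seq gate) (s : nat) : seq rtoken :=
  let g := size gs in
  [seq (false, (Bn (2 ^ (s * (g - i.+1))), Bn 1)) | i <- iota 0 g]
  ++ [seq stoken (if i.+1 == g then (0, 1) else (0, 0)) | i <- iota 0 g]
  ++ stoken (0, 0)
  :: flatten [seq [seq stoken (matrix_entry gs i j) | j <- iota 0 g] | i <- iota 0 g]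
  ++ [seq stoken (nth gate0 gs i).1 | i <- iota 0 g]
  ++ [seq stoken (nth gate0 gs i).2.1 | i <- iota 0 g]
  ++ [seq stoken (if i == 0 then (1, 0) else (0, 0)) | i <- iota 0 g]
  ++ [:: stoken (0, 0)].

Lemma col_entries_iota g (f : nat -> rat) :
  col_entries (\col_(i < g) f i)%R = [seq f i | i <- iota 0 g].
Proof. by rewrite /col_entries -val_enum_ord -map_comp; apply: eq_map => i /=; rewrite mxE. Qed.

Lemma mx_entries_iota g h (f : nat -> nat -> rat) :
  mx_entries (\matrix_(i < g, j < h) f i j)%R = flatten [seq [seq f i j | j <- iota 0 h] | i <- iota 0 g].
Proof.
rewrite /mx_entries -[iota 0 g]val_enum_ord -map_comp; congr flatten; apply: eq_map => i /=.
by rewrite -val_enum_ord -map_comp; apply: eq_map => j /=; rewrite mxE.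
Qed.

Lemma raw_networkE gs s : raw_entries (network_query gs s) = raw_network gs s.
Proof.
rewrite /raw_entries /query_entries /raw_network /=.
rewrite (col_entries_iota _ (fun i => (2 ^ (s * (size gs - i.+1)))%:R)%R).
rewrite (col_entries_iota _ (fun i => if i.+1 == size gs then -1 else 0)%R).
rewrite (mx_entries_iota _ _ (fun i j => (ival (matrix_entry gs i j))%:~R)%R).
rewrite (col_entries_iota _ (fun i => (ival (nth gate0 gs i).1)%:~R)%R).
rewrite (col_entries_iota _ (fun i => (ival (nth gate0 gs i).2.1)%:~R)%R).
rewrite (col_entries_iota _ (fun i => (i == 0%N)%:R)%R).
have E0 : rtoken_of 0%R = stoken (0, 0) by rewrite -stokenE.
have E1 : rtoken_of (-1)%R = stoken (0, 1) by rewrite -stokenE.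
have E2 : rtoken_of 1%R = stoken (1, 0) by rewrite -stokenE.
rewrite -cat1s -[X in _ = _ ++ _ ++ X]cat1s !map_cat -!map_comp map_flatten -!map_comp /= E0.
congr (_ ++ _); [|congr (_ ++ _); [|congr (_ :: _); congr (_ ++ _); [|congr (_ ++ _); [|congr (_ ++ _); [|congr (_ ++ _)]]]]].
- apply: eq_map => i /=; rewrite /rtoken_of -[(_ : nat)%:R%R]/((2 ^ (s * (size gs - i.+1)))%:Z%:~R)%R.
  by rewrite numq_int denq_int.
- by apply: eq_map => i /=; case: ifP => _; rewrite ?E0 ?E1.
- congr flatten; apply: eq_map => i /=; rewrite -map_comp; apply: eq_map => j /=.
  exact: stokenE.
- by apply: eq_map => i /=; exact: stokenE.
- by apply: eq_map => i /=; exact: stokenE.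
- by apply: eq_map => i /=; case: eqP => _; rewrite ?E0 ?E2.
Qed.

Lemma PT_stoken X {cX : coded X} (c : X -> sint) : PT c -> PT (fun x => stoken (c x)).
Proof. by apply: PT_app1; rewrite /stoken; pt. Qed.

Lemma csz_sadd c d : csz (sadd c d) <= csz c + csz d.
Proof. by rewrite !csz_pair !csz_nat /=; lia. Qed.

Lemma PT_coef X {cX : coded X} (l : X -> seq (nat * sint)) (j : X -> nat) : PT l -> PT j ->
  PT (fun x => coef (l x) (j x)).
Proof.
apply: PT_app2; rewrite /coef.
apply: (PT_foldl_incr (s := fun z e c => if e.1 == z.2 then sadd c e.2 else c) (q := id)).
- by pbd.
- by pt.
- by pt.
- by rewrite /sadd; pt.
- move=> z e c; case: ifP => _; last by rewrite leq_addr.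
  apply: leq_trans (csz_sadd _ _) _; rewrite leq_add2l.
  by apply: leq_trans (leq_addl _ _); rewrite (csz_pair e) /=; lia.
Qed.

Lemma PT_matrix_entry X {cX : coded X} (gs : X -> seq gate) (i j : X -> nat) : PT gs -> PT i -> PT j ->
  PT (fun x => matrix_entry (gs x) (i x) (j x)).
Proof.
apply: PT_app3; rewrite /matrix_entry /sadd.
have H : PT (fun z : seq gate * (nat * nat) => coef (nth gate0 z.1 z.2.1).2.2 z.2.2).
  by apply: PT_coef; pt.
by pt; apply: H.
Qed.

Ltac pt_user5 := lazymatch goal with
  | |- PT (fun x => stoken _) => apply: PT_stoken
  | |- PT (fun x => matrix_entry _ _ _) => apply: PT_matrix_entry
  | |- _ => pt_user4
  end.
Ltac pt_user ::= pt_user5.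

Lemma PT_raw_network X {cX : coded X} (gs : X -> seq gate) (s : X -> nat) : PT gs -> PT s ->
  PT (fun x => raw_network (gs x) (s x)).
Proof. by apply: PT_app2; rewrite /raw_network; pt. Qed.

Lemma PT_sat_gates X {cX : coded X} (N : X -> nat) (F : X -> seq clause) : PT N -> PT F ->
  PT (fun x => sat_gates (N x) (F x)).
Proof.
apply: PT_app2.
by rewrite /sat_gates /gate_r /gate_h /gate_clause /gate_out /literal_terms; pt.
Qed.

Lemma PT_encode_sat_query X {cX : coded X} (N : X -> nat) (F : X -> seq clause) : PT N -> PT F ->
  PT (fun x => encode_query (sat_query (N x) (F x))).
Proof.
apply: (PT_app2 (g := fun N F => encode_query (sat_query N F)));
  apply: (PT_ext (f := fun z => encode_raw (Bn (size (sat_gates z.1 z.2)))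
   (Bn (size (sat_gates z.1 z.2))) (raw_network (sat_gates z.1 z.2) (sat_shift z.2)))).
  by move=> z; rewrite encode_queryE raw_networkE.
have Hg : PT (fun z : nat * seq clause => sat_gates z.1 z.2) by apply: PT_sat_gates; pt.
have Hs : PT (fun z : nat * seq clause => sat_shift z.2) by rewrite /sat_shift; pt.
apply: PT_encode_raw; [by apply: PT_Bn; apply: PT_size_seq|by apply: PT_Bn; apply: PT_size_seq|].
exact: PT_raw_network.
Qed.

(** * The tableau of a machine as a formula *)

Definition horn (ps : seq nat) (c : nat) : clause := [seq (false, v) | v <- ps] ++ [:: (true, c)].

Lemma hornE tau ps c : has (fun l : literal => tau l.2 == l.1) (horn ps c) = (all tau ps ==> tau c).
Proof.
rewrite /horn has_cat has_map /= eqb_id orbF implybE; congr (_ || _).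
by rewrite -has_predC; apply: eq_has => v /=; rewrite eqbF_neg.
Qed.

(* Cells are numbered relatively to the head. *)
Definition cell (S : finType) (t : tape S) (z : int) : symbol S :=
  match z with Posz k => nth None (tright t) k | Negz k => nth None (tleft t) k end.

Definition shift (d : move) : int :=
  match d with MoveLeft => -1 | Stay => 0 | MoveRight => 1 end.

Lemma nth_behead (T : Type) (x0 : T) s k : nth x0 (behead s) k = nth x0 s k.+1.
Proof. by case: s => //=; rewrite nth_nil. Qed.

Lemma cell_act (S : finType) (t : tape S) w d z :
  cell (act (w, d) t) z = if (z + shift d == 0)%R then w else cell t (z + shift d)%R.
Proof.
case: t => l r; rewrite /act /=; case: d => /=.
- case: z => [[|[|k]]|k] /=.
  + by case: l.
  + by [].
  + by rewrite nth_behead subn1.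
  + by rewrite nth_behead addn0.
- rewrite addr0; case: z => [[|k]|k] //=; by rewrite nth_behead.
- case: z => [k|[|k]] /=.
  + have -> : (k%:Z + 1 == 0)%R = false by lia.
    by rewrite nth_behead addn1.
  + by [].
  + by rewrite subn1.
Qed.

Section Tableau.
Variable M : machine.
Local Notation S := (symbol (extra M)).
Local Notation Q := (state M).
Local Notation nI := (ntapes M).+1.
Local Notation nS := #|S|.
Local Notation nA := (nS + #|Q|).

Definition sym_rank (s : S) : nat := enum_rank s.
Definition state_rank (q : Q) : nat := enum_rank q.

Lemma sym_rank_lt s : sym_rank s < nS. Proof. exact: ltn_ord. Qed.
Lemma sym_rank_ltA s : sym_rank s < nA. Proof. exact: leq_trans (ltn_ord _) (leq_addr _ _). Qed.
Lemma state_rank_ltA s : state_rank s < nA. Proof. exact: leq_trans (ltn_ord _) (leq_addl _ _). Qed.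

Lemma sym_rank_inj : injective sym_rank.
Proof. by move=> a b /val_inj /enum_rank_inj. Qed.
Lemma state_rank_inj : injective state_rank.
Proof. by move=> a b /val_inj /enum_rank_inj. Qed.

(* The variable "at time t, the cell k of the tape i holds a"; the head is on
   the cell B. The tape nI holds the state. *)
Definition tableau_var (B t k i a : nat) : nat :=
  ((t * (2 * B + 1) + k) * nI.+1 + i) * nA + a.

Definition next_state (q : Q) (s : {ffun 'I_nI -> S}) : Q :=
  if halted q then q else (delta q s).1.
Definition next_action (q : Q) (s : {ffun 'I_nI -> S}) (i : 'I_nI) : S * move :=
  if halted q then (s i, Stay) else (delta q s).2 i.

Definition move_code (d : move) : nat := match d with MoveLeft => 0 | Stay => 1 | MoveRight => 2 end.

(* A state, the next state and, for each tape i, the tuple (i, the scanned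
   symbol, the written symbol, the code of the move). *)
Definition rule : Type := nat * (nat * seq (nat * (nat * (nat * nat)))).

Definition rule_of (qs : Q * {ffun 'I_nI -> S}) : rule :=
  (state_rank qs.1, (state_rank (next_state qs.1 qs.2),
   [seq (val i, (sym_rank (qs.2 i), (sym_rank (next_action qs.1 qs.2 i).1,
      move_code (next_action qs.1 qs.2 i).2))) | i <- enum 'I_nI])).

(** This table depends on the machine alone, so it is a constant of the reduction. *)
Definition rules : seq rule := [seq rule_of qs | qs <- enum {: Q * {ffun 'I_nI -> S}}].

Definition premises (B t : nat) (r : rule) : seq nat :=
  tableau_var B t 0 nI r.1 :: [seq tableau_var B t B e.1 e.2.1 | e <- r.2.2].

(* The move d shifts the tape by [move_code d - 1] with respect to the head. *)
Definition cell_clauses (B t : nat) (r : rule) (e : nat * (nat * (nat * nat))) (k : nat) : seq clause :=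
  if k + e.2.2.2 == B.+1 then [:: horn (premises B t r) (tableau_var B t.+1 k e.1 e.2.2.1)]
  else [seq horn (tableau_var B t (k + e.2.2.2 - 1) e.1 a :: premises B t r) (tableau_var B t.+1 k e.1 a)
       | a <- iota 0 nS].

(** The cells 0 and 2 B may receive a symbol from outside the window, so only the cells 1 to 2 B - 1
    are propagated. *)
Definition step_clauses (B t : nat) : seq clause :=
  flatten [seq horn (premises B t r) (tableau_var B t.+1 0 nI r.2.1) ::
     flatten [seq flatten [seq cell_clauses B t r e k.+1 | k <- iota 0 (2 * B - 1)] | e <- r.2.2]
  | r <- rules].

Definition rank_blank : nat := sym_rank None.
Definition rank_bit (b : bool) : nat := sym_rank (bit (extra M) b).

Definition input_rank (x : seq bool) (j : nat) : nat :=
  if j.+1 <= size x then (if nth false x j then rank_bit true else rank_bit false) else rank_blank.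

(* The cells B, ..., B + L - 1 of the tape 1 are left free: they hold some bits
   followed by blanks only. *)
Definition init_cell (x : seq bool) (B L k i : nat) : seq clause :=
  if (i == 1) && ((B <= k) && (k.+1 <= B + L)) then
    [:: [:: (true, tableau_var B 0 k 1 (rank_bit true)); (true, tableau_var B 0 k 1 (rank_bit false));
            (true, tableau_var B 0 k 1 rank_blank)];
        horn [:: tableau_var B 0 k 1 rank_blank] (tableau_var B 0 k.+1 1 rank_blank)]
  else [:: [:: (true, tableau_var B 0 k i
    (if (i == 0) && (B <= k) then input_rank x (k - B) else rank_blank))]].

Definition init_clauses (x : seq bool) (B L : nat) : seq clause :=
  [:: (true, tableau_var B 0 0 nI (state_rank (start M)))] ::
  flatten [seq flatten [seq init_cell x B L k i | i <- iota 0 nI] | k <- iota 0 (2 * B + 1)].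

Definition accept_clauses (B T : nat) : seq clause :=
  flatten [seq (if a == rank_bit true then [::] else [:: [:: (false, tableau_var B T B 0 a)]]) | a <- iota 0 nS].

(** No clause says that a cell holds only one symbol: the step clauses are implications that force
    every fact of the actual run to be true, and acceptance forbids all output symbols but one. With
    [T + L] cells on each side, [T] steps leave the scanned cell under control and the [L] free
    cells fit. *)
Definition tableau (x : seq bool) (T L : nat) : seq clause :=
  init_clauses x (T + L) L ++ flatten [seq step_clauses (T + L) t | t <- iota 0 T]
  ++ accept_clauses (T + L) T.

Lemma PT_var X {cX : coded X} (B t k i a : X -> nat) : PT B -> PT t -> PT k -> PT i -> PT a ->
  PT (fun x => tableau_var (B x) (t x) (k x) (i x) (a x)).
Proof. by move=> hB ht hk hi ha; rewrite /tableau_var; pt. Qed.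

Ltac pt_user6 := lazymatch goal with
  | |- PT (fun x => tableau_var _ _ _ _ _) => apply: PT_var
  | |- _ => pt_user5
  end.
Ltac pt_user ::= pt_user6.

Lemma PT_premises X {cX : coded X} (B t : X -> nat) (r : X -> rule) : PT B -> PT t -> PT r ->
  PT (fun x => premises (B x) (t x) (r x)).
Proof. by apply: PT_app3; rewrite /premises; pt. Qed.

Lemma PT_horn X {cX : coded X} (ps : X -> seq nat) (c : X -> nat) : PT ps -> PT c ->
  PT (fun x => horn (ps x) (c x)).
Proof. by apply: PT_app2; rewrite /horn; pt. Qed.

Ltac pt_user7 := lazymatch goal with
  | |- PT (fun x => premises _ _ _) => apply: PT_premises
  | |- PT (fun x => horn _ _) => apply: PT_horn
  | |- _ => pt_user6
  end.
Ltac pt_user ::= pt_user7.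

Lemma PT_cell_clauses X {cX : coded X} (B t : X -> nat) (r : X -> rule)
    (e : X -> nat * (nat * (nat * nat))) (k : X -> nat) :
  PT B -> PT t -> PT r -> PT e -> PT k ->
  PT (fun x => cell_clauses (B x) (t x) (r x) (e x) (k x)).
Proof.
move=> hB ht hr he hk.
apply: (PT_app4 (g := fun B t r (z : (nat * (nat * (nat * nat))) * nat) => cell_clauses B t r z.1 z.2)
  _ hB ht hr (PT_pair he hk)).
by rewrite /cell_clauses; pt.
Qed.

Lemma PT_step_clauses X {cX : coded X} (B t : X -> nat) : PT B -> PT t ->
  PT (fun x => step_clauses (B x) (t x)).
Proof.
apply: PT_app2; rewrite /step_clauses.
by pt; apply: PT_cell_clauses; pt.
Qed.

Lemma PT_init_clauses X {cX : coded X} (x : X -> seq bool) (B L : X -> nat) : PT x -> PT B -> PT L ->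
  PT (fun z => init_clauses (x z) (B z) (L z)).
Proof. by apply: PT_app3; rewrite /init_clauses /init_cell /input_rank; pt. Qed.

Lemma PT_accept_clauses X {cX : coded X} (B T : X -> nat) : PT B -> PT T ->
  PT (fun z => accept_clauses (B z) (T z)).
Proof. by apply: PT_app2; rewrite /accept_clauses; pt. Qed.

Lemma PT_tableau X {cX : coded X} (x : X -> seq bool) (T L : X -> nat) : PT x -> PT T -> PT L ->
  PT (fun z => tableau (x z) (T z) (L z)).
Proof.
apply: PT_app3; rewrite /tableau; apply: PT_cat; last apply: PT_cat.
- by apply: PT_init_clauses; pt.
- by pt; apply: PT_step_clauses; pt.
- by apply: PT_accept_clauses; pt.
Qed.

End Tableau.

Lemma all_flatten_map (A C : Type) (P : pred C) (f : A -> seq C) s :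
  all P (flatten [seq f a | a <- s]) = all (fun a => all P (f a)) s.
Proof. by elim: s => //= a s IH; rewrite all_cat IH. Qed.

Lemma all_cons1 (A : Type) (P : pred A) a s : all P (a :: s) = P a && all P s.
Proof. by []. Qed.

Lemma all_iota_ltP (P : pred nat) n : reflect (forall k, k < n -> P k) (all P (iota 0 n)).
Proof.
apply: (iffP allP) => H k; last by rewrite mem_iota => /andP[_]; apply: H.
by move=> lt; apply: H; rewrite mem_iota.
Qed.

(** * The clauses read as conditions on an assignment *)

Section TableauSpec.
Variable M : machine.
Local Notation S := (symbol (extra M)).
Local Notation Q := (state M).
Local Notation nI := (ntapes M).+1.
Local Notation nS := #|S|.
Local Notation var := (@tableau_var M).

Lemma all_symP (P : pred nat) : reflect (forall s : S, P (sym_rank s)) (all P (iota 0 nS)).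
Proof.
apply: (iffP (all_iota_ltP _ _)) => H; first by move=> s; apply: H; apply: sym_rank_lt.
by move=> k lt; have := H (enum_val (Ordinal lt)); rewrite /sym_rank enum_valK.
Qed.

Arguments premises : simpl never.
Arguments horn : simpl never.

Definition input_sym (x : seq bool) (j : nat) : S :=
  if j < size x then bit (extra M) (nth false x j) else None.

Lemma input_rankE x j : input_rank M x j = sym_rank (input_sym x j).
Proof. by rewrite /input_rank /input_sym; case: ifP => // _; case: (nth _ _ _). Qed.

Definition step_holds (tau : nat -> bool) (B t : nat) : Prop :=
  forall (q : Q) (s : {ffun 'I_nI -> S}),
    tau (var B t 0 nI (state_rank q)) ->
    (forall i : 'I_nI, tau (var B t B i (sym_rank (s i)))) ->
    tau (var B t.+1 0 nI (state_rank (next_state q s))) /\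
    forall (i : 'I_nI) k, 0 < k < 2 * B ->
      let a := next_action q s i in
      if k + move_code a.2 == B.+1 then is_true (tau (var B t.+1 k i (sym_rank a.1)))
      else forall s' : S, tau (var B t (k + move_code a.2 - 1) i (sym_rank s')) ->
        tau (var B t.+1 k i (sym_rank s')).

Definition init_holds (tau : nat -> bool) (x : seq bool) (B L : nat) : Prop :=
  tau (var B 0 0 nI (state_rank (start M))) /\
  forall (i : 'I_nI) k, k < 2 * B + 1 ->
    if (val i == 1) && (B <= k < B + L) then
      [|| tau (var B 0 k 1 (rank_bit M true)), tau (var B 0 k 1 (rank_bit M false))
        | tau (var B 0 k 1 (rank_blank M))] &&
      (tau (var B 0 k 1 (rank_blank M)) ==> tau (var B 0 k.+1 1 (rank_blank M)))
    else tau (var B 0 k i (sym_rank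
      (if (val i == 0) && (B <= k) then input_sym x (k - B) else None))).

Definition accept_holds (tau : nat -> bool) (B T : nat) : Prop :=
  forall s : S, tau (var B T B 0 (sym_rank s)) -> s = bit (extra M) true.

Lemma satisfying_step tau B t : satisfying tau (step_clauses M B t) <-> step_holds tau B t.
Proof.
rewrite /satisfying /step_clauses all_flatten_map /rules all_map; set P := has _.
have PE ps c : P (horn ps c) = (all tau ps ==> tau c) by exact: hornE.
clearbody P.
have prem q s : all tau (premises M B t (rule_of (q, s))) =
    tau (var B t 0 nI (state_rank q)) && [forall i : 'I_nI, tau (var B t B i (sym_rank (s i)))].
  rewrite /premises /= all_map all_map /=; congr (_ && _).
  by apply/allP/forallP => H i; [apply: H; rewrite mem_enum|move=> _; apply: H].
split=> [/allP H q s Hq Hs|H].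
  have {H} /= /andP[] := H (q, s) (mem_enum _ _).
  have Hp : all tau (premises M B t (rule_of (q, s))).
    by rewrite prem Hq; apply/forallP.
  rewrite PE Hp => Hn; rewrite all_flatten_map all_map => /allP H; split=> // i k lk.
  have := H i (mem_enum _ _); rewrite /= all_flatten_map => /all_iota_ltP /(_ k.-1).
  have -> : k.-1 < 2 * B - 1 by lia.
  move=> /(_ isT); rewrite prednK; last by lia.
  rewrite /cell_clauses /=; case: ifP => _.
    by rewrite /= PE Hp andbT.
  by rewrite all_map => /all_symP H1 s' Ht; have := H1 s'; rewrite /= PE all_cons1 Ht Hp.
apply/allP => -[q s] _; rewrite /= PE prem.
case E : (_ && [forall _, _]); last first.
  apply/andP; split=> //; rewrite all_flatten_map all_map; apply/allP => i _ /=.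
  rewrite all_flatten_map; apply/all_iota_ltP => k _; rewrite /cell_clauses.
  case: ifP => _; first by rewrite /= PE prem E.
  by rewrite all_map; apply/all_symP => s' /=; rewrite PE all_cons1 prem E andbF.
move/andP: E => [Hq /forallP Hs]; have [Hn Hc] := H q s Hq Hs.
rewrite /= Hn; rewrite all_flatten_map all_map; apply/allP => i _ /=.
rewrite all_flatten_map; apply/all_iota_ltP => k lk; rewrite /cell_clauses.
have lk' : 0 < k.+1 < 2 * B by lia.
have {Hc} /= := Hc i _ lk'; case: ifP => _ Hc; first by rewrite /= PE Hc implybT.
rewrite all_map; apply/all_symP => s' /=; rewrite PE all_cons1.
by case E : (tau _) => //=; rewrite Hc // implybT.
Qed.

Lemma satisfying_init tau x B L : satisfying tau (init_clauses M x B L) <-> init_holds tau x B L.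
Proof.
rewrite /satisfying /init_clauses; set P := has _.
have PE ps c : P (horn ps c) = (all tau ps ==> tau c) by exact: hornE.
have P1 v : P [:: (true, v)] = tau v by rewrite /P /= orbF eqb_id.
have P3 u v w : P [:: (true, u); (true, v); (true, w)] = [|| tau u, tau v | tau w].
  by rewrite /P /= orbF !eqb_id.
clearbody P; rewrite all_cons1 P1.
have E (i : 'I_nI) k : all P (init_cell M x B L k i) =
    (if (val i == 1) && (B <= k < B + L) then
      [|| tau (var B 0 k 1 (rank_bit M true)), tau (var B 0 k 1 (rank_bit M false))
        | tau (var B 0 k 1 (rank_blank M))] &&
      (tau (var B 0 k 1 (rank_blank M)) ==> tau (var B 0 k.+1 1 (rank_blank M)))
    else tau (var B 0 k i (sym_rank
      (if (val i == 0) && (B <= k) then input_sym x (k - B) else None)))).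
  rewrite /init_cell; case: ifP => _.
    by rewrite /= P3 PE /= !andbT.
  by rewrite /= P1 andbT; case: ifP => // _; rewrite input_rankE.
split=> [/andP[Hs H]|[Hs H]].
  split=> // i k lk; rewrite -E; move: H; rewrite all_flatten_map => /all_iota_ltP /(_ _ lk).
  by rewrite all_flatten_map => /all_iota_ltP; apply.
rewrite Hs all_flatten_map; apply/all_iota_ltP => k lk.
rewrite all_flatten_map; apply/all_iota_ltP => i li.
by have := H (Ordinal li) k lk; rewrite -E.
Qed.

Lemma satisfying_accept tau B T : satisfying tau (accept_clauses M B T) <-> accept_holds tau B T.
Proof.
rewrite /satisfying /accept_clauses all_flatten_map; split=> [/all_symP H s Hs|H].
  have := H s; case: ifP => [/eqP/sym_rank_inj //|_]; by rewrite /= Hs.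
apply/all_symP => s; case: ifP => // ns; rewrite /= orbF andbT.
case E : (tau _) => //; by rewrite (H s E) eqxx in ns.
Qed.

Lemma satisfying_tableau tau x T L :
  satisfying tau (tableau M x T L) <->
  [/\ init_holds tau x (T + L) L, forall t, t < T -> step_holds tau (T + L) t
    & accept_holds tau (T + L) T].
Proof.
rewrite /satisfying /tableau !all_cat all_flatten_map.
split=> [/and3P[/satisfying_init H1 /all_iota_ltP H2 /satisfying_accept H3]|[H1 H2 H3]].
  by split=> // t lt; apply/satisfying_step; apply: H2.
apply/and3P; split; [exact/satisfying_init| |exact/satisfying_accept].
by apply/all_iota_ltP => t lt; apply/satisfying_step; apply: H2.
Qed.

End TableauSpec.

(** * Satisfying assignments against accepting runs *)

Section TableauCorrect.
Variables (M : machine) (x : seq bool) (T L : nat).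
Local Notation S := (symbol (extra M)).
Local Notation Q := (state M).
Local Notation nI := (ntapes M).+1.
Local Notation nS := #|S|.
Local Notation nA := (nS + #|Q|).
Local Notation var := (@tableau_var M).
Local Notation B := (T + L).

Definition scans (c : config M) : {ffun 'I_nI -> S} := [ffun i => scan (ctapes c i)].

Lemma cstate_step c : cstate (step c) = next_state (cstate c) (scans c).
Proof. by rewrite /step /next_state; case: ifP => // _; case: (delta _ _). Qed.

Lemma move_codeE d : shift d = (Posz (move_code d) - 1)%R.
Proof. by case: d. Qed.

Lemma cell0 (t : tape (extra M)) : cell t 0%R = scan t.
Proof. by case: t => l []. Qed.

Lemma cell_step (c : config M) (i : 'I_nI) z : let a := next_action (cstate c) (scans c) i in
  cell (ctapes (step c) i) z =
  if (z + shift a.2 == 0)%R then a.1 else cell (ctapes c i) (z + shift a.2)%R.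
Proof.
rewrite /step /next_action; case: ifP => _ /=.
  by rewrite addr0; case: eqP => // ->; rewrite cell0 ffunE.
rewrite -/(scans c); case: (delta _ _) => q a /=; rewrite ffunE; case: (a i) => w d.
exact: cell_act.
Qed.

Lemma cell_init args (i : 'I_nI) (k b : nat) :
  cell (ctapes (init M args) i) (Posz k - Posz b)%R =
  if b <= k then input_sym M (nth [::] args i) (k - b) else None.
Proof.
rewrite ffunE; case: leqP => [le|lt].
  rewrite (subzn le) /cell /= /input_sym; case: ltnP => l1; first by rewrite (nth_map false).
  by rewrite nth_default // size_map.
have -> : (Posz k - Posz b)%R = Negz (b - k).-1 by lia.
by rewrite /= nth_nil.
Qed.

Local Notation conf y t := (iter t (@step M) (init M [:: x; y])).
Local Notation content y t i k := (cell (ctapes (conf y t) i) (Posz k - Posz B)%R).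

(** Any fact of the run on the extracted [y] is true under [tau], in particular the one about the
    output cell at time [T], where only the bit 1 is allowed. *)
Lemma tableau_sound tau : satisfying tau (tableau M x T L) ->
  exists y, size y <= L /\ forall w, computes_within M [:: x; y] [:: w] T -> w.
Proof.
case/satisfying_tableau => Hi Hs Ha.
pose blank j := tau (var B 0 (B + j) 1 (rank_blank M)).
(* The word ends before the first free cell marked blank; before it, a cell marked with both bits
   counts as 1, and one not marked 1 must be marked 0. *)
pose n := find blank (iota 0 L).
pose y := [seq tau (var B 0 (B + j) 1 (rank_bit M true)) | j <- iota 0 n].
have nL : n <= L by rewrite -[leqRHS](size_iota 0) find_size.
have sy : size y = n by rewrite size_map size_iota.
exists y; split; first by rewrite sy.
(* Only B cells on each side of the head are represented, so each step loses one
   cell at both ends. *)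
have inv t : t <= T -> tau (var B t 0 nI (state_rank (cstate (conf y t)))) /\
    forall (i : 'I_nI) k, t <= k <= 2 * B - t -> tau (var B t k i (sym_rank (content y t i k))).
  elim: t => [|t IH] lt.
    split=> [|i k /andP[_ lk]]; first exact: Hi.1.
    have lk' : k < 2 * B + 1 by lia.
    have := Hi.2 i k lk'; rewrite cell_init; case: ifP => [/andP[/eqP E1 /andP[lB lL]]|N1].
      rewrite lB E1 [nth _ _ _]/= /input_sym sy.
      have Ek : k = B + (k - B) by lia.
      case: ltnP => ln.
        have := before_find 0 ln; rewrite nth_iota; last by lia.
        rewrite /blank add0n -Ek => nb; rewrite nb orbF /= andbT.
        rewrite (nth_map 0) ?size_iota // nth_iota // add0n -Ek.
        by case E : (tau _).
      move=> _; suff H : forall d, n + d < L -> blank (n + d).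
        by have := H (k - B - n); rewrite /blank subnKC // -Ek; apply; lia.
      elim=> [|d IHd] ld.
        have hb : has blank (iota 0 L) by rewrite has_find size_iota -/n; lia.
        by have := nth_find 0 hb; rewrite -/n nth_iota ?addn0 //; lia.
      have k1 : B + (n + d) < 2 * B + 1 by lia.
      have := Hi.2 i _ k1; rewrite E1 eqxx leq_addr ltn_add2l /=.
      have -> : n + d < L by lia.
      by move=> /andP[_ /implyP]; rewrite addnS /blank addnS; apply; apply: IHd; lia.
    case: leqP => [lB|_]; last by rewrite andbF.
    rewrite andbT.
    case E0 : (val i == 0); first by rewrite [nat_of_ord i](eqP E0).
    case E1 : (val i == 1); last first.
      have -> : nth [::] [:: x; y] i = [::] by move: E0 E1 => /=; case: (nat_of_ord i) => [|[|[]]].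
      by [].
    rewrite [nat_of_ord i](eqP E1) /= /input_sym; case: ltnP => // ly.
    by move: N1; rewrite E1 lB /=; lia.
  have [Hq Hc] := IH (ltnW lt).
  have Hz : forall i : 'I_nI, tau (var B t B i (sym_rank (scans (conf y t) i))).
    move=> i; rewrite ffunE -cell0; have := Hc i B; rewrite subrr; apply; lia.
  have [H1 H2] := Hs t lt _ _ Hq Hz.
  split=> [|i k lk]; first by rewrite iterS cstate_step.
  rewrite iterS cell_step.
  have lk' : 0 < k < 2 * B by lia.
  have := H2 i k lk'; set a := next_action _ _ _; cbv zeta; rewrite move_codeE.
  case: eqP => [E|N]; first by have -> : (k%:Z - B%:Z + ((move_code a.2)%:Z - 1) == 0)%R by lia.
  have -> : (k%:Z - B%:Z + ((move_code a.2)%:Z - 1) == 0)%R = false by lia.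
  have lm : move_code a.2 <= 2 by case: (a.2).
  have -> : (k%:Z - B%:Z + ((move_code a.2)%:Z - 1) = (k + move_code a.2 - 1)%:Z - B%:Z)%R by lia.
  by apply; apply: Hc; lia.
move=> w [hal [r [Er _]]].
have [_ /(_ ord0 B)] := inv T (leqnn _).
rewrite subrr cell0 /scan Er /= => Hb; have Hb' : tau (var B T B 0 (sym_rank (bit (extra M) w))).
  by apply: Hb; lia.
by have [->] := Ha _ Hb'.
Qed.

Definition fact y t k i a : bool :=
  if i == nI then state_rank (cstate (conf y t)) == a
  else sym_rank (cell (ctapes (conf y t) (inord i)) (Posz k - Posz B)%R) == a.

(** Decodes the mixed-radix number [tableau_var] and evaluates the resulting fact on the run. *)
Definition assignment y (v : nat) : bool :=
  let w := v %/ nA in let u := w %/ nI.+1 in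
  fact y (u %/ (2 * B + 1)) (u %% (2 * B + 1)) (w %% nI.+1) (v %% nA).

Lemma assignmentE y t k i a : k < 2 * B + 1 -> i <= nI -> a < nA ->
  assignment y (var B t k i a) = fact y t k i a.
Proof.
move=> lk li la; rewrite /assignment /tableau_var.
have n0 : 0 < nA by case: (nA) la.
rewrite modnMDl divnMDl // (divn_small la) addn0 (modn_small la).
rewrite modnMDl divnMDl // (divn_small (_ : i < nI.+1)) // addn0 (modn_small (_ : i < nI.+1)) //.
by rewrite modnMDl divnMDl ?addn1 // -addn1 (divn_small lk) addn0 (modn_small lk).
Qed.

Lemma assignment_cell y t k (i : 'I_nI) s : k < 2 * B + 1 ->
  assignment y (var B t k i (sym_rank s)) = (content y t i k == s).
Proof.
move=> lk; rewrite assignmentE ?sym_rank_ltA //; last exact: ltnW.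
rewrite /fact (ltn_eqF (ltn_ord i)) inord_val; exact: (inj_eq (@sym_rank_inj M)).
Qed.

Lemma assignment_state y t q :
  assignment y (var B t 0 nI (state_rank q)) = (cstate (conf y t) == q).
Proof.
rewrite assignmentE ?state_rank_ltA ?addn1 // /fact eqxx; exact: (inj_eq (@state_rank_inj M)).
Qed.

Lemma tableau_complete y : size y <= L -> computes_within M [:: x; y] [:: true] T ->
  satisfying (assignment y) (tableau M x T L).
Proof.
move=> sy [hal [r [Er _]]]; apply/satisfying_tableau; split.
- split=> [|i k lk]; first by rewrite assignment_state.
  case: ifP => [/andP[/eqP E1 /andP[lB lL]]|N1].
    have k1 : k.+1 < 2 * B + 1 by lia.
    rewrite -{1 2 3 4 5}E1 /rank_bit /rank_blank !assignment_cell //= !cell_init.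
    rewrite lB (leqW lB) E1 /= /input_sym subSn //; case: (ltnP (k - B)) => l1.
      by case: (nth _ _ _).
    by rewrite /= ltnNge (leqW l1).
  rewrite assignment_cell // cell_init; case: leqP => lB; last by rewrite andbF.
  rewrite andbT; case E0 : (val i == 0); first by rewrite [nat_of_ord i](eqP E0).
  case E1 : (val i == 1); last first.
    by move: E0 E1 => /=; case: (nat_of_ord i) => [|[|[]]].
  rewrite [nat_of_ord i](eqP E1) /= /input_sym; case: ltnP => // ly.
  by move: N1; rewrite E1 lB /=; lia.
- move=> t lt q s; rewrite assignment_state => /eqP <- Hs.
  have {Hs} -> : s = scans (conf y t).
    apply/ffunP => i; have := Hs i; rewrite assignment_cell; last by lia.
    by rewrite subrr cell0 ffunE => /eqP.
  split=> [|i k lk]; first by rewrite assignment_state iterS cstate_step.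
  set a := next_action _ _ _; cbv zeta.
  have lk' : k < 2 * B + 1 by lia.
  have lm : move_code a.2 <= 2 by case: (a.2).
  have E := cell_step (conf y t) i (k%:Z - B%:Z)%R; cbv zeta in E.
  rewrite -iterS -/a move_codeE in E.
  case: eqP => [Ek|Nk]; [|move=> s'; rewrite assignment_cell; last by lia]; rewrite assignment_cell //.
    by rewrite E; have -> : (k%:Z - B%:Z + ((move_code a.2)%:Z - 1) == 0)%R by lia.
  move=> /eqP <-; rewrite E.
  have -> : (k%:Z - B%:Z + ((move_code a.2)%:Z - 1) == 0)%R = false by lia.
  by have -> : (k%:Z - B%:Z + ((move_code a.2)%:Z - 1) = (k + move_code a.2 - 1)%:Z - B%:Z)%R by lia.
- move=> s; rewrite (assignment_cell _ _ ord0); last by lia.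
  by rewrite subrr cell0 /scan Er => /eqP.
Qed.

End TableauCorrect.

(** * The reduction *)

Lemma computes_within_le M args w t t' : t <= t' ->
  @computes_within M args w t -> computes_within M args w t'.
Proof.
move=> le; rewrite -(subnK le) /computes_within iterD => -[h r].
elim: (t' - t) => [|d [h' r']] //=.
have E : step (iter d (@step M) (iter t (@step M) (init M args)))
    = iter d (@step M) (iter t (@step M) (init M args)) by rewrite {1}/step h'.
by rewrite /= E.
Qed.

(** The sum of the successors of all variable indices, a crude but easily computed substitute for
    their maximum. *)
Definition var_bound (F : seq clause) : nat :=
  size (flatten [seq nseq l.2.+1 tt | l <- flatten F]).

Lemma var_boundP F : all (all (fun l : literal => l.2 < var_bound F)) F.
Proof.
apply/allP => cl Hcl; apply/allP => l Hl.
have : l \in flatten F by apply/flattenP; exists cl.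
rewrite /var_bound; elim: (flatten F) => // l' s IH; rewrite inE -[flatten _]/(nseq l'.2.+1 tt ++ flatten _) size_cat size_nseq.
by case/orP => [/eqP-> | /IH H]; [exact: leq_addr|exact: leq_trans H (leq_addl _ _)].
Qed.

Section Reduction.
Variables (M : machine) (p q : {poly nat}).

Definition reduction_formula (x : seq bool) : seq clause :=
  tableau M x p.[size x + q.[size x]] q.[size x].

Definition reduction_map (x : seq bool) : seq bool :=
  encode_query (sat_query (var_bound (reduction_formula x)) (reduction_formula x)).

Lemma polytime_reduction_map : polytime reduction_map.
Proof.
have HF : PT reduction_formula by apply: PT_tableau; pt; exact: (PT_size_seq PT_id).
apply: PT_polytime; apply: PT_encode_sat_query => //.
by rewrite /var_bound; pt.
Qed.

Lemma reduction_formulaP V x :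
  (forall y, computes_within M [:: x; y] [:: V x y] p.[size x + size y]) ->
  (exists tau, satisfying tau (reduction_formula x)) <-> exists y, size y <= q.[size x] /\ V x y.
Proof.
move=> HV.
have HT y : size y <= q.[size x] -> computes_within M [:: x; y] [:: V x y] p.[size x + q.[size x]].
  by move=> le; apply: computes_within_le (HV y); apply: leq_horner; rewrite leq_add2l.
split=> [[tau /tableau_sound [y [sy Hy]]]|[y [sy Vxy]]].
  by exists y; split=> //; apply: Hy; apply: HT.
exists (assignment M x p.[size x + q.[size x]] q.[size x] y); apply: tableau_complete => //.
by rewrite -Vxy; apply: HT.
Qed.

(** The optimal query behind the string could differ from the constructed one. The verifier settles
    this in place of injectivity of the encoding: it sees only the string, so a certificate against
    the constructed query would also refute the other. *)
Lemma reduction_mapP (R : realType) x :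
  language_of encode_query (@query_optimal R) (reduction_map x) <->
  ~ exists tau, satisfying tau (reduction_formula x).
Proof.
have Hsat := sat_queryP R (var_boundP (reduction_formula x)).
split=> [[Q [EQ opt]]|/Hsat opt]; last by eexists.
apply/Hsat; apply: boolp.contrapT => /verify_complete [y [_]].
by rewrite -/(reduction_map x) -EQ => /(verify_sound (R := R)); apply.
Qed.

End Reduction.

Theorem proposition2 (R : realType) :
  coNP_complete (language_of encode_query (@query_optimal R)).
Proof.
split; first exact: membership.
move=> L' [V [M [p [q [HV HL]]]]]; exists (reduction_map M p q); split.
  exact: polytime_reduction_map.
move=> x; have E := reduction_formulaP q (HV x).
split=> [Lx|/reduction_mapP nsat].
  by apply/reduction_mapP => /E /HL.
by apply: boolp.contrapT => /HL /E.
Qed.
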